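(* Let $(\mathbb{L},\mu)$ be a random iterated function system on $\mathbb{R}^d$ (with index set $\Lambda$) which is non-extinguishing, i.e. $\int_\Lambda \mathcal{N}(\lambda)\,d\mu(\lambda)>1$, which satisfies the uniform open set condition, and all of whose maps $f_\lambda^i$ are similarities with contraction rates $c_\lambda^i$ satisfying $c_{\min}\le c_\lambda^i\le c_{\max}$ for all $\lambda\in\Lambda\setminus\{0\}$, $1\le i\le\mathcal{N}(\lambda)$, for some constants $0<c_{\min}\le c_{\max}<1$. Let $\mathbb{P}$ be the random recursive measure on the space $\mathcal{T}$ of labelled trees and let $F_\tau$ be the random set associated with $\tau\in\mathcal{T}$. Then, for $\mathbb{P}$-almost every $\tau\in\mathcal{T}$, $$\dim_{qA}F_\tau=\dim_H F_\tau ,$$ where $\dim_{qA}$ is the quasi-Assouad dimension and $\dim_H$ is the Hausdorff dimension.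
   Context: **Random iterated function systems.** Let $\Lambda\subset\mathbb{R}^k$ be compact (for some $k$) and let $\mu$ be a Borel probability measure on $\Lambda$. Fix $\mathcal{N}\in\mathbb{N}$. For each $\lambda\in\Lambda$ there is a finite iterated function system (IFS) $\mathbb{I}_\lambda=\{f_\lambda^1,\dots,f_\lambda^{\mathcal{N}(\lambda)}\}$ of maps $f_\lambda^i:\mathbb{R}^d\to\mathbb{R}^d$, with $\mathcal{N}(\lambda)\le\mathcal{N}$. If $0\in\Lambda$, then $0$ is an isolated point of $\Lambda$ and $\mathbb{I}_0=\varnothing$ (so $\mathcal{N}(0)=0$); for all $\lambda\in\Lambda\setminus\{0\}$ one has $\mathcal{N}(\lambda)\ge1$. The map $\lambda\mapsto\mathcal{N}(\lambda)$ and the dependence of $f_\lambda^i$ on $\lambda$ are Borel measurable. Put $\mathbb{L}=\{\mathbb{I}_\lambda\}_{\lambda\in\Lambda}$; the pair $(\mathbb{L},\mu)$ is a random iterated function system (RIFS). A similarity with contraction rate $c$ is a map $f$ with $\|f(x)-f(y)\|=c\|x-y\|$ for all $x,y$ (Euclidean norm). **Uniform open set condition (UOSC).** There exists a non-empty bounded open set $\mathcal{O}\subset\mathbb{R}^d$ such that for all $\lambda\in\Lambda\setminus\{0\}$ and all $1\le i,j\le\mathcal{N}(\lambda)$: $f_\lambda^i(\mathcal{O})\subseteq\mathcal{O}$, and $f_\lambda^i(\mathcal{O})\cap f_\lambda^j(\mathcal{O})\ne\varnothing$ implies $i=j$. **Labelled trees and the measure $\mathbb{P}$.** Let $\mathfrak{T}=\bigcup_{k\ge0}\{1,\dots,\mathcal{N}\}^k$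 be the set of nodes of the rooted $\mathcal{N}$-ary tree (the root is the empty tuple). Let $\mathcal{T}=\Lambda^{\mathfrak{T}}$ be the set of labellings $\tau:\mathfrak{T}\to\Lambda$, and let $\mathbb{P}$ be the product measure $\mu^{\otimes\mathfrak{T}}$, i.e. the labels $\tau(v)$, $v\in\mathfrak{T}$, are independent with law $\mu$. **Random recursive set.** For $\tau\in\mathcal{T}$, a node $v=(v_1,\dots,v_k)$ is called admissible if $v_{j+1}\le\mathcal{N}(\tau((v_1,\dots,v_j)))$ for all $0\le j<k$; for admissible $v$ put $$f_v=f_{\tau(\text{root})}^{v_1}\circ f_{\tau((v_1))}^{v_2}\circ\cdots\circ f_{\tau((v_1,\dots,v_{k-1}))}^{v_k}.$$ Then $F_\tau=\bigcap_{k=1}^\infty\ \bigcup_{v\text{ admissible of level }k} f_v(\Delta)$, where $\Delta\subset\mathbb{R}^d$ is a non-empty compact set with $f_\lambda^i(\Delta)\subseteq\Delta$ for all $\lambda\in\Lambda$, $1\le i\le\mathcal{N}(\lambda)$ (e.g. the closure of $\mathcal{O}$); $F_\tau$ is compact (possibly empty) and does not depend on the choice of $\Delta$. **Quasi-Assouad dimension.** For a totally bounded metric space $F$, $|F|$ denotes its diameter; $N_r(X)$ is the minimal number of sets of diameter at most $r$ needed to cover $X$; $N_{r,R}(F)=\max_{x\in F}N_r(B(x,R)\cap F)$, with $B(x,R)$ the open ball. For $\delta\ge0$, $$h(\delta,F)=\inf\{\alpha\ge 0\mid \exists C>0,\ \forall\, 0<r\le R^{1+\delta}\le|F|:\ N_{r,R}(F)\le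 C(R/r)^\alpha\},$$ and $\dim_{qA}F=\lim_{\delta\to0^+}h(\delta,F)$. All dimensions of the empty set are taken to be $0$. *)

(* Defs.v *)
From HB Require Import structures.
From mathcomp Require Import all_boot all_order all_algebra.
From mathcomp Require Import all_classical all_reals all_analysis.

Set Implicit Arguments.
Unset Strict Implicit.
Unset Printing Implicit Defensive.
Import Order.TTheory GRing.Theory Num.Theory.
Import numFieldNormedType.Exports.

Local Open Scope classical_set_scope.
Local Open Scope ring_scope.

Section EuclideanMetric.
Context {R : realType} {d : nat}.
Local Notation E := 'rV[R]_d.

(* The library norm on 'rV[R]_d is the sup norm. It induces the same topology
   as the Euclidean norm, so [open] and [compact] are taken from the library,
   while every metric notion below is Euclidean. *)
Definition enorm (x : E) : R := Num.sqrt (\sum_(i < d) x 0 i ^+ 2).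

Definition eball (x : E) (rho : R) : set E := [set y | enorm (x - y) < rho].

(* 0 is added to the set of distances so that diam set0 = 0 and not -oo. *)
Definition diam (U : set E) : \bar R :=
  ereal_sup (0%E |` [set (enorm (p.1 - p.2))%:E | p in U `*` U]).

Definition similarity (c : R) (f : E -> E) : Prop :=
  forall x y, enorm (f x - f y) = c * enorm (x - y).

End EuclideanMetric.

Section HausdorffDimension.
Context {R : realType} {d : nat}.
Local Notation E := 'rV[R]_d.
Local Open Scope ereal_scope.

(* |U|^s, with |set0|^s = 0 also for s = 0 (where 0 `^ 0 = 1), so that finite
   covers are countable covers padded with empty sets. *)
Definition diam_pow (s : R) (U : set E) : \bar R :=
  if `[< U = set0 >] then 0 else diam U `^ s.

Definition hausdorff_premeasure (s eps : R) (F : set E) : \bar R :=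
  ereal_inf [set \sum_(0 <= n <oo) diam_pow s (U n) | U in
    [set U : (set E)^nat |
      (forall n, diam (U n) <= eps%:E) /\ F `<=` \bigcup_n U n]].

Definition hausdorff_measure (s : R) (F : set E) : \bar R :=
  ereal_sup [set hausdorff_premeasure s eps F | eps in [set eps | (0 < eps)%R]].

Definition dim_H (F : set E) : \bar R :=
  ereal_inf [set s%:E | s in
    [set s : R | (0 <= s)%R /\ hausdorff_measure s F = 0]].

End HausdorffDimension.

Section QuasiAssouadDimension.
Context {R : realType} {d : nat}.
Local Notation E := 'rV[R]_d.
Local Open Scope ereal_scope.

(* N_r(X); it is +oo if no finite cover exists. *)
Definition cover_number (r : R) (X : set E) : \bar R :=
  ereal_inf [set n%:R%:E | n in
    [set n : nat | exists U : 'I_n -> set E,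
      (forall i, diam (U i) <= r%:E) /\ X `<=` \bigcup_i U i]].

(* N_{r,rho}(F); the supremum is a maximum when F is totally bounded. *)
Definition local_cover_number (r rho : R) (F : set E) : \bar R :=
  ereal_sup [set cover_number r (eball x rho `&` F) | x in F].

(* h(delta, F). The condition 0 < rho, implicit in 0 < r <= rho^(1+delta), is
   stated because the library power is total (a `^ x = 1 for a < 0). *)
Definition qA_exponent (delta : R) (F : set E) : \bar R :=
  ereal_inf [set alpha%:E | alpha in
    [set alpha : R | (0 <= alpha)%R /\
      exists2 C : R, (0 < C)%R &
        forall r rho : R, (0 < r)%R -> (0 < rho)%R ->
          (r <= rho `^ (1 + delta))%R -> (rho `^ (1 + delta))%:E <= diam F ->
          local_cover_number r rho F <= (C * (rho / r) `^ alpha)%:E]].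

Definition dim_qA (F : set E) : \bar R :=
  lim (qA_exponent delta F @[delta --> (0%R : R)^'+]).

End QuasiAssouadDimension.

Definition borel (T : ptopologicalType) := g_sigma_algebraType (@open T).

HB.instance Definition _ (T : ptopologicalType) :=
  Measurable.on (borel T).

(* Nonemptiness is implied by the existence of a probability on the set; it is
   a field because measurable types are pointed. *)
Record index_set (R : realType) (k : nat) := IndexSet {
  index_carrier :> set 'rV[R]_k;
  index_neq0 : index_carrier !=set0;
  index_compact : compact index_carrier;
  index_isolated0 : index_carrier 0 -> isolated index_carrier 0
}.

(* Lambda as a type, with the subspace topology. *)
Definition label (R : realType) (k : nat) (Lam : index_set R k) : Type :=
  set_type Lam.

Section LabelInstances.
Context (R : realType) (k : nat) (Lam : index_set R k).

Definition label_point : label Lam :=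
  exist _ (sval (cid (index_neq0 Lam)))
    (mem_set (svalP (cid (index_neq0 Lam)))).

HB.instance Definition _ := Topological.on (label Lam).
HB.instance Definition _ := isPointed.Build (label Lam) label_point.

End LabelInstances.

Definition label_val (R : realType) (k : nat) (Lam : index_set R k)
  (l : label Lam) : 'rV[R]_k := set_val l.

(* The map f_l^{i+1} is [rifs_map l i] for i < rifs_arity l; the values of
   [rifs_map l i] for other i are irrelevant. Borel dependence on the parameter
   is measurability of l |-> f_l^i x for every i and x. *)
Record rifs (R : realType) (k d Nmax : nat) := Rifs {
  rifs_index : index_set R k;
  rifs_law : probability (borel (label rifs_index)) R;
  rifs_arity : label rifs_index -> nat;
  rifs_map : label rifs_index -> 'I_Nmax -> 'rV[R]_d -> 'rV[R]_d;
  rifs_arity_le : forall l, (rifs_arity l <= Nmax)%N;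
  rifs_arity0 : forall l, label_val l = 0 -> rifs_arity l = 0%N;
  rifs_arity_gt0 : forall l, label_val l <> 0 -> (0 < rifs_arity l)%N;
  rifs_arity_measurable :
    measurable_fun [set: borel (label rifs_index)] rifs_arity;
  rifs_map_measurable : forall (i : 'I_Nmax) (x : 'rV[R]_d),
    measurable_fun [set l : borel (label rifs_index) | (i < rifs_arity l)%N]
      (fun l => rifs_map l i x : borel 'rV[R]_d)
}.

Section RandomRecursive.
Context {R : realType} {k d Nmax : nat} (L : rifs R k d Nmax).
Local Notation Lambda := (label (rifs_index L)).

Definition non_extinguishing : Prop :=
  (1 < \int[rifs_law L]_(l in setT) (rifs_arity l)%:R%:E)%E.

Definition uosc : Prop :=
  exists O : set 'rV[R]_d,
    [/\ O !=set0, (diam O < +oo)%E, open O &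
      forall l : Lambda, label_val l <> 0 ->
        (forall i : 'I_Nmax, (i < rifs_arity l)%N -> rifs_map l i @` O `<=` O) /\
        (forall i j : 'I_Nmax, (i < rifs_arity l)%N -> (j < rifs_arity l)%N ->
          (rifs_map l i @` O) `&` (rifs_map l j @` O) !=set0 -> i = j)].

Definition node := seq 'I_Nmax.

(* The labellings, with the product sigma-algebra. *)
Definition cylinders : set (set (node -> borel Lambda)) :=
  [set C | exists v (A : set (borel Lambda)),
    measurable A /\ C = [set tau | A (tau v)]].

Definition labelled_tree := g_sigma_algebraType cylinders.

HB.instance Definition _ := Measurable.on labelled_tree.

(* This determines P uniquely, as the product of copies of the law. *)
Definition random_recursive_measure (P : probability labelled_tree R) : Prop :=
  forall (s : seq node) (A : node -> set (borel Lambda)), uniq s ->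
    (forall v, measurable (A v)) ->
    P [set tau | forall v, v \in s -> A v (tau v)] =
      (\prod_(v <- s) rifs_law L (A v))%E.

Definition admissible (tau : labelled_tree) (v : node) : Prop :=
  forall j, (j < size v)%N ->
    (nth 0 [seq val i | i <- v] j < rifs_arity (tau (take j v)))%N.

(* The composition of the maps met when reading v downwards from node u. *)
Fixpoint node_map_from (tau : labelled_tree) (u v : node) :
    'rV[R]_d -> 'rV[R]_d :=
  if v is i :: w then rifs_map (tau u) i \o node_map_from tau (rcons u i) w
  else id.

Definition node_map (tau : labelled_tree) (v : node) := node_map_from tau [::] v.

Definition invariant_compact (D : set 'rV[R]_d) : Prop :=
  [/\ D !=set0, compact D &
    forall (l : Lambda) (i : 'I_Nmax), (i < rifs_arity l)%N ->
      rifs_map l i @` D `<=` D].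

Definition random_set (D : set 'rV[R]_d) (tau : labelled_tree) :
    set 'rV[R]_d :=
  \bigcap_(n in [set n | (0 < n)%N])
    \bigcup_(v in [set v | size v = n /\ admissible tau v])
      (node_map tau v @` D).

End RandomRecursive.

(* Main.v *)
(* Put [phi t = E (sum_i c_i^t)], which decreases strictly, and let [s] be the
   point where it crosses 1. For a set that is not empty both dimensions equal
   [s] almost surely.

   Upper bound. Let [t > s] and let [U] be the sum of [c_v^t] over all nodes
   [v] of the tree. As [phi t < 1] and the number of children is bounded, [U] has
   an exponential moment, by induction on the depth. Hence almost surely
   the values of [U] on the subtrees at the nodes [v] are at most [B + K |v|].
   By the open set condition boundedly many cylinders of size [rho] meet a ball
   of radius [rho], and a cylinder of size [rho] splits into at most
   [U (rho / r)^t] cylinders of size [r]. The factor [B + K |v|] is of order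
   [log (1 / rho)], which is negligible against powers of [rho / r] since
   [r <= rho^(1 + delta)].

   Lower bound. Let [0 < t < s] and let [M] be the minimal value of the sum of
   [c_v^t] over the cut sets of the tree. Truncated at depth [n], it satisfies
   [M_(n+1) = min 1 (sum_i c_i^t M_n(i))], and as [phi t > 1] a second order
   inclusion-exclusion bound shows that its mean does not tend to 0. So
   [M > 0] with positive probability. Both [M = 0] and extinction hold for a
   tree iff they hold for the subtrees of all children of the root, so their
   probabilities are fixed points of the generating function, which has only
   one fixed point below 1. So [M > 0] almost surely on non-extinction, and
   a cover of the set by small balls yields a cut set.

   Finally [dim_H <= h(delta, _)] holds for every bounded set. *)
Require Import Defs.
From HB Require Import structures.
From mathcomp Require Import all_boot all_order all_algebra.
From mathcomp Require Import all_classical all_reals all_analysis.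
From mathcomp Require Import measurable_realfun ring lra zify.

Set Implicit Arguments.
Unset Strict Implicit.
Unset Printing Implicit Defensive.
Import Order.TTheory GRing.Theory Num.Theory.
Import numFieldNormedType.Exports.

Local Open Scope classical_set_scope.
Local Open Scope ring_scope.

(** * Labelled trees and independence of subtrees *)

(** The law [P] is known only through its values on finitely many labels, so all independence is
    drawn from one fact: grafting an independent tree below a child of the root preserves [P].
    Expectations are then computed by resampling one child at a time. A bound on the mean of [U]
    would not suffice: there may be [Nmax^n] nodes at depth [n], and a bound linear in the depth
    that holds at all of them needs exponential tails. For the lower bound no random measure on the
    set is built. The capacity takes the place of a mass distribution: it is at most 1, decreases
    with the depth and bounds the sum over every cut set from below. Continuity of [phi] is avoided:
    [s] is a supremum, and [phi t' <= cmax^(t' - t) * phi t] separates the two sides of it strictly.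
    Measurability of the dimensions in the tree is avoided as well: the null sets come from events
    on masses and capacities at the exponents [s + 1/(j+1)] and [s - 1/(j+1)]. *)

Section Grafting.
Context {R : realType} {k d Nmax : nat} {L : rifs R k d Nmax}.
Local Notation Lab := (borel (label (rifs_index L))).
Local Notation Tree := (labelled_tree L).

Definition root_label (tau : Tree) : Lab := tau [::].

Definition child (i : 'I_Nmax) (tau : Tree) : Tree := fun v => tau (i :: v).

Definition graft (i : 'I_Nmax) (p : Tree * Tree) : Tree :=
  fun v => if v is j :: w then if j == i then p.2 w else p.1 v else p.1 v.

Lemma root_label_graft i p : root_label (graft i p) = root_label p.1.
Proof. by []. Qed.

Lemma child_graft i p : child i (graft i p) = p.2.
Proof. by apply: funext => v; rewrite /child /graft eqxx. Qed.

Lemma child_graft_neq i j p : j != i -> child j (graft i p) = child j p.1.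
Proof. by move=> /negPf ji; apply: funext => v; rewrite /child /graft ji. Qed.

Lemma measurable_label v : measurable_fun [set: Tree] (fun tau : Tree => tau v : Lab).
Proof.
by move=> _ A mA; rewrite setTI; apply: sub_sigma_algebra; exists v, A.
Qed.

Lemma measurable_tree_fun d' (T : measurableType d') (f : T -> Tree) :
  (forall v, measurable_fun [set: T] (fun x => f x v : Lab)) ->
  measurable_fun [set: T] f.
Proof.
move=> mf; apply: (@measurability _ _ _ Tree setT f (cylinders (L := L))) => //.
move=> _ [_ [v [A [mA ->]]] <-].
exact: mf.
Qed.

Lemma measurable_root_label : measurable_fun [set: Tree] root_label.
Proof. exact: measurable_label. Qed.

Lemma measurable_child i : measurable_fun [set: Tree] (child i).
Proof. by apply: measurable_tree_fun => v; exact: measurable_label. Qed.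

Lemma measurable_graft i : measurable_fun [set: Tree * Tree] (graft i).
Proof.
have m1 v : measurable_fun [set: Tree * Tree] (fun p => p.1 v : Lab).
  exact: measurableT_comp (measurable_label v) measurable_fst.
have m2 v : measurable_fun [set: Tree * Tree] (fun p => p.2 v : Lab).
  exact: measurableT_comp (measurable_label v) measurable_snd.
apply: measurable_tree_fun => -[|j w] /=; first exact: m1.
by rewrite /graft; case: (j == i); [exact: m2|exact: m1].
Qed.

(** The pi-system on which [random_recursive_measure] prescribes the values of [P]. *)
Definition boxes : set (set Tree) :=
  [set C | exists (s : seq (seq 'I_Nmax)) (A : seq 'I_Nmax -> set Lab),
    [/\ uniq s, forall v, measurable (A v) &
    C = [set tau : Tree | forall v, v \in s -> A v (tau v)]]].

Lemma boxes_setI : setI_closed boxes.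
Proof.
move=> _ _ [s [A [us mA ->]]] [s' [A' [us' mA' ->]]].
exists (undup (s ++ s')), (fun v => (if v \in s then A v else setT) `&`
  (if v \in s' then A' v else setT)); split; first exact: undup_uniq.
  by move=> v; apply: measurableI; case: ifP.
apply/seteqP; split => tau /=.
  move=> [h h'] v; rewrite mem_undup mem_cat => _.
  by split; case: ifP => // ?; [exact: h|exact: h'].
move=> h; split=> v vs.
  by have := h v; rewrite mem_undup mem_cat vs => /(_ isT)[].
by have := h v; rewrite mem_undup mem_cat vs orbT => /(_ isT)[].
Qed.

Lemma measurable_box C : boxes C -> measurable C.
Proof.
move=> [s [A [_ mA ->]]]; elim: s => [|v s IH].
  by rewrite (_ : [set _ | _] = setT)//; apply/seteqP; split.
rewrite (_ : [set _ | _] = ((fun tau : Tree => tau v) @^-1` A v) `&`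
   [set tau | forall w, w \in s -> A w (tau w)]).
  by apply: measurableI => //; rewrite -[X in measurable X]setTI; exact: measurable_label.
apply/seteqP; split => tau /= h.
  by split=> [|w ws]; apply: h; rewrite inE ?eqxx// ws orbT.
by move=> w; rewrite inE => /orP[/eqP->|/h.2//]; exact: h.1.
Qed.

Lemma boxes_generate : @measurable _ Tree = <<s boxes >>.
Proof.
apply/seteqP; split.
  apply: smallest_sub; first exact: smallest_sigma_algebra.
  move=> _ [v [A [mA ->]]]; apply: sub_sigma_algebra.
  exists [:: v], (fun=> A); split=> //.
  by apply/seteqP; split => tau /= h; [move=> w; rewrite inE => /eqP->
    |apply: h; rewrite inE].
apply: smallest_sub; first exact: sigma_algebra_measurable.
exact: measurable_box.
Qed.

Lemma eq_tree_measure (m1 m2 : {measure set Tree -> \bar R}) :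
  (m1 setT < +oo)%E -> (forall C, boxes C -> m1 C = m2 C) ->
  forall A, measurable A -> m1 A = m2 A.
Proof.
move=> m1oo m12 A mA; apply: (measure_unique boxes (fun=> setT)) => //.
- exact: boxes_generate.
- exact: boxes_setI.
- by move=> _; exists [::], (fun=> setT); split=> //; apply/seteqP; split.
- by rewrite bigcup_const//; exists 0%N.
Qed.

Context (P : probability Tree R) (hP : random_recursive_measure P).

Lemma product_setT : (P \x P)%E setT = 1%E.
Proof.
by rewrite -setXTT product_measure1E//= !probability_setT mule1.
Qed.

Definition starts_with (i : 'I_Nmax) (v : seq 'I_Nmax) : bool := ohead v == Some i.

Lemma graft_box i (s : seq (seq 'I_Nmax)) (A : seq 'I_Nmax -> set Lab) :
  graft i @^-1` [set tau : Tree | forall v, v \in s -> A v (tau v)] =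
  [set tau : Tree | forall v, v \in [seq v <- s | ~~ starts_with i v] -> A v (tau v)] `*`
  [set tau : Tree | forall v, v \in [seq behead v | v <- s & starts_with i v] ->
                       A (i :: v) (tau v)].
Proof.
apply/seteqP; split => -[t t'] /=.
  move=> h; split => v.
    rewrite mem_filter => /andP[iv vs]; have := h _ vs.
    rewrite /graft; case: v iv {vs} => //= j w; rewrite /starts_with /= => /negPf.
    by case: (j =P i) => [->|//]; rewrite eqxx.
  move=> /mapP[w]; rewrite mem_filter => /andP[iw ws] ->; have := h _ ws.
  by case: w iw {ws} => //= j w /eqP[->]; rewrite /graft eqxx.
move=> [h h'] v vs; case iv: (starts_with i v).
  case: v iv vs => // j w /eqP[->] vs; rewrite /graft eqxx; apply: h'.
  by apply/mapP; exists (i :: w) => //; rewrite mem_filter vs /starts_with/= eqxx.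
have -> : graft i (t, t') v = t v.
  case: v iv {vs} => // j w; rewrite /graft /starts_with/=.
  by case: (j =P i) => [->|]//; rewrite eqxx.
by apply: h; rewrite mem_filter iv.
Qed.

(** A box pulls back to a product of two boxes: labels below the child [i] are read from the second
    tree, all others from the first, and these groups concern disjoint sets of nodes. Agreement on
    the pi-system of boxes suffices. *)
Lemma graft_law i A : measurable A -> (P \x P)%E (graft i @^-1` A) = P A.
Proof.
move=> mA.
pose Q : {measure set Tree -> \bar R} :=
  measure_function_pushforward__canonical__measure_function_Measure (P \x P)%E (measurable_graft i).
suff QE : Q A = P A by exact: QE.
apply: (@eq_tree_measure Q P _ _ A mA).
  by rewrite [Q _]product_setT ltry.
move=> _ [s [B [us mB ->]]]; transitivity ((P \x P)%E (graft i @^-1`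
  [set tau : Tree | forall v, v \in s -> B v (tau v)])); first by [].
rewrite graft_box.
have u2 : uniq [seq behead v | v <- s & starts_with i v].
  rewrite map_inj_in_uniq ?filter_uniq// => -[|j v] [|j' v'];
    rewrite !mem_filter => /andP[/eqP iv _] /andP[/eqP iv' _]//=.
  by move: iv iv' => [->] [->] ->.
have u1 : uniq [seq v <- s | ~~ starts_with i v] by rewrite filter_uniq.
rewrite [LHS]product_measure1E; last 2 first.
- by apply: measurable_box; exists [seq v <- s | ~~ starts_with i v], B.
- by apply: measurable_box; exists [seq behead v | v <- s & starts_with i v],
    (fun v => B (i :: v)).
apply: eq_trans (congr2 mule (hP u1 mB) (hP u2 (fun v => mB (i :: v)))) _.
apply: (eq_trans _ (esym (hP us mB))).
rewrite big_map [in RHS](bigID (starts_with i))/= muleC !big_filter.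
by congr (_ * _)%E; apply: eq_bigr => -[|j w]//= /eqP[->].
Qed.

Lemma integral_graft (i : 'I_Nmax) (f : Tree -> \bar R) :
  measurable_fun [set: Tree] f -> (forall tau, 0 <= f tau)%E ->
  (\int[P]_tau f tau = \int[P]_tau \int[P]_tau' f (graft i (tau, tau')))%E.
Proof.
move=> mf f0.
have mg : measurable_fun [set: Tree * Tree] (f \o graft i).
  by apply: measurableT_comp => //; exact: measurable_graft.
pose Q : {measure set Tree -> \bar R} :=
  measure_function_pushforward__canonical__measure_function_Measure (P \x P)%E (measurable_graft i).
have -> : (\int[P]_tau f tau = \int[Q]_tau f tau)%E.
  by apply: eq_measure_integral => A mA _; exact/esym/graft_law.
have -> : (\int[Q]_tau f tau = \int[P \x P]_p (f \o graft i) p)%E.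
  by rewrite ge0_integral_pushforward//; exact: measurable_graft.
by rewrite fubini_tonelli1// => x; exact: f0.
Qed.

End Grafting.

(** * Branching property *)

Lemma emeasurable_prod {d} {T : measurableType d} {R : realType} {I : Type}
    (D : set T) (s : seq I) (h : I -> T -> \bar R) :
  (forall i, measurable_fun D (h i)) ->
  measurable_fun D (fun x => \prod_(i <- s) h i x)%E.
Proof.
move=> mh; elim: s => [|i s IH].
  by under eq_fun do rewrite big_nil; exact: measurable_cst.
by under eq_fun do rewrite big_cons; exact: emeasurable_funM.
Qed.

Section Branching.
Context {R : realType} {k d Nmax : nat} {L : rifs R k d Nmax}.
Local Notation Lab := (borel (label (rifs_index L))).
Local Notation Tree := (labelled_tree L).
Context (P : probability Tree R) (hP : random_recursive_measure P).
Local Open Scope ereal_scope.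

(** Given the root label, the subtrees at the children are independent copies of the whole tree. *)
Lemma integral_branching (g : 'I_Nmax -> Lab * Tree -> \bar R) :
  (forall i, measurable_fun [set: Lab * Tree] (g i)) ->
  (forall i x, 0 <= g i x) ->
  \int[P]_tau (\prod_(i < Nmax) g i (root_label tau, child i tau)) =
  \int[P]_tau (\prod_(i < Nmax) \int[P]_tau' g i (root_label tau, tau')).
Proof.
move=> mg g0.
pose G i l := \int[P]_tau' g i (l, tau').
have mG i : measurable_fun [set: Lab] (G i) by exact: measurable_fun_fubini_tonelli_F.
have G0 i l : 0 <= G i l by exact: integral_ge0.
have mgr i : measurable_fun [set: Tree] (fun tau => g i (root_label tau, child i tau)).
  apply: measurableT_comp => //.
  by apply: measurable_fun_pair; [exact: measurable_root_label|exact: measurable_child].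
(* The factor [h] collects what has already been integrated and depends on the root label only; each
   step resamples one further child. *)
suff H (s : seq 'I_Nmax) : uniq s -> forall h : Lab -> \bar R,
    measurable_fun [set: Lab] h -> (forall l, 0 <= h l) ->
    \int[P]_tau (h (root_label tau) * \prod_(i <- s) g i (root_label tau, child i tau)) =
    \int[P]_tau (h (root_label tau) * \prod_(i <- s) G i (root_label tau)).
  have := H (index_enum 'I_Nmax) (index_enum_uniq _) (cst 1) (measurable_cst _) (fun=> lee01).
  by under eq_integral do rewrite mul1e; move=> ->; under eq_integral do rewrite mul1e.
elim: s => [|i s IH] => [_ h _ _|/= /andP[si us] h mh h0].
  by apply: eq_integral => tau _; rewrite !big_nil.
rewrite (integral_graft hP i)//; first last.
- by move=> tau; rewrite mule_ge0// prode_ge0.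
- apply: emeasurable_funM; first exact: measurableT_comp mh measurable_root_label.
  exact: emeasurable_prod.
transitivity (\int[P]_tau (h (root_label tau) * G i (root_label tau) *
    \prod_(j <- s) g j (root_label tau, child j tau))).
  apply: eq_integral => tau _.
  transitivity (\int[P]_tau' (h (root_label tau) * \prod_(j <- s) g j (root_label tau, child j tau)
      * g i (root_label tau, tau'))).
    apply: eq_integral => tau' _; rewrite big_cons root_label_graft child_graft/=.
    rewrite [g i _ * _]muleC muleA; congr (_ * _ * _).
    by apply: eq_big_seq => j js; rewrite child_graft_neq//; apply: contraNneq si => <-.
  rewrite ge0_integralZl//.
  - by rewrite -/(G i (root_label tau)) -!muleA; congr (_ * _); exact: muleC.
  - by apply: (measurable_fun_pair2 (f := g i)); exact: mg.
  - by rewrite mule_ge0// prode_ge0.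
rewrite (IH us (fun l => h l * G i l)).
- by apply: eq_integral => tau _; rewrite big_cons muleA.
- exact: emeasurable_funM.
- by move=> l; rewrite mule_ge0.
Qed.
End Branching.
(** * Exponential moments of the total mass *)

Section ExponentialMoments.
Context {R : realType} {k d Nmax : nat} {L : rifs R k d Nmax}.
Local Notation Lab := (borel (label (rifs_index L))).
Local Notation Tree := (labelled_tree L).
Context (a : 'I_Nmax -> Lab -> R).

(** With the weights [c_i^t] this is [U] truncated at depth [n]; the 1 is the term of the root. *)
Fixpoint total_mass (n : nat) (tau : Tree) : R :=
  1 + if n is m.+1 then
        \sum_(i < Nmax) a i (root_label tau) * total_mass m (child i tau)
      else 0.

(* A bound on [exp_mass] for all depths bounds [total_mass] on all subtrees. *)
Fixpoint exp_mass (xi q : R) (n : nat) (tau : Tree) : R :=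
  expR (xi * total_mass n tau) +
    if n is m.+1 then q * \sum_(i < Nmax) exp_mass xi q m (child i tau) else 0.

Definition subtree (v : seq 'I_Nmax) (tau : Tree) : Tree := fun w => tau (v ++ w).

Lemma subtree_cons i v tau : subtree (i :: v) tau = subtree v (child i tau).
Proof. by []. Qed.

Context (ma : forall i, measurable_fun [set: Lab] (a i)).
Context (a_ge0 : forall i l, 0 <= a i l).

Lemma total_mass_ge1 n tau : 1 <= total_mass n tau.
Proof.
elim: n tau => [|n IH] tau /=; rewrite lerDl// sumr_ge0// => i _.
by rewrite mulr_ge0// (le_trans ler01).
Qed.

Lemma total_mass_ge0 n tau : 0 <= total_mass n tau.
Proof. exact: le_trans ler01 (total_mass_ge1 n tau). Qed.

Lemma measurable_total_mass n : measurable_fun [set: Tree] (total_mass n).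
Proof.
elim: n => [|n IH]; first by rewrite (_ : total_mass 0 = cst (1 + 0)).
apply: measurable_funD => //; apply: measurable_sum => i.
apply: measurable_funM; first exact: measurableT_comp (ma i) measurable_root_label.
exact: measurableT_comp IH (measurable_child i).
Qed.

Lemma exp_mass_ge0 xi q n tau : 0 <= q -> 0 <= exp_mass xi q n tau.
Proof.
move=> q0; elim: n tau => [|n IH] tau /=; first by rewrite addr0 expR_ge0.
by rewrite addr_ge0 ?expR_ge0// mulr_ge0// sumr_ge0.
Qed.

Lemma measurable_exp_mass xi q n : measurable_fun [set: Tree] (exp_mass xi q n).
Proof.
have mU m : measurable_fun [set: Tree] (fun tau => expR (xi * total_mass m tau)).
  apply: (measurableT_comp (@measurable_expR R)).
  exact: measurable_funM (measurable_cst xi) (measurable_total_mass m).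
elim: n => [|n IH].
  rewrite (_ : exp_mass xi q 0 = (fun tau => expR (xi * total_mass 0 tau)) \+ cst 0)//.
  exact: measurable_funD.
rewrite (_ : exp_mass xi q n.+1 = (fun tau => expR (xi * total_mass n.+1 tau)) \+
  (fun tau => q * \sum_(i < Nmax) exp_mass xi q n (child i tau)))//.
apply: measurable_funD => //; apply: measurable_funM => //.
by apply: measurable_sum => i; exact: measurableT_comp IH (measurable_child i).
Qed.

Lemma total_mass_nondecreasing n tau : total_mass n tau <= total_mass n.+1 tau.
Proof.
elim: n tau => [|n IH] tau /=.
  by rewrite lerD2l sumr_ge0// => i _; rewrite mulr_ge0// addr0.
by rewrite lerD2l ler_sum// => i _; rewrite ler_wpM2l//; exact: IH.
Qed.

Lemma exp_mass_nondecreasing xi q n tau : 0 <= xi -> 0 <= q ->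
  exp_mass xi q n tau <= exp_mass xi q n.+1 tau.
Proof.
move=> xi0 q0; elim: n tau => [|n IH] tau.
  rewrite /=; apply: lerD.
    by rewrite ler_expR ler_wpM2l// lerD2l sumr_ge0// => i _; rewrite mulr_ge0// addr0.
  by rewrite mulr_ge0// sumr_ge0// => i _; rewrite addr0 expR_ge0.
have E m : exp_mass xi q m.+1 tau = expR (xi * total_mass m.+1 tau) +
  q * \sum_(i < Nmax) exp_mass xi q m (child i tau) by [].
rewrite !E; apply: lerD; first by rewrite ler_expR ler_wpM2l//; exact: total_mass_nondecreasing.
by rewrite ler_wpM2l// ler_sum// => i _; exact: IH.
Qed.

(** Unfolded, [exp_mass] is a sum over the nodes [v] of [q^|v|] times the exponential of [xi] times
    the mass of the subtree at [v]. Each term is at most [B], and taking logarithms gives a bound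
    linear in [|v|]. *)
Lemma total_mass_subtree_le xi q B tau : 0 < xi -> 0 < q -> q < 1 -> 0 < B ->
  (forall n, exp_mass xi q n tau <= B) ->
  forall v n, total_mass n (subtree v tau) <=
    ln B / xi + (- ln q / xi) * (size v)%:R.
Proof.
move=> xi0 q0 q1 B0 hB.
have H v : forall n, exp_mass xi q n (subtree v tau) <= B / q ^+ size v.
  elim: v tau B B0 hB => [|i v IH] t B B0 hB n /=; first by rewrite divr1.
  rewrite subtree_cons exprS invfM mulrA; apply: IH; first by rewrite divr_gt0.
  move=> m; rewrite ler_pdivlMr// [leLHS]mulrC.
  apply: le_trans (hB m.+1).
  apply: (@le_trans _ _ (q * \sum_(j < Nmax) exp_mass xi q m (child j t))).
    rewrite (ler_wpM2l (ltW q0))// (bigD1 i)//= lerDl sumr_ge0// => j _.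
    exact: exp_mass_ge0 (ltW q0).
  by rewrite /= lerDr expR_ge0.
move=> v n; have h : expR (xi * total_mass n (subtree v tau)) <= B / q ^+ size v.
  apply: le_trans (H v n); case: n => [|n] /=; first by rewrite lerDl.
  rewrite lerDl; apply: mulr_ge0 (ltW q0) _; apply: sumr_ge0 => j _.
  exact: exp_mass_ge0 (ltW q0).
have : xi * total_mass n (subtree v tau) <= ln B + (- ln q) * (size v)%:R.
  by rewrite -ler_expR (le_trans h)// expRD expRM_natr expRN !lnK ?posrE// exprVn.
by rewrite mulrAC -mulrDl ler_pdivlMr// mulrC.
Qed.

End ExponentialMoments.

(** * Exponential moments uniformly in the depth *)

Lemma expR_le_quadratic {R : realType} (y : R) :
  0 <= y -> y <= 2^-1 -> expR y <= 1 + y + 2 * y ^+ 2.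
Proof.
move=> y0 y2; have h : 0 < 1 - y by lra.
rewrite -[y in leLHS]opprK expRN; apply: (@le_trans _ _ (1 - y)^-1).
  by rewrite lef_pV2 ?posrE ?expR_gt0// expR_ge1Dx.
(* Here [(1 - y)(1 + y + 2y^2) = 1 + y^2 (1 - 2y)]. *)
rewrite -div1r ler_pdivrMr//; nra.
Qed.

Lemma lee_prod {R : realDomainType} {I : Type} (s : seq I) (F G : I -> \bar R) :
  (forall i, 0 <= F i)%E -> (forall i, F i <= G i)%E ->
  (\prod_(i <- s) F i <= \prod_(i <- s) G i)%E.
Proof.
move=> F0 FG; elim: s => [|i s IH]; first by rewrite !big_nil.
by rewrite !big_cons lee_pmul// prode_ge0.
Qed.

Section ExponentialMomentBound.
Context {R : realType} {k d Nmax : nat} {L : rifs R k d Nmax}.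
Local Notation Lab := (borel (label (rifs_index L))).
Local Notation Tree := (labelled_tree L).
Context (P : probability Tree R) (hP : random_recursive_measure P).
Context (a : 'I_Nmax -> Lab -> R).
Context (ma : forall i, measurable_fun [set: Lab] (a i)).
Context (a_ge0 : forall i l, 0 <= a i l) (a_le1 : forall i l, a i l <= 1).
Context (phi : R) (phi1 : phi < 1).
Context (phiE : (\int[P]_tau (\sum_(i < Nmax) a i (root_label tau))%:E = phi%:E)%E).

(** The mean of [U] is at most [1 / (1 - phi)]. Doubling this gives [b * phi = b - 2], so the linear
    term [(1 + b * phi) x = (b - 1) x] leaves a slack of [x] below [b * x]; [xi] is small enough for
    the quadratic remainder to fit into it. *)
Let b := 2 / (1 - phi).
Let N : R := Nmax%:R.
Let xi := (2 * b ^+ 2 * (N + 1))^-1.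

Let phi_ge0 : 0 <= phi.
Proof.
rewrite -lee_fin -phiE integral_ge0// => tau _.
by rewrite lee_fin sumr_ge0.
Qed.

Let b_ge2 : 2 <= b.
Proof. by have := phi_ge0; move: phi1 => p1 p0; rewrite /b ler_pdivlMr; lra. Qed.

Let N_ge0 : 0 <= N. Proof. exact: ler0n. Qed.

Let xi_inv_gt0 : 0 < 2 * b ^+ 2 * (N + 1).
Proof.
move: b_ge2 N_ge0 => b2 N0.
by apply: mulr_gt0; [apply: mulr_gt0; [lra|apply: exprn_gt0; lra]|lra].
Qed.

Let xi_gt0 : 0 < xi.
Proof. by rewrite invr_gt0. Qed.

Let bphi : b * phi = b - 2.
Proof. by move: phi1 => p1; rewrite /b; field; apply: lt0r_neq0; lra. Qed.

Let exp_moment_step x : 0 <= x -> x <= xi ->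
  (\int[P]_tau (expR (x * (1 + \sum_(i < Nmax) b * a i (root_label tau))))%:E
     <= (expR (b * x))%:E)%E.
Proof.
move=> x0 xxi; move: b_ge2 N_ge0 xi_gt0 => b2 N0 xi0.
have xiE : xi * (2 * b ^+ 2 * (N + 1)) = 1 by rewrite mulVf// gt_eqF.
have mX : measurable_fun [set: Tree] (fun tau => \sum_(i < Nmax) a i (root_label tau)).
  by apply: measurable_sum => i; exact: measurableT_comp (ma i) measurable_root_label.
(* The sum of the weights is at most [N], so the quadratic term is at most [2 (b x)^2 N] times that
   sum. The bound becomes affine in the sum, and only the mean [phi] enters. *)
pose C := b * x * (1 + 2 * b * x * N).
have b0 : 0 <= b by lra.
have bx0 : 0 <= b * x by exact: mulr_ge0.
have bxN0 : 0 <= b * x * N by exact: mulr_ge0.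
have C0 : 0 <= C by rewrite /C; apply: mulr_ge0 => //; nra.
apply: (@le_trans _ _ (\int[P]_tau ((expR x)%:E + (expR x * C)%:E *
    (\sum_(i < Nmax) a i (root_label tau))%:E)))%E.
  apply: ge0_le_integral => //.
  - apply/measurable_EFinP; apply: (measurableT_comp (@measurable_expR R)).
    apply: (measurable_funM (measurable_cst x)).
    apply: (measurable_funD (measurable_cst (1 : R))).
    apply: measurable_sum => i; apply: (measurable_funM (measurable_cst b)).
    exact: measurableT_comp (ma i) measurable_root_label.
  - apply: emeasurable_funD => //; apply: emeasurable_funM => //.
    exact/measurable_EFinP.
  move=> tau _; rewrite -EFinM -EFinD lee_fin -mulr_sumr mulrDr mulr1 expRD.
  set X := \sum_(i < Nmax) _.
  have X0 : 0 <= X by exact: sumr_ge0.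
  have XN : X <= N.
    apply: (@le_trans _ _ (\sum_(i < Nmax) 1)); first exact: ler_sum.
    by rewrite sumr_const card_ord.
  have -> : expR x + expR x * C * X = expR x * (1 + C * X) by ring.
  rewrite ler_wpM2l ?expR_ge0//.
  have bxN : b * x * N <= 4^-1.
    have h1 : b * x * N <= b * xi * N by apply: ler_wpM2r => //; exact: ler_wpM2l.
    have h2 : 0 <= b * xi * N by rewrite mulr_ge0// mulr_ge0// ltW.
    have h3 : b * (b * xi * N) <= 2^-1.
      have : 0 <= xi * b ^+ 2 by rewrite mulr_ge0 ?sqr_ge0// ltW.
      have -> : b * (b * xi * N) = xi * (2 * b ^+ 2 * (N + 1)) / 2 - xi * b ^+ 2 by field.
      rewrite xiE; lra.
    nra.
  have bxX : b * x * X <= b * x * N by exact: ler_wpM2l.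
  have y0 : 0 <= x * (b * X) by rewrite mulr_ge0// mulr_ge0.
  have bxE : x * (b * X) = b * x * X by ring.
  have y1 : x * (b * X) <= 2^-1 by rewrite bxE; apply: (le_trans bxX); lra.
  apply: le_trans (expR_le_quadratic y0 y1) _.
  rewrite /C -addrA lerD2l.
  have -> : b * x * (1 + 2 * b * x * N) * X =
     x * (b * X) + 2 * (x * (b * X)) * (b * x * N) by ring.
  rewrite lerD2l expr2 mulrA ler_wpM2l//; first by rewrite mulr_ge0.
  by rewrite bxE.
rewrite ge0_integralD//; first last.
- by apply: emeasurable_funM => //; exact/measurable_EFinP.
- move=> tau _; apply: mule_ge0; rewrite lee_fin; last exact: sumr_ge0.
  by rewrite mulr_ge0// expR_ge0.
rewrite ge0_integralZl//; first last.
- by rewrite lee_fin mulr_ge0// expR_ge0.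
- by move=> tau _; rewrite lee_fin sumr_ge0.
- exact/measurable_EFinP.
rewrite phiE integral_cst//= probability_setT mule1 -EFinM -EFinD lee_fin.
have -> : expR x + expR x * C * phi = expR x * (1 + C * phi) by ring.
have -> : b * x = x + (b - 1) * x by ring.
rewrite expRD ler_wpM2l ?expR_ge0//; apply: le_trans (expR_ge1Dx _).
rewrite lerD2l /C.
have -> : b * x * (1 + 2 * b * x * N) * phi = (b * phi) * x * (1 + 2 * b * x * N) by ring.
rewrite bphi.
have h : 2 * b ^+ 2 * x * N <= 1.
  have b20 : 0 <= 2 * b ^+ 2 by rewrite mulr_ge0// sqr_ge0.
  apply: (@le_trans _ _ (xi * (2 * b ^+ 2 * N))); last first.
    by rewrite -[leRHS]xiE ler_wpM2l ?(ltW xi0)// ler_wpM2l// lerDl.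
  have -> : 2 * b ^+ 2 * x * N = x * (2 * b ^+ 2 * N) by ring.
  by rewrite ler_wpM2r// mulr_ge0.
have : (b - 2) * (2 * b * x * N) <= 1.
  apply: le_trans h; rewrite -subr_ge0.
  have -> : 2 * b ^+ 2 * x * N - (b - 2) * (2 * b * x * N) = 4 * b * x * N by ring.
  by rewrite mulr_ge0// mulr_ge0// mulr_ge0.
move=> h'; have -> : (b - 2) * x * (1 + 2 * b * x * N) =
  x * ((b - 2) + (b - 2) * (2 * b * x * N)) by ring.
by rewrite [leRHS]mulrC ler_wpM2l//; move: h'; lra.
Qed.

(** The branching property reduces depth [n + 1] to the moments at [x * a i] of depth [n]. As the
    weights are at most 1, these arguments stay below [xi]; the induction therefore runs over all
    [x], and the one-generation estimate closes it. *)
Lemma exp_moment_total_mass n x : 0 <= x -> x <= xi ->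
  (\int[P]_tau (expR (x * total_mass a n tau))%:E <= (expR (b * x))%:E)%E.
Proof.
elim: n x => [|n IH] x x0 xxi.
  under eq_integral do rewrite /= addr0 mulr1.
  rewrite integral_cst//= probability_setT mule1 lee_fin ler_expR.
  by rewrite -[leLHS]mul1r ler_wpM2r//; apply: le_trans b_ge2; lra.
pose g i (p : Lab * Tree) := (expR (x * a i p.1 * total_mass a n p.2))%:E.
have mg i : measurable_fun [set: Lab * Tree] (g i).
  apply/measurable_EFinP; apply: (measurableT_comp (@measurable_expR R)).
  apply: measurable_funM; last exact: measurableT_comp (measurable_total_mass ma n) measurable_snd.
  by apply: measurable_funM => //; exact: measurableT_comp (ma i) measurable_fst.
have g0 i p : (0 <= g i p)%E by rewrite lee_fin expR_ge0.
have -> : (\int[P]_tau (expR (x * total_mass a n.+1 tau))%:E = (expR x)%:E *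
    \int[P]_tau \prod_(i < Nmax) g i (root_label tau, child i tau))%E.
  rewrite -ge0_integralZl//; first last.
  - by move=> tau _; exact: prode_ge0.
  - apply: emeasurable_prod => i; apply: measurableT_comp => //.
    by apply: measurable_fun_pair; [exact: measurable_root_label|exact: measurable_child].
  apply: eq_integral => tau _ /=.
  rewrite mulrDr mulr1 expRD EFinM; congr (_ * _)%E.
  rewrite prodEFin mulr_sumr expR_sum; congr EFin.
  by apply: eq_bigr => i _; rewrite mulrA.
rewrite (integral_branching hP)//.
apply: le_trans (exp_moment_step x0 xxi).
have -> : (\int[P]_tau (expR (x * (1 + \sum_(i < Nmax) b * a i (root_label tau))))%:E =
  (expR x)%:E * \int[P]_tau \prod_(i < Nmax) (expR (b * (x * a i (root_label tau))))%:E)%E.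
  rewrite -ge0_integralZl//; first last.
  - by move=> tau _; apply: prode_ge0 => i _; rewrite lee_fin expR_ge0.
  - apply: emeasurable_prod => i; apply/measurable_EFinP.
    apply: (measurableT_comp (@measurable_expR R)).
    apply: (measurable_funM (measurable_cst b)); apply: (measurable_funM (measurable_cst x)).
    exact: measurableT_comp (ma i) measurable_root_label.
  apply: eq_integral => tau _ /=.
  rewrite mulrDr mulr1 expRD EFinM; congr (_ * _)%E.
  rewrite prodEFin mulr_sumr expR_sum; congr EFin.
  by apply: eq_bigr => i _; congr expR; ring.
rewrite lee_wpmul2l ?lee_fin ?expR_ge0//; apply: ge0_le_integral => //.
- by move=> tau _; apply: prode_ge0 => i _; exact: integral_ge0.
- apply: emeasurable_prod => i.
  have mG : measurable_fun [set: Lab] (fun l => \int[P]_tau' g i (l, tau'))%E.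
    exact: measurable_fun_fubini_tonelli_F.
  exact: measurableT_comp mG measurable_root_label.
- apply: emeasurable_prod => i; apply/measurable_EFinP.
  apply: (measurableT_comp (@measurable_expR R)).
  apply: (measurable_funM (measurable_cst b)); apply: (measurable_funM (measurable_cst x)).
  exact: measurableT_comp (ma i) measurable_root_label.
move=> tau _; apply: lee_prod => i; first exact: integral_ge0.
rewrite /g /=; apply: (IH (x * a i (root_label tau))); first by rewrite mulr_ge0.
by apply: le_trans xxi; rewrite ler_piMr.
Qed.

End ExponentialMomentBound.

(** * Almost sure bounds on the masses of all subtrees *)

Section BoundedMass.
Context {R : realType} {k d Nmax : nat} {L : rifs R k d Nmax}.
Local Notation Lab := (borel (label (rifs_index L))).
Local Notation Tree := (labelled_tree L).
Context (P : probability Tree R) (hP : random_recursive_measure P).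

Lemma integral_child (i : 'I_Nmax) (f : Tree -> \bar R) :
  measurable_fun [set: Tree] f -> (forall tau, 0 <= f tau)%E ->
  (\int[P]_tau f (child i tau) = \int[P]_tau f tau)%E.
Proof.
move=> mf f0; rewrite (integral_graft hP i) => [||tau]; last exact: f0.
  under eq_integral => tau _ do under eq_integral do rewrite child_graft.
  rewrite /= integral_cst//= probability_setT mule1//.
exact: measurableT_comp mf (measurable_child i).
Qed.

Context (a : 'I_Nmax -> Lab -> R).
Context (ma : forall i, measurable_fun [set: Lab] (a i)).
Context (a_ge0 : forall i l, 0 <= a i l) (a_le1 : forall i l, a i l <= 1).

(** The children contribute at most [q * Nmax * 2E <= E], so the bound [2E] reproduces itself. *)
Lemma exp_mass_integral_le xi q E n : 0 <= q -> 0 <= E -> 2 * q * Nmax%:R <= 1 ->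
  (forall n, \int[P]_tau (expR (xi * total_mass a n tau))%:E <= E%:E)%E ->
  (\int[P]_tau (exp_mass a xi q n tau)%:E <= (2 * E)%:E)%E.
Proof.
move=> q0 E0 qN hE.
have mU m : measurable_fun [set: Tree] (fun tau => (expR (xi * total_mass a m tau))%:E).
  apply/measurable_EFinP; apply: (measurableT_comp (@measurable_expR R)).
  exact: measurable_funM (measurable_cst xi) (measurable_total_mass ma m).
have mY m : measurable_fun [set: Tree] (fun tau => (exp_mass a xi q m tau)%:E).
  by apply/measurable_EFinP; exact: measurable_exp_mass.
have Y0 m tau : (0 <= (exp_mass a xi q m tau)%:E)%E.
  by rewrite lee_fin exp_mass_ge0.
have mYc m i : measurable_fun [set: Tree] (fun tau => (exp_mass a xi q m (child i tau))%:E).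
  exact: measurableT_comp (mY m) (measurable_child i).
elim: n => [|n IH].
  under eq_integral do rewrite /= addr0.
  by apply: le_trans (hE 0%N) _; rewrite lee_fin ler_peMl// ler1n.
have -> : (\int[P]_tau (exp_mass a xi q n.+1 tau)%:E =
    \int[P]_tau ((expR (xi * total_mass a n.+1 tau))%:E +
      q%:E * \sum_(i < Nmax) (exp_mass a xi q n (child i tau))%:E))%E.
  by apply: eq_integral => tau _; rewrite sumEFin.
rewrite ge0_integralD//; first last.
- by apply: emeasurable_funM => //; exact: emeasurable_sum.
- by move=> tau _; rewrite mule_ge0// sume_ge0.
rewrite ge0_integralZl//; first last.
- by move=> tau _; exact: sume_ge0.
- exact: emeasurable_sum.
rewrite ge0_integral_sum//.
have -> : (\sum_(i < Nmax) \int[P]_tau (exp_mass a xi q n (child i tau))%:E =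
  \sum_(i < Nmax) \int[P]_tau (exp_mass a xi q n tau)%:E)%E.
  by apply: eq_bigr => i _; exact: (integral_child i (mY n) (Y0 n)).
apply: (@le_trans _ _ (E%:E + q%:E * (\sum_(i < Nmax) (2 * E)%:E))%E).
  rewrite leeD// lee_wpmul2l ?lee_fin// lee_sum// => i _; exact: IH.
rewrite sumEFin -EFinM -EFinD lee_fin.
have -> : \sum_(i < Nmax) (2 * E) = 2 * E * Nmax%:R by rewrite sumr_const card_ord mulr_natr.
have -> : q * (2 * E * Nmax%:R) = E * (2 * q * Nmax%:R) by ring.
have : E * (2 * q * Nmax%:R) <= E * 1 by rewrite ler_wpM2l.
lra.
Qed.

(** [exp_mass] increases with the depth and has bounded means. By monotone convergence its limit is
    integrable, hence almost surely finite, and this limit bounds all depths at once. *)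
Lemma ae_total_mass_bounded (phi : R) : phi < 1 ->
  (\int[P]_tau (\sum_(i < Nmax) a i (root_label tau))%:E = phi%:E)%E ->
  {ae P, forall tau, exists B K : R, 0 <= K /\
    forall v n, total_mass a n (subtree v tau) <= B + K * (size v)%:R}.
Proof.
move=> phi1 phiE.
have [xi xi0 [E E0 hE]] : exists2 xi, 0 < xi & exists2 E, 0 <= E &
    (forall n, \int[P]_tau (expR (xi * total_mass a n tau))%:E <= E%:E)%E.
  have h0 : 0 < 2 * (2 / (1 - phi)) ^+ 2 * (Nmax%:R + 1 : R).
    rewrite mulr_gt0 ?ltr_wpDl// mulr_gt0// exprn_gt0// divr_gt0//; lra.
  exists (2 * (2 / (1 - phi)) ^+ 2 * (Nmax%:R + 1))^-1; first by rewrite invr_gt0.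
  exists (expR (2 / (1 - phi) * (2 * (2 / (1 - phi)) ^+ 2 * (Nmax%:R + 1))^-1)).
    exact: expR_ge0.
  move=> n; apply: (exp_moment_total_mass hP ma a_ge0 a_le1 phi1 phiE) => //.
  by rewrite invr_ge0 ltW.
pose q : R := (2 * (Nmax%:R + 1))^-1.
have q0 : 0 < q by rewrite invr_gt0 mulr_gt0// ltr_wpDl.
have q1 : q < 1.
  by rewrite invf_lt1 ?mulr_gt0// ?ltr_wpDl//; have := ler0n R Nmax; lra.
have qN : 2 * q * Nmax%:R <= 1.
  have : q * (2 * (Nmax%:R + 1)) = 1 by rewrite mulVf// gt_eqF// mulr_gt0// ltr_wpDl.
  lra.
pose Y n (tau : Tree) := (exp_mass a xi q n tau)%:E.
have mY n : measurable_fun [set: Tree] (Y n).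
  by apply/measurable_EFinP; exact: measurable_exp_mass.
have Y0 n tau : (0 <= Y n tau)%E by rewrite lee_fin exp_mass_ge0// ltW.
have ndY tau : {homo Y ^~ tau : n m / (n <= m)%N >-> (n <= m)%E}.
  by apply/nondecreasing_seqP => n; rewrite lee_fin exp_mass_nondecreasing// ltW.
have lim_le : (\int[P]_tau limn (Y ^~ tau) <= (2 * E)%:E)%E.
  rewrite monotone_convergence//.
  apply: lime_le.
    apply: ereal_nondecreasing_is_cvgn => n m nm; apply: ge0_le_integral => // tau _.
    exact: ndY.
  by apply: nearW => n; apply: exp_mass_integral_le => //; exact: ltW.
have Yn_le n tau : (Y n tau <= limn (Y ^~ tau))%E.
  have /cvg_lim -> // := ereal_nondecreasing_cvgn (ndY tau).
  by apply: ereal_sup_ubound; exists n.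
have int : P.-integrable setT (fun tau => limn (Y ^~ tau)).
  apply/integrableP; split.
    apply: (emeasurable_fun_cvg Y) => // tau _.
    exact: ereal_nondecreasing_is_cvgn.
  apply: le_lt_trans (ltry (2 * E)); apply: le_trans lim_le.
  under eq_integral => tau _ do rewrite gee0_abs ?(le_trans (Y0 0%N tau))//.
  by [].
have := integrable_ae measurableT int; apply: filterS => tau /(_ I) fin.
pose B := fine (limn (Y ^~ tau)).
have hB n : exp_mass a xi q n tau <= B + 1.
  have : exp_mass a xi q n tau <= B by rewrite -lee_fin fineK//; exact: Yn_le.
  lra.
have B0 : 0 < B + 1 by apply: lt_le_trans (hB 0%N); rewrite /= addr0 expR_gt0.
exists (ln (B + 1) / xi), (- ln q / xi); split; last exact: total_mass_subtree_le.
by rewrite divr_ge0 ?ltW// oppr_gt0 ln_lt0// q0.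
Qed.

End BoundedMass.
(** * Capacity of the tree *)

(** Since [y_i^2 <= y_i], the double sum is at least [S^2 - S = S (S - 1)], which is at least
    [S - 1] when [S >= 1]; when [S < 1] it is enough that it is nonnegative. *)
Lemma min1_sum_bonferroni {R : realFieldType} {I : finType} (y : I -> R) :
  (forall i, 0 <= y i <= 1) ->
  \sum_i y i <= Num.min 1 (\sum_i y i) + \sum_i \sum_(j | j != i) y i * y j.
Proof.
move=> y01; set S := \sum_i y i.
have S0 : 0 <= S by apply: sumr_ge0 => i _; have /andP[] := y01 i.
have -> : \sum_i \sum_(j | j != i) y i * y j = S ^+ 2 - \sum_i y i ^+ 2.
  rewrite expr2 mulr_suml -sumrB; apply: eq_bigr => i _.
  rewrite -mulr_sumr [S](bigD1 i)//= mulrDr expr2 addrAC subrr add0r.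
  by [].
have h2 : \sum_i y i ^+ 2 <= S.
  by apply: ler_sum => i _; have /andP[y0 y1] := y01 i; rewrite expr2 ler_piMr.
have h3 : \sum_i y i ^+ 2 <= S ^+ 2.
  rewrite [leRHS]expr2 mulr_suml; apply: ler_sum => i _; have /andP[y0 y1] := y01 i.
  rewrite expr2 ler_wpM2l// /S (bigD1 i)//= lerDl sumr_ge0// => j _.
  by have /andP[] := y01 j.
by case: (leP 1 S) => S1; [nra|lra].
Qed.

Lemma archimedean_inv_lt {R : archiRealFieldType} (e : R) :
  0 < e -> exists j : nat, j.+1%:R^-1 < e.
Proof.
move=> e0; exists (Num.truncn e^-1); rewrite invf_plt ?posrE//.
exact: truncnS_gt.
Qed.

Section Capacity.
Context {R : realType} {k d Nmax : nat} {L : rifs R k d Nmax}.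
Local Notation Lab := (borel (label (rifs_index L))).
Local Notation Tree := (labelled_tree L).
Context (a : 'I_Nmax -> Lab -> R).

(* The minimum of the sum of the products of weights over the cut sets of depth at
   most [n]. *)
Fixpoint capacity (n : nat) (tau : Tree) : R :=
  if n is m.+1 then
    Num.min 1 (\sum_(i < Nmax) a i (root_label tau) * capacity m (child i tau))
  else 1.

Context (ma : forall i, measurable_fun [set: Lab] (a i)).
Context (a_ge0 : forall i l, 0 <= a i l) (a_le1 : forall i l, a i l <= 1).

Lemma measurable_capacity n : measurable_fun [set: Tree] (capacity n).
Proof.
elim: n => [|n IH]; first by rewrite (_ : capacity 0 = cst 1).
apply: (measurable_minr (measurable_cst (1 : R))).
apply: measurable_sum => i; apply: measurable_funM.
  exact: measurableT_comp (ma i) measurable_root_label.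
exact: measurableT_comp IH (measurable_child i).
Qed.

Lemma capacity_ge0 n tau : 0 <= capacity n tau.
Proof.
elim: n tau => [|n IH] tau //=; rewrite le_min ler01/= sumr_ge0// => i _.
by rewrite mulr_ge0.
Qed.

Lemma capacity_le1 n tau : capacity n tau <= 1.
Proof. by case: n => [|n] //=; rewrite ge_min lexx. Qed.

Lemma capacity_le_sum n tau : capacity n.+1 tau <=
  \sum_(i < Nmax) a i (root_label tau) * capacity n (child i tau).
Proof. by rewrite /= ge_min lexx orbT. Qed.

Lemma capacity_nonincreasing tau n m : (n <= m)%N -> capacity m tau <= capacity n tau.
Proof.
suff H q : forall t, capacity q.+1 t <= capacity q t.
  by move=> /subnK <-; elim: (m - n)%N => // p IHp; exact: le_trans (H _ _) IHp.
elim: q => [|q IH] t; first exact: capacity_le1.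
have E p : capacity p.+1 t = Num.min 1
  (\sum_(i < Nmax) a i (root_label t) * capacity p (child i t)) by [].
rewrite !E le_min2// ler_sum// => i _; rewrite ler_wpM2l//.
Qed.

(** The event that the limit [M] of the capacities is 0, in a form with countable quantifiers
    only. *)
Definition capacity_vanishing : set Tree :=
  [set tau | forall j : nat, exists n, capacity n tau < j.+1%:R^-1].

Lemma measurable_capacity_vanishing : measurable capacity_vanishing.
Proof.
rewrite (_ : capacity_vanishing =
  \bigcap_j \bigcup_n (capacity n @^-1` `]-oo, j.+1%:R^-1[)).
  apply: bigcap_measurable => // j _; apply: bigcup_measurable => n _.
  by rewrite -[X in measurable X]setTI; apply: measurable_capacity.
apply/seteqP; split => tau h j.
  by move=> _; have [n hn] := h j; exists n => //=; rewrite in_itv.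
by have [n _ /=] := h j I; rewrite in_itv/= => hn; exists n.
Qed.

Context (P : probability Tree R) (hP : random_recursive_measure P).
Context (phi : R) (phi1 : 1 < phi).
Context (phiE : (\int[P]_tau (\sum_(i < Nmax) a i (root_label tau))%:E = phi%:E)%E).

Let N : R := Nmax%:R.
(** Chosen such that [N^2 eta^2 <= eta (phi - 1)]: at mean [eta] the second order loss does not
    exceed the first order gain. *)
Let eta : R := Num.min 1 ((phi - 1) / (N ^+ 2 + 1)).

Let eta_gt0 : 0 < eta.
Proof. by rewrite lt_min ltr01 divr_gt0 ?subr_gt0// ltr_wpDl ?sqr_ge0. Qed.

Let eta_le1 : eta <= 1. Proof. by rewrite ge_min lexx. Qed.

Let eta_le : N ^+ 2 * eta <= phi - 1.
Proof.
have h : 0 < N ^+ 2 + 1 by rewrite ltr_wpDl ?sqr_ge0.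
have : eta <= (phi - 1) / (N ^+ 2 + 1) by rewrite ge_min lexx orbT.
rewrite ler_pdivlMr//; move: eta_gt0; lra.
Qed.

Let capE n := fine (\int[P]_tau (capacity n tau)%:E).

Let mcap n : measurable_fun [set: Tree] (fun tau => (capacity n tau)%:E).
Proof. by apply/measurable_EFinP; exact: measurable_capacity. Qed.

Let mcapc n i : measurable_fun [set: Tree] (fun tau => (capacity n (child i tau))%:E).
Proof. exact: measurableT_comp (mcap n) (measurable_child i). Qed.

Let cap0 n tau : (0 <= (capacity n tau)%:E)%E.
Proof. by rewrite lee_fin capacity_ge0. Qed.

Let capEE n : (\int[P]_tau (capacity n tau)%:E = (capE n)%:E)%E.
Proof.
rewrite fineK// ge0_fin_numE; last by apply: integral_ge0 => tau _.
apply: (@le_lt_trans _ _ (\int[P]_tau (cst 1 tau)))%E; last first.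
  by rewrite integral_cst//= probability_setT mule1 ltry.
by apply: ge0_le_integral => // tau _; rewrite lee_fin capacity_le1.
Qed.

Let integral_cap_pair n i j : j != i ->
  (\int[P]_tau ((capacity n (child i tau))%:E * (capacity n (child j tau))%:E) =
   (capE n ^+ 2)%:E)%E.
Proof.
move=> ji; rewrite (integral_graft hP i); last 2 first.
- exact: emeasurable_funM.
- by move=> tau; rewrite mule_ge0.
under eq_integral => tau _.
  under eq_integral do rewrite child_graft child_graft_neq//=.
  rewrite ge0_integralZr// capEE.
over.
have capE0 : (0 <= (capE n)%:E)%E by rewrite -capEE integral_ge0.
by rewrite /= ge0_integralZl// (integral_child hP j (mcap n) (cap0 n)) capEE.
Qed.

Let integral_cap_weighted n i :
  (\int[P]_tau ((a i (root_label tau))%:E * (capacity n (child i tau))%:E) =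
   (capE n)%:E * \int[P]_tau (a i (root_label tau))%:E)%E.
Proof.
have mar : measurable_fun [set: Tree] (fun tau => (a i (root_label tau))%:E).
  by apply/measurable_EFinP; exact: measurableT_comp (ma i) measurable_root_label.
have ar0 tau : (0 <= (a i (root_label tau))%:E)%E by rewrite lee_fin.
rewrite (integral_graft hP i); last 2 first.
- exact: emeasurable_funM.
- by move=> tau; rewrite mule_ge0.
under eq_integral => tau _.
  under eq_integral do rewrite child_graft root_label_graft/=.
  rewrite ge0_integralZl// capEE muleC.
over.
by rewrite /= ge0_integralZl// -capEE integral_ge0.
Qed.

Lemma capacity_integral_ge n :
  (eta%:E <= \int[P]_tau (capacity n tau)%:E)%E.
Proof.
elim: n => [|n IH].
  rewrite (eq_integral (cst 1%E))// integral_cst//= probability_setT mule1 lee_fin.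
  exact: eta_le1.
have eta0 := eta_gt0; have eta1 := eta_le1.
have m_ge : eta <= capE n by rewrite -lee_fin -capEE.
have m_gt0 : 0 < capE n by exact: lt_le_trans m_ge.
(* At a large mean the second order loss could exceed the gain. Rescaling brings the mean down to
   exactly [eta], and the next mean is then at least [eta * phi - N^2 eta^2 >= eta]. *)
pose kap := eta / capE n.
have kap0 : 0 <= kap by rewrite divr_ge0// ltW.
have kap1 : kap <= 1 by rewrite ler_pdivrMr// mul1r.
have kapE : kap * capE n = eta by rewrite divfK// gt_eqF.
pose cc i tau := (capacity n (child i tau))%:E.
have mcc i : measurable_fun [set: Tree] (cc i) by exact: mcapc.
have cc0 i tau : (0 <= cc i tau)%E by exact: cap0.
have mar i : measurable_fun [set: Tree] (fun tau => (a i (root_label tau))%:E).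
  by apply/measurable_EFinP; exact: measurableT_comp (ma i) measurable_root_label.
have ar0 i tau : (0 <= (a i (root_label tau))%:E)%E by rewrite lee_fin.
(* As [kap <= 1], the truncated rescaled sum is at most the next capacity. In the pair terms the
   weights, which share the root label, are bounded by 1, so that only independent subtrees
   remain. *)
have pointwise tau :
  (kap%:E * (\sum_(i < Nmax) (a i (root_label tau))%:E * cc i tau) <=
   (capacity n.+1 tau)%:E + (kap ^+ 2)%:E *
     \sum_(i < Nmax) \sum_(j < Nmax | j != i) cc i tau * cc j tau)%E.
  pose y i := kap * (a i (root_label tau) * capacity n (child i tau)).
  have y01 i : 0 <= y i <= 1.
    have c0 := capacity_ge0 n (child i tau); have c1 := capacity_le1 n (child i tau).
    have ac0 : 0 <= a i (root_label tau) * capacity n (child i tau) by exact: mulr_ge0.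
    have ac1 : a i (root_label tau) * capacity n (child i tau) <= 1 by exact: mulr_ile1.
    by apply/andP; split; [exact: mulr_ge0|exact: mulr_ile1].
  have -> : (\sum_(i < Nmax) (a i (root_label tau))%:E * cc i tau =
     (\sum_(i < Nmax) a i (root_label tau) * capacity n (child i tau))%:E)%E.
    by rewrite -sumEFin.
  have -> : (\sum_(i < Nmax) \sum_(j < Nmax | j != i) cc i tau * cc j tau =
     (\sum_(i < Nmax) \sum_(j < Nmax | j != i)
        capacity n (child i tau) * capacity n (child j tau))%:E)%E.
    by rewrite -sumEFin; apply: eq_bigr => i _; rewrite -sumEFin.
  rewrite -!EFinM -EFinD lee_fin mulr_sumr.
  apply: le_trans (min1_sum_bonferroni y01) _.
  apply: lerD.
    rewrite /= le_min2// ler_sum// => i _; rewrite ler_piMl// mulr_ge0//.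
    exact: capacity_ge0.
  rewrite mulr_sumr ler_sum// => i _; rewrite mulr_sumr ler_sum// => j _.
  have ci := capacity_ge0 n (child i tau); have cj := capacity_ge0 n (child j tau).
  rewrite /y mulrACA -expr2 ler_wpM2l ?sqr_ge0//.
  by apply: ler_pM; rewrite ?mulr_ge0// ler_piMl.
have msum : measurable_fun [set: Tree]
  (fun tau => \sum_(i < Nmax) (a i (root_label tau))%:E * cc i tau)%E.
  by apply: emeasurable_sum => i; exact: emeasurable_funM.
have mpair i : measurable_fun [set: Tree]
    (fun tau => \sum_(j < Nmax | j != i) cc i tau * cc j tau)%E.
  rewrite (_ : (fun tau => _) = fun tau =>
    (\sum_(j <- [seq j <- index_enum 'I_Nmax | j != i]) cc i tau * cc j tau)%E); last first.
    by apply: funext => tau; rewrite big_filter.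
  by apply: emeasurable_sum => j; exact: emeasurable_funM.
have mdouble : measurable_fun [set: Tree]
  (fun tau => \sum_(i < Nmax) \sum_(j < Nmax | j != i) cc i tau * cc j tau)%E.
  exact: emeasurable_sum.
have pair0 i tau : (0 <= \sum_(j < Nmax | j != i) cc i tau * cc j tau)%E.
  by apply: sume_ge0 => j _; rewrite mule_ge0.
have : (\int[P]_tau (kap%:E * (\sum_(i < Nmax) (a i (root_label tau))%:E * cc i tau)) <=
   \int[P]_tau ((capacity n.+1 tau)%:E + (kap ^+ 2)%:E *
     \sum_(i < Nmax) \sum_(j < Nmax | j != i) cc i tau * cc j tau))%E.
  apply: ge0_le_integral => //.
  - by move=> tau _; rewrite mule_ge0 ?lee_fin// sume_ge0// => i _; rewrite mule_ge0.
  - exact: emeasurable_funM.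
  - by apply: emeasurable_funD => //; exact: emeasurable_funM.
rewrite ge0_integralZl//; first last.
- by move=> tau _; rewrite sume_ge0// => i _; rewrite mule_ge0.
rewrite ge0_integral_sum//; first last.
- by move=> i tau _; rewrite mule_ge0.
- by move=> i; exact: emeasurable_funM.
under [X in (_ * X <= _)%E]eq_bigr do rewrite integral_cap_weighted.
rewrite -ge0_sume_distrr; last by move=> i _; exact: integral_ge0.
rewrite -ge0_integral_sum//.
under [X in (_ * (_ * X) <= _)%E]eq_integral do rewrite sumEFin.
rewrite phiE.
rewrite ge0_integralD//; first last.
- exact: emeasurable_funM.
- by move=> tau _; rewrite mule_ge0 ?lee_fin ?sqr_ge0// sume_ge0.
rewrite ge0_integralZl//; first last.
- by rewrite lee_fin sqr_ge0.
- by move=> tau _; exact: sume_ge0.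
rewrite ge0_integral_sum//.
have -> : (\sum_(i < Nmax) \int[P]_tau \sum_(j < Nmax | j != i) cc i tau * cc j tau =
  \sum_(i < Nmax) \sum_(j < Nmax | j != i) (capE n ^+ 2)%:E)%E.
  apply: eq_bigr => i _.
  transitivity (\int[P]_tau
    \sum_(j <- [seq j <- index_enum 'I_Nmax | j != i]) cc i tau * cc j tau)%E.
    by apply: eq_integral => tau _; rewrite big_filter.
  rewrite ge0_integral_sum//; first last.
  - by move=> j tau _; rewrite mule_ge0.
  - by move=> j; exact: emeasurable_funM.
  by rewrite big_filter; apply: eq_bigr => j ji; exact: integral_cap_pair.
rewrite !capEE.
under eq_bigr do rewrite sumEFin.
rewrite sumEFin -!EFinM -EFinD !lee_fin.
set S := \sum_(i < Nmax) _ => h.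
have SN : S <= N ^+ 2 * capE n ^+ 2.
  apply: (@le_trans _ _ (\sum_(i < Nmax) \sum_(j < Nmax) capE n ^+ 2)).
    apply: ler_sum => i _; rewrite [leRHS](bigID (fun j => j != i))/= lerDl.
    by rewrite sumr_ge0// => j _; rewrite sqr_ge0.
  by rewrite !sumr_const card_ord -mulrnA -[leLHS]mulr_natl natrM -expr2.
have h2 : kap ^+ 2 * S <= N ^+ 2 * eta ^+ 2.
  apply: (@le_trans _ _ (kap ^+ 2 * (N ^+ 2 * capE n ^+ 2))).
    by rewrite ler_wpM2l ?sqr_ge0.
  have -> : kap ^+ 2 * (N ^+ 2 * capE n ^+ 2) = N ^+ 2 * (kap * capE n) ^+ 2 by ring.
  by rewrite kapE.
have h3 : eta * phi <= capE n.+1 + N ^+ 2 * eta ^+ 2.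
  have -> : eta * phi = kap * (capE n * phi) by rewrite mulrA kapE.
  by apply: (le_trans h); rewrite lerD2l.
have h4 : eta * (N ^+ 2 * eta) <= eta * (phi - 1) by rewrite ler_wpM2l ?(ltW eta0)// eta_le.
have -> : eta = eta * phi - eta * (phi - 1) by ring.
have : N ^+ 2 * eta ^+ 2 = eta * (N ^+ 2 * eta) by ring.
lra.
Qed.

(** A variable that is at most 1 with mean at least [eta] is at least [eta / 2] with probability at
    least [eta / 2]. These events decrease with the depth, so their intersection keeps that
    probability. *)
Lemma capacity_vanishing_lt1 : (P capacity_vanishing < 1)%E.
Proof.
have eta0 := eta_gt0.
pose A n := [set tau | eta / 2 <= capacity n tau].
have mA n : measurable (A n).
  rewrite -[A n]setTI; have := measurable_capacity n.
  move=> /(_ measurableT `[eta / 2, +oo[%classic).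
  rewrite (_ : capacity n @^-1` _ = A n); first by apply; exact: measurable_itv.
  by apply/seteqP; split => tau /=; rewrite /A/= in_itv/= andbT.
have PA n : ((eta / 2)%:E <= P (A n))%E.
  have := capacity_integral_ge n.
  have : (\int[P]_tau (capacity n tau)%:E <=
     \int[P]_tau ((eta / 2)%:E + (\1_(A n) tau)%:E))%E.
    apply: ge0_le_integral => //.
    - by apply: emeasurable_funD => //; exact/measurable_EFinP/measurable_indic.
    move=> tau _; rewrite -EFinD lee_fin indicE.
    case: (boolP (tau \in A n)) => /=.
      by move=> _; have := capacity_le1 n tau; lra.
    by rewrite notin_setE /A/= addr0 => /negP; rewrite -ltNge => /ltW.
  rewrite ge0_integralD//; last 2 first.
  - by move=> tau _; rewrite lee_fin divr_ge0// ltW.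
  - exact/measurable_EFinP/measurable_indic.
  rewrite integral_cst//= probability_setT mule1 integral_indic// setIT => h1 h2.
  have : (eta%:E <= (eta / 2)%:E + P (A n))%E by exact: le_trans h2 h1.
  have /fineK <- : P (A n) \is a fin_num by exact: fin_num_measure.
  by rewrite -EFinD !lee_fin; lra.
have PI : ((eta / 2)%:E <= P (\bigcap_n A n))%E.
  have cv : P \o A @ \oo --> P (\bigcap_n A n).
    apply: nonincreasing_cvg_mu => //.
    - by rewrite (le_lt_trans (probability_le1 _ _))// ltry.
    - exact: bigcap_measurable.
    - move=> n m nm; apply/subsetPset => tau; rewrite /A/= => h.
      exact: le_trans h (capacity_nonincreasing _ nm).
  rewrite -(cvg_lim _ cv)//; apply: lime_ge; first by apply: cvgP cv.
  exact: nearW.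
have mI : measurable (\bigcap_n A n) by exact: bigcap_measurable.
apply: (@le_lt_trans _ _ (P (~` \bigcap_n A n))).
  apply: le_measure; rewrite ?inE//; [exact: measurable_capacity_vanishing|exact: measurableC|].
  move=> tau; have e2 : 0 < eta / 2 by rewrite divr_gt0.
  have [j] := archimedean_inv_lt e2.
  move=> je /(_ j)[n nj] /(_ n I); rewrite /A/= => h.
  by have := lt_trans nj je; rewrite ltNge h.
rewrite probability_setC// lteBlDr// ?fin_num_measure//.
rewrite -[X in (X < _)%E]adde0 lteD2lE//.
by apply: lt_le_trans PI; rewrite lte_fin divr_gt0.
Qed.

End Capacity.
(** * Hereditary events *)

Section HereditaryEvents.
Context {R : realType} {k d Nmax : nat} {L : rifs R k d Nmax}.
Local Notation Lab := (borel (label (rifs_index L))).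
Local Notation Tree := (labelled_tree L).
Context (P : probability Tree R) (hP : random_recursive_measure P).

Lemma integral_root_label (f : Lab -> \bar R) :
  measurable_fun [set: Lab] f -> (forall l, 0 <= f l)%E ->
  (\int[P]_tau f (root_label tau) = \int[rifs_law L]_l f l)%E.
Proof.
move=> mf f0.
pose Q : {measure set Lab -> \bar R} :=
  measure_function_pushforward__canonical__measure_function_Measure P
    (@measurable_root_label _ _ _ _ L).
have -> : (\int[rifs_law L]_l f l = \int[Q]_l f l)%E.
  apply: eq_measure_integral => A mA _.
  have h := hP (s := [:: [::]]) (A := fun=> A) isT (fun=> mA).
  rewrite big_seq1 in h; apply: eq_trans (esym h) _.
  transitivity (P (root_label @^-1` A)); last by [].
  congr (P _); apply/seteqP; split => tau /=; first by apply; rewrite inE.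
  by move=> At v; rewrite inE => /eqP ->.
have -> : (\int[Q]_l f l = \int[P]_tau (f \o root_label) tau)%E; last by [].
by rewrite ge0_integral_pushforward//; exact: measurable_root_label.
Qed.

(** The condition is void at a root without children, so every such set contains the trees that end
    there. *)
Definition hereditary (A : set Tree) := measurable A /\
  forall tau, A tau <-> (forall i : 'I_Nmax,
    (i < rifs_arity (root_label tau))%N -> A (child i tau)).

Let ar (l : Lab) : nat := rifs_arity l.

Lemma measurable_arity (f : nat -> R) :
  measurable_fun [set: Lab] (fun l : Lab => f (ar l)).
Proof.
have mf : measurable_fun [set: nat] f by [].
exact: measurableT_comp mf (@rifs_arity_measurable _ _ _ _ L).
Qed.

(** The indicator of [A] is the product of its values at the children present, and the branching
    property turns its mean into the generating function of the arity at [p]. *)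
Lemma hereditary_fixpoint A (p : R) : hereditary A -> P A = p%:E ->
  (\int[P]_tau (p ^+ ar (root_label tau))%:E = p%:E)%E.
Proof.
move=> [mA hA] PA.
pose g (i : 'I_Nmax) (x : Lab * Tree) : \bar R :=
  (if (i < ar x.1)%N then (\1_A x.2 : R) else 1)%:E.
have mg i : measurable_fun [set: Lab * Tree] (g i).
  apply/measurable_EFinP; apply: measurable_fun_ifT => //.
    have mi : measurable_fun [set: nat] (fun n => (i < n)%N) by [].
    exact: measurableT_comp mi (measurableT_comp (@rifs_arity_measurable _ _ _ _ L) measurable_fst).
  by apply: measurableT_comp measurable_snd; exact: measurable_indic.
have g0 i x : (0 <= g i x)%E by rewrite lee_fin; case: ifP.
have gE tau : (\prod_(i < Nmax) g i (root_label tau, child i tau) = (\1_A tau)%:E)%E.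
  rewrite prodEFin indicE; congr EFin.
  case: (boolP (tau \in A)) => [|/negP]; rewrite inE => /hA.
    move=> h; rewrite big1// => i _; case: ifP => //= iN.
    by rewrite indicE mem_set//; exact: h.
  move=> /existsNP[i /not_implyP[iN hi]].
  by rewrite (bigD1 i)//= iN indicE memNset// mul0r.
rewrite -[RHS]PA -[in RHS](setIT A) -integral_indic//.
under [RHS]eq_integral do rewrite -gE.
rewrite (integral_branching hP)//.
apply: eq_integral => tau _.
have GE (i : 'I_Nmax) : (\int[P]_tau' g i (root_label tau, tau') =
    (if (i < ar (root_label tau))%N then p else 1)%:E)%E.
  rewrite /g /=; case: ifP => _.
    by rewrite integral_indic// setIT.
  by rewrite integral_cst//= probability_setT mule1.
under [RHS]eq_bigr do rewrite GE.
rewrite prodEFin; congr EFin.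
rewrite -big_mkcond/= -(big_ord_widen Nmax (fun=> p)) ?rifs_arity_le//.
by rewrite prodr_const card_ord.
Qed.
Context (N1 : (1 < \int[rifs_law L]_l (rifs_arity l)%:R%:E)%E).

(* [s p n = 1 + p + ... + p^(n-1)] has mean 1 at every fixed point [p < 1] of
   the generating function, and it increases strictly with [p] where [n >= 2]. *)
Lemma hereditary_eq_mod0 (A B : set Tree) : hereditary A -> hereditary B ->
  A `<=` B -> (P B < 1)%E -> P (B `\` A) = 0%E.
Proof.
move=> hA hB AB PB1.
have finP C : measurable C -> P C = (fine (P C))%:E.
  by move=> mC; rewrite fineK// fin_num_measure.
have le0 C : 0 <= fine (P C) by rewrite fine_ge0.
pose s p n : R := \sum_(j < n) p ^+ j.
have s0 p n : 0 <= p -> 0 <= s p n by move=> p0; rewrite sumr_ge0// => j _; rewrite exprn_ge0.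
have ms p : measurable_fun [set: Tree] (fun tau => (s p (ar (root_label tau)))%:E).
  apply/measurable_EFinP.
  exact: measurableT_comp (measurable_arity (s p)) measurable_root_label.
have mean_s C : hereditary C -> fine (P C) < 1 ->
    (\int[P]_tau (s (fine (P C)) (ar (root_label tau)))%:E = 1)%E.
  move=> hC p1; set p := fine _ in p1 *; have p0 : 0 <= p by exact: le0.
  have := hereditary_fixpoint hC (finP C hC.1); rewrite -/p => fp.
  have : (\int[P]_tau ((1 - p)%:E * (s p (ar (root_label tau)))%:E +
      (p ^+ ar (root_label tau))%:E) = 1)%E.
    rewrite (eq_integral (cst 1%E)) ?integral_cst//= ?probability_setT ?mule1//.
    move=> tau _; rewrite -EFinM -EFinD; congr EFin.
    by have := subrX1 p (ar (root_label tau)); rewrite /s; lra.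
  rewrite ge0_integralD//; first last.
  - apply/measurable_EFinP.
    exact: measurableT_comp (measurable_arity (fun n => p ^+ n)) measurable_root_label.
  - by move=> tau _; rewrite lee_fin exprn_ge0.
  - exact: emeasurable_funM.
  - by move=> tau _; rewrite mule_ge0// lee_fin ?s0// subr_ge0 ltW.
  rewrite fp ge0_integralZl//; first last.
  - by rewrite lee_fin subr_ge0 ltW.
  - by move=> tau _; rewrite lee_fin s0.
  have : (0 <= \int[P]_tau (s p (ar (root_label tau)))%:E)%E.
    by apply: integral_ge0 => tau _; rewrite lee_fin s0.
  case: (\int[P]_tau _)%E => [r r0|_|//].
    rewrite -EFinM -EFinD => -[]; rewrite -[X in _ = X -> _](subrK p) => /addIr.
    move=> h; congr EFin; apply: (@mulfI _ (1 - p)); last by rewrite h mulr1.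
    by rewrite gt_eqF// subr_gt0.
  by rewrite gt0_muley ?lte_fin ?subr_gt0.
have leAB : fine (P A) <= fine (P B).
  by rewrite -lee_fin -(finP _ hA.1) -(finP _ hB.1) le_measure ?inE//; [exact: hA.1|exact: hB.1].
have B1 : fine (P B) < 1 by rewrite -lte_fin -(finP _ hB.1).
have A1 : fine (P A) < 1 by exact: le_lt_trans B1.
suff eqAB : fine (P A) = fine (P B).
  have -> : (P (B `\` A) = P B - P A)%E.
    by rewrite -[in RHS](setIidr AB) measureD//; [exact: hB.1|exact: hA.1|
      rewrite -ge0_fin_numE// fin_num_measure//; exact: hB.1].
  by rewrite (finP _ hB.1) (finP _ hA.1) eqAB -EFinB subrr.
apply/eqP; rewrite eq_le leAB/= leNgt; apply/negP => ltAB.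
have := mean_s _ hA A1; have := mean_s _ hB B1; move: ltAB B1 (le0 A) (le0 B).
move: (fine (P A)) (fine (P B)) => e q eq q1 e0 q0 sq se.
(* For [n >= 2] the increase of [s] from [e] to [q] is at least [q - e], and [n <= Nmax] makes this
   linear in [n]. Both means of [s] are 1, so integration leaves a mean arity of at most 1, against
   non-extinction. *)
have key n : (n <= Nmax)%N ->
    (q - e) * n%:R + Nmax%:R * s e n <= (q - e) + Nmax%:R * s q n.
  move=> nN; case: n nN => [|[|n]] nN.
  - by rewrite /s !big_ord0 !mulr0 !addr0 subr_ge0 ltW.
  - by rewrite /s !big_ord1 mulr1.
  have : s e n.+2 + (q - e) <= s q n.+2.
    rewrite /s 2!big_ord_recl [leRHS]big_ord_recl [X in _ <= _ + X]big_ord_recl /=.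
    have : \sum_(i < n) e ^+ bump 0 (bump 0 i) <= \sum_(i < n) q ^+ bump 0 (bump 0 i).
      by apply: ler_sum => i _; rewrite lerXn2r// ?nnegrE// ltW.
    rewrite !expr0 !expr1; lra.
  move=> h; have h2 : Nmax%:R * (s e n.+2 + (q - e)) <= Nmax%:R * s q n.+2 by rewrite ler_wpM2l.
  have h3 : (q - e) * n.+2%:R <= (q - e) * Nmax%:R.
    by rewrite ler_wpM2l ?ler_nat// subr_ge0 ltW.
  have : 0 < q - e by rewrite subr_gt0.
  lra.
have mN : measurable_fun [set: Tree] (fun tau => ((ar (root_label tau))%:R : R)%:E).
  apply/measurable_EFinP.
  exact: measurableT_comp (measurable_arity (fun n => n%:R)) measurable_root_label.
have qe0 : 0 <= q - e by rewrite subr_ge0 ltW.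
have : (\int[P]_tau ((q - e)%:E * ((ar (root_label tau))%:R : R)%:E +
     Nmax%:R%:E * (s e (ar (root_label tau)))%:E) <=
   \int[P]_tau ((q - e)%:E + Nmax%:R%:E * (s q (ar (root_label tau)))%:E))%E.
  apply: ge0_le_integral => //.
  - by move=> tau _; rewrite adde_ge0// mule_ge0// lee_fin ?s0.
  - by apply: emeasurable_funD; exact: emeasurable_funM.
  - by apply: emeasurable_funD => //; exact: emeasurable_funM.
  by move=> tau _; rewrite -!EFinM -!EFinD lee_fin key// rifs_arity_le.
rewrite !ge0_integralD//; first last.
- exact: emeasurable_funM.
- by move=> tau _; rewrite mule_ge0// lee_fin s0.
- exact: emeasurable_funM.
- by move=> tau _; rewrite mule_ge0// lee_fin s0.
- exact: emeasurable_funM.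
- by move=> tau _; rewrite mule_ge0// lee_fin s0.
rewrite !ge0_integralZl//; first last.
- by move=> tau _; rewrite lee_fin s0.
- by move=> tau _; rewrite lee_fin s0.
rewrite se sq integral_cst//= probability_setT !mule1.
rewrite leeD2rE// => h.
have mL : measurable_fun [set: Lab] (fun l => (ar l)%:R%:E : \bar R).
  by apply/measurable_EFinP; exact: (measurable_arity (fun n => n%:R)).
have arE := integral_root_label mL (fun l => ltac:(by rewrite lee_fin)).
move: N1; rewrite -[X in (1 < X)%E]arE ltNge => /negP; apply.
by rewrite -(@lee_pmul2l _ (q - e)%:E)// ?lte_fin ?subr_gt0// mule1.
Qed.

End HereditaryEvents.
(** * Euclidean geometry *)

Section EuclideanGeometry.
Context {R : realType} {d : nat}.
Local Notation E := 'rV[R]_d.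
Implicit Types x y z u : E.

Definition dot x y : R := \sum_(i < d) x 0 i * y 0 i.

Lemma dotC x y : dot x y = dot y x.
Proof. by apply: eq_bigr => i _; rewrite mulrC. Qed.

Lemma dotBl x y z : dot (x - y) z = dot x z - dot y z.
Proof. by rewrite /dot -sumrB; apply: eq_bigr => i _; rewrite !mxE mulrBl. Qed.

Lemma dotBr x y z : dot z (x - y) = dot z x - dot z y.
Proof. by rewrite dotC dotBl !(dotC z). Qed.

Lemma dotDl x y z : dot (x + y) z = dot x z + dot y z.
Proof. by rewrite /dot -big_split; apply: eq_bigr => i _; rewrite !mxE mulrDl. Qed.

Lemma dotDr x y z : dot z (x + y) = dot z x + dot z y.
Proof. by rewrite dotC dotDl !(dotC z). Qed.

Lemma sqr_enorm x : enorm x ^+ 2 = dot x x.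
Proof.
rewrite /enorm sqr_sqrtr; last by apply: sumr_ge0 => i _; rewrite sqr_ge0.
by apply: eq_bigr => i _; rewrite expr2.
Qed.

Lemma enorm_ge0 x : 0 <= enorm x.
Proof. exact: sqrtr_ge0. Qed.

Lemma enormE x : enorm x = Num.sqrt (dot x x).
Proof. by congr Num.sqrt; apply: eq_bigr => i _; rewrite expr2. Qed.

Lemma enorm0 : enorm (0 : E) = 0.
Proof. by rewrite enormE /dot big1 ?sqrtr0// => i _; rewrite mxE mul0r. Qed.

Lemma enormN x : enorm (- x) = enorm x.
Proof. by congr Num.sqrt; apply: eq_bigr => i _; rewrite mxE sqrrN. Qed.

Lemma enormC x y : enorm (x - y) = enorm (y - x).
Proof. by rewrite -enormN opprB. Qed.

Lemma enorm_le x (r : R) : 0 <= r -> (enorm x <= r) = (dot x x <= r ^+ 2).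
Proof. by move=> r0; rewrite -sqr_enorm ler_sqr ?nnegrE// enorm_ge0. Qed.

Lemma cauchy_schwarz x y : dot x y <= enorm x * enorm y.
Proof.
suff : dot x y ^+ 2 <= (enorm x * enorm y) ^+ 2.
  case: (leP 0 (dot x y)) => [xy0|/ltW xy0 _].
    by rewrite ler_sqr ?nnegrE// mulr_ge0 ?enorm_ge0.
  by rewrite (le_trans xy0)// mulr_ge0 ?enorm_ge0.
rewrite exprMn !sqr_enorm -subr_ge0.
(* Lagrange's identity. *)
have -> : dot x x * dot y y - dot x y ^+ 2 =
  (\sum_(i < d) \sum_(j < d) (x 0 i * y 0 j - x 0 j * y 0 i) ^+ 2) / 2.
  apply: (@mulIf _ 2) => //; rewrite divfK//.
  transitivity (\sum_(i < d) \sum_(j < d) ((x 0 i * x 0 i) * (y 0 j * y 0 j)) +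
    \sum_(i < d) \sum_(j < d) ((y 0 i * y 0 i) * (x 0 j * x 0 j))
    - 2 * \sum_(i < d) \sum_(j < d) ((x 0 i * y 0 i) * (x 0 j * y 0 j))).
    have F (a b : 'I_d -> R) : \sum_(i < d) \sum_(j < d) a i * b j = (\sum_i a i) * (\sum_i b i).
      by rewrite mulr_suml; apply: eq_bigr => i _; rewrite mulr_sumr.
    rewrite !F -/(dot x x) -/(dot y y) -/(dot x y); ring.
  rewrite mulr_sumr -big_split -sumrB/=; apply: eq_bigr => i _.
  rewrite mulr_sumr -big_split -sumrB/=; apply: eq_bigr => j _; ring.
by rewrite divr_ge0// sumr_ge0// => i _; rewrite sumr_ge0// => j _; rewrite sqr_ge0.
Qed.

Lemma ler_enormD x y : enorm (x + y) <= enorm x + enorm y.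
Proof.
rewrite enorm_le ?addr_ge0 ?enorm_ge0// dotDl !dotDr (dotC y x).
rewrite sqrrD !sqr_enorm; have := cauchy_schwarz x y; lra.
Qed.

Lemma ler_enorm_dist x y z : enorm (x - z) <= enorm (x - y) + enorm (y - z).
Proof. by rewrite -[x - z](subrKA y) ler_enormD. Qed.

Lemma coord_le_enorm x i : `|x 0 i| <= enorm x.
Proof.
rewrite -sqrtr_sqr ler_wsqrtr// (bigD1 i)//= lerDl.
by apply: sumr_ge0 => j _; rewrite sqr_ge0.
Qed.

Lemma enorm_le_coord x (h : R) : 0 <= h -> (forall i, `|x 0 i| <= h) ->
  enorm x <= d%:R * h.
Proof.
move=> h0 xh; rewrite enorm_le ?mulr_ge0//.
apply: (@le_trans _ _ (\sum_(i < d) h ^+ 2)).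
  apply: ler_sum => i _; rewrite -expr2 -[leLHS]real_normK ?num_real//.
  by rewrite ler_sqr ?nnegrE.
rewrite sumr_const card_ord -[leLHS]mulr_natl exprMn; apply: ler_wpM2r; first exact: sqr_ge0.
by rewrite -natrX ler_nat; case: d => // m; rewrite -{1}[m.+1]muln1 leq_mul.
Qed.

Lemma enorm_le_norm x : enorm x <= d%:R * `|x|.
Proof.
apply: enorm_le_coord => // i.
rewrite [leRHS]mx_normrE; exact: (le_bigmax _ (fun j => `|x j.1 j.2|) (0, i)).
Qed.

Lemma norm_le_enorm x : `|x| <= enorm x.
Proof.
rewrite [leLHS]mx_normrE; apply: bigmax_le => [|[j i] _]; first exact: enorm_ge0.
by rewrite (ord1 j); exact: coord_le_enorm.
Qed.

Lemma enorm_eq0 x : enorm x = 0 -> x = 0.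
Proof.
by move=> x0; apply/rowP => i; apply/eqP; rewrite mxE -normr_le0 -x0 coord_le_enorm.
Qed.

Lemma open_eball x r : open (eball x r).
Proof.
rewrite openE => y; rewrite /eball/= => xy; apply/nbhs_ballP.
have e0 : 0 < (r - enorm (x - y)) / d.+1%:R by rewrite divr_gt0// subr_gt0.
exists ((r - enorm (x - y)) / d.+1%:R) => //= z; rewrite -ball_normE/= => yz.
apply: (le_lt_trans (ler_enorm_dist x y z)); rewrite addrC -ltrBrDr.
apply: (le_lt_trans (enorm_le_norm _)); apply: (@le_lt_trans _ _ (d.+1%:R * `|y - z|)).
  by rewrite ler_wpM2r// ler_nat.
by rewrite mulrC -ltr_pdivlMr.
Qed.

Lemma similarity_continuous c f : similarity c f -> continuous (f : E -> E).
Proof.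
move=> hf x A /nbhs_ballP[e /= e0 eA].
have D0 : 0 < (`|c| + 1) * d.+1%:R by rewrite mulr_gt0// ltr_wpDl.
apply/nbhs_ballP; exists (e / ((`|c| + 1) * d.+1%:R)); first exact: divr_gt0.
move=> y; rewrite -ball_normE/= ltr_pdivlMr// => xy; apply: eA.
rewrite -ball_normE/=; apply: (le_lt_trans (norm_le_enorm _)); rewrite hf.
apply: le_lt_trans xy; apply: (@le_trans _ _ ((`|c| + 1) * enorm (x - y))).
  by rewrite ler_wpM2r ?enorm_ge0// (le_trans (ler_norm _))// lerDl.
rewrite [leRHS]mulrC -mulrA ler_wpM2l ?addr_ge0//.
by apply: (le_trans (enorm_le_norm _)); rewrite ler_wpM2r// ler_nat.
Qed.

Lemma similarity_inj c f : 0 < c -> similarity c f -> injective (f : E -> E).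
Proof.
move=> c0 hf x y fxy; apply/subr0_eq/enorm_eq0; apply: (@mulfI _ c); first by rewrite gt_eqF.
by rewrite -hf fxy subrr enorm0 mulr0.
Qed.

Lemma similarity_comp c c' f g :
  similarity c f -> similarity c' g -> similarity (c * c') ((f : E -> E) \o g).
Proof. by move=> hf hg x y; rewrite /= hf hg mulrA. Qed.

(* By polarization the images of the standard basis form, up to the factor c,
   an orthonormal basis. *)
Lemma similarity_surj c f : 0 < c -> similarity c f ->
  forall y, exists x, (f : E -> E) x = y.
Proof.
move=> c0 hf y.
have polar x z : dot (f x - f 0) (f z - f 0) = c ^+ 2 * dot x z.
  have sq u v : dot (f u - f v) (f u - f v) = c ^+ 2 * dot (u - v) (u - v).
    by rewrite -!sqr_enorm hf exprMn.
  have h1 := sq x z; have h2 := sq x 0; have h3 := sq z 0.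
  move: h1 h2 h3; rewrite !subr0.
  have -> : f x - f z = (f x - f 0) - (f z - f 0) by rewrite opprB addrA subrK.
  move: (f x - f 0) (f z - f 0) => u v.
  rewrite !dotBl !dotBr (dotC v u) (dotC z x); lra.
have cK r : c ^- 2 * (c ^+ 2 * r) = r by rewrite mulKf// expf_neq0// gt_eqF.
pose e (i : 'I_d) : E := delta_mx 0 i.
have dot_e x i : dot x (e i) = x 0 i.
  rewrite /dot (bigD1 i)//= big1 ?addr0 => [|j ji]; rewrite !mxE eqxx ?eqxx ?mulr1//=.
  by rewrite (negPf ji) mulr0.
pose G : 'M[R]_d := \matrix_(i, j) (f (e i) - f 0) 0 j.
have GG : (c ^- 2) *: (G *m G^T) = 1%:M.
  apply/matrixP => i j; rewrite !mxE.
  have -> : \sum_k G i k * G^T k j = dot (f (e i) - f 0) (f (e j) - f 0).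
    by apply: eq_bigr => m _; rewrite !mxE.
  by rewrite polar cK dot_e mxE eqxx eq_sym.
(* A one-sided inverse of a square matrix is two-sided; here finite dimension yields
   surjectivity. *)
have GG' : (c ^- 2 *: G^T) *m G = 1%:M by apply: mulmx1C; rewrite -scalemxAr.
exists ((y - f 0) *m (c ^- 2 *: G^T)).
set x := _ *m _.
apply/(addIr (- f 0)).
suff : (f x - f 0) *m (c ^- 2 *: G^T) = x.
  by move=> /(congr1 (mulmx^~ G)); rewrite /x -!mulmxA GG' !mulmx1.
apply/rowP => i; rewrite -scalemxAr mxE [X in _ * X]mxE.
have -> : \sum_k (f x - f 0) 0 k * G^T k i = dot (f x - f 0) (f (e i) - f 0).
  by apply: eq_bigr => m _; rewrite !mxE.
by rewrite polar cK dot_e.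
Qed.

Lemma eball_sub_image c f x r : 0 < c -> similarity c f ->
  eball (f x) (c * r) `<=` (f : E -> E) @` eball x r.
Proof.
move=> c0 hf y; rewrite /eball/=; have [z <-] := similarity_surj c0 hf y.
by rewrite hf ltr_pM2l// => xz; exists z.
Qed.

(** Two points in one cell of a grid of mesh [h = A rho / (d + 1)] are at distance at most
    [d h < A rho], and the number of cells depends on [A], [B] and [d] only. Division by [d + 1]
    keeps the inequality strict and includes [d = 0]. *)
Lemma separated_card_bound (A B : R) : 0 < A -> 0 <= B -> exists K : nat,
  forall (T : eqType) (p : T -> E) (s : seq T) (u : E) (rho : R), 0 < rho -> uniq s ->
    (forall t, t \in s -> enorm (p t - u) <= B * rho) ->
    (forall t t', t \in s -> t' \in s -> t != t' -> A * rho <= enorm (p t - p t')) ->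
  (size s <= K)%N.
Proof.
move=> A0 B0.
pose m := Num.truncn (2 * B * d.+1%:R / A).
exists #|{: {ffun 'I_d -> 'I_m.+1}}| => T p s u rho rho0 us near sep.
pose h := A * rho / d.+1%:R.
have h0 : 0 < h by rewrite divr_gt0// mulr_gt0.
pose q t i := (p t 0 i - u 0 i + B * rho) / h.
pose cell t : {ffun 'I_d -> 'I_m.+1} := [ffun i => inord (Num.truncn (q t i))].
have q_bound t i : t \in s -> 0 <= q t i <= 2 * B * d.+1%:R / A.
  move=> ts; have := le_trans (coord_le_enorm (p t - u) i) (near t ts).
  rewrite !mxE ler_norml => /andP[l1 l2]; apply/andP; split.
    by rewrite divr_ge0 ?(ltW h0)//; lra.
  rewrite ler_pdivrMr//; have -> : 2 * B * d.+1%:R / A * h = 2 * (B * rho).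
    rewrite /h; have : d.+1%:R != 0 :> R by rewrite pnatr_eq0.
    by move: (d.+1%:R : R) => D D0; field; rewrite D0 gt_eqF.
  lra.
have cell_inj : {in s &, injective cell}.
  move=> t t' ts ts' tt'; apply/eqP; apply: contraT => /(sep _ _ ts ts').
  rewrite leNgt => /negP; case.
  apply: (@le_lt_trans _ _ (d%:R * h)); last first.
    rewrite /h mulrCA gtr_pMr ?mulr_gt0// ltr_pdivrMr// mul1r ltr_nat//.
  apply: enorm_le_coord => [|i]; first exact: ltW.
  have /ffunP /(_ i) := tt'; rewrite !ffunE => /(congr1 val) /=.
  have /andP[q0 q1] := q_bound t i ts; have /andP[q0' q1'] := q_bound t' i ts'.
  rewrite !inordK ?ltnS; last 2 first.
  - exact: le_truncn.
  - exact: le_truncn.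
  move=> eqq; rewrite !mxE.
  have /andP[a1 a2] := truncn_itv q0; have /andP[b1 b2] := truncn_itv q0'.
  have : `|q t i - q t' i| <= 1.
    rewrite ler_norml; move: a1 a2 b1 b2; rewrite eqq -natr1; lra.
  have -> : q t i - q t' i = (p t 0 i - p t' 0 i) / h by rewrite /q; field; rewrite gt_eqF.
  by rewrite normrM normfV (gtr0_norm h0) ler_pdivrMr// mul1r.
rewrite -(size_map cell) -(card_uniqP _) ?max_card//.
by rewrite map_inj_in_uniq.
Qed.

Lemma diam_le (U : set E) (r : R) : 0 <= r ->
  (forall x y, U x -> U y -> enorm (x - y) <= r) -> (diam U <= r%:E)%E.
Proof.
move=> r0 h; apply: ge_ereal_sup => _ [->|[[x y] [/= Ux Uy] <-]]; rewrite lee_fin//.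
exact: h.
Qed.

Lemma enorm_le_diam (U : set E) x y : U x -> U y -> ((enorm (x - y))%:E <= diam U)%E.
Proof.
move=> Ux Uy; apply: ereal_sup_ubound; right; exists (x, y) => //.
Qed.

Lemma diam_ge0 (U : set E) : (0 <= diam U)%E.
Proof. by apply: ereal_sup_ubound; left. Qed.

End EuclideanGeometry.
(** * Cylinders *)

Section TreeMaps.
Context {R : realType} {k d Nmax : nat} {L : rifs R k d Nmax}.
Local Notation Tree := (labelled_tree L).
Local Notation Node := (seq 'I_Nmax).
Local Notation E := 'rV[R]_d.
Implicit Types (tau : Tree) (v w : Node).

(** The recursion passes to the subtree at a child instead of carrying a growing address, so that
    inductions on the node range over all trees. *)
Fixpoint adm tau v : bool :=
  if v is i :: w then (i < rifs_arity (root_label tau))%N && adm (child i tau) w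
  else true.

Fixpoint nmap tau v : E -> E :=
  if v is i :: w then rifs_map (root_label tau) i \o nmap (child i tau) w else id.

Lemma node_mapE tau v : node_map tau v = nmap tau v.
Proof.
suff H u w : node_map_from tau u w = nmap (subtree u tau) w by exact: (H [::]).
elim: w u => [|i w IH] u //=; rewrite IH.
have -> : root_label (subtree u tau) = tau u by rewrite /root_label /subtree cats0.
by congr (_ \o nmap _ w); apply: funext => x; rewrite /subtree /child cat_rcons.
Qed.

Lemma admissibleP tau v : admissible tau v <-> adm tau v.
Proof.
elim: v tau => [|i w IH] tau; first by split.
split=> [h|/= /andP[h0 /IH h] [|j] //= jw]; last exact: h.
apply/andP; split; first exact: (h 0%N).
by apply/IH => j jw; exact: (h j.+1).
Qed.

Lemma adm_cat tau v w : adm tau (v ++ w) = adm tau v && adm (subtree v tau) w.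
Proof. by elim: v tau => [|i v IH] tau //=; rewrite IH andbA. Qed.

Lemma nmap_cat tau v w : nmap tau (v ++ w) = nmap tau v \o nmap (subtree v tau) w.
Proof. by elim: v tau => [|i v IH] tau //=; rewrite IH. Qed.

Definition level (D : set E) n tau : set E :=
  \bigcup_(v in [set v | size v = n /\ adm tau v]) nmap tau v @` D.

Lemma random_setE D tau : random_set D tau = \bigcap_(n in [set n | (0 < n)%N]) level D n tau.
Proof.
apply: eq_bigcapr => n _; rewrite /level.
apply/seteqP; split => x [v [sv av]] [y Dy <-].
  by exists v; [split => //; exact/admissibleP|exists y; rewrite // node_mapE].
by exists v; [split => //; exact/admissibleP|exists y; rewrite // node_mapE].
Qed.

Lemma nmap_invariant (D : set E) tau v :
  (forall (l : label (rifs_index L)) (i : 'I_Nmax), (i < rifs_arity l)%N ->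
     rifs_map l i @` D `<=` D) ->
  adm tau v -> nmap tau v @` D `<=` D.
Proof.
move=> hD; elim: v tau => [|i v IH] tau /=; first by rewrite image_id => _ x.
move=> /andP[iN av] _ [x Dx <-]; apply: (hD _ _ iN).
by apply: imageP; apply: (IH _ av); exact: imageP.
Qed.

Context (c : label (rifs_index L) -> 'I_Nmax -> R) (cmin cmax : R).
Context (cmin0 : 0 < cmin) (cminmax : cmin <= cmax) (cmax1 : cmax < 1).
Context (hc : forall l (i : 'I_Nmax), (i < rifs_arity l)%N ->
  similarity (c l i) (rifs_map l i) /\ cmin <= c l i <= cmax).

Fixpoint node_ratio tau v : R :=
  if v is i :: w then c (root_label tau) i * node_ratio (child i tau) w else 1.

Lemma c_gt0 l (i : 'I_Nmax) : (i < rifs_arity l)%N -> 0 < c l i.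
Proof. by move=> /hc[_ /andP[h _]]; exact: lt_le_trans h. Qed.

Lemma ratio_gt0 tau v : adm tau v -> 0 < node_ratio tau v.
Proof.
elim: v tau => [|i v IH] tau //= /andP[iN av].
by rewrite mulr_gt0 ?IH// c_gt0.
Qed.

Lemma ratio_le tau v : adm tau v -> node_ratio tau v <= cmax ^+ size v.
Proof.
elim: v tau => [|i v IH] tau //= /andP[iN av]; rewrite exprS.
have [_ /andP[_ h]] := hc iN.
by rewrite ler_pM ?IH// ltW ?c_gt0 ?ratio_gt0.
Qed.

Lemma nmap_similarity tau v : adm tau v -> similarity (node_ratio tau v) (nmap tau v).
Proof.
elim: v tau => [|i v IH] tau /=; first by move=> _ x y; rewrite mul1r.
by move=> /andP[iN /IH av]; apply: similarity_comp => //; have [] := hc iN.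
Qed.

(* The first nodes of ratio at most [rho], or of depth [n] where there is none. *)
Fixpoint line n (rho : R) tau : seq Node :=
  if n is m.+1 then
    if 1 <= rho then [:: [::]]
    else [seq i :: w | i <- [seq i : 'I_Nmax <- enum 'I_Nmax | (i < rifs_arity (root_label tau))%N],
                       w <- line m (rho / c (root_label tau) i) (child i tau)]
  else [:: [::]].

Lemma lineP n rho tau v : v \in line n.+1 rho tau -> rho < 1 ->
  exists i w, [/\ v = i :: w, (i < rifs_arity (root_label tau))%N &
     w \in line n (rho / c (root_label tau) i) (child i tau)].
Proof.
rewrite /= => + r1; rewrite leNgt r1 /= => /allpairsPdep[i [w [ia wl ->]]].
by exists i, w; split=> //; move: ia; rewrite mem_filter => /andP[].
Qed.

Lemma line_nil n rho tau v : 1 <= rho -> v \in line n rho tau -> v = [::].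
Proof. by case: n => [|n] /=; [move=> _|move=> ->]; rewrite inE => /eqP. Qed.

Lemma line_adm n rho tau v : v \in line n rho tau -> adm tau v.
Proof.
elim: n rho tau v => [|n IH] rho tau v; first by rewrite inE => /eqP ->.
have [r1|r1] := leP 1 rho; first by move=> /(line_nil r1) ->.
by move=> /lineP /(_ r1)[i [w [-> /= -> /IH]]].
Qed.

(** By [cmax^n <= rho] the nodes at which the depth bound stops are small enough too. *)
Lemma line_ratio_le n rho tau v : cmax ^+ n <= rho -> v \in line n rho tau ->
  node_ratio tau v <= rho.
Proof.
elim: n rho tau v => [|n IH] rho tau v; first by rewrite inE => ? /eqP ->.
have [r1|r1] := leP 1 rho; first by move=> _ /(line_nil r1) ->.
move=> cr /lineP /(_ r1)[i [w [-> iN wl]]] /=.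
have c0 := c_gt0 iN; rewrite mulrC -ler_pdivlMr//; apply: IH wl.
rewrite ler_pdivlMr//; apply: le_trans cr; rewrite exprSr ler_wpM2l//.
  by rewrite exprn_ge0//; have [_ /andP[_ h]] := hc iN; rewrite (le_trans (ltW c0)).
by have [_ /andP[]] := hc iN.
Qed.

(** The last step before the first passage below [rho] multiplies by at least [cmin]; the depth
    bound can only stop earlier, at a larger ratio. *)
Lemma line_ratio_ge n rho tau v : 0 < rho -> rho <= 1 -> v \in line n rho tau ->
  cmin * rho <= node_ratio tau v.
Proof.
have cmin1 : cmin <= 1 by rewrite (le_trans cminmax)// ltW.
elim: n rho tau v => [|n IH] rho tau v r0 r1.
  by rewrite inE => /eqP -> /=; rewrite mulr_ile1// ltW.
have [r1'|r1'] := leP 1 rho; first by move=> /(line_nil r1') ->; rewrite /= mulr_ile1// ltW.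
move=> /lineP /(_ r1')[i [w [-> iN wl]]] /=; have c0 := c_gt0 iN.
have [rc1|rc1] := leP (rho / c (root_label tau) i) 1.
  have := IH _ _ _ (divr_gt0 r0 c0) rc1 wl.
  by rewrite mulrA ler_pdivrMr// [leRHS]mulrC.
rewrite (line_nil (ltW rc1) wl) /= mulr1.
have [_ /andP[+ _]] := hc iN; apply: le_trans.
by rewrite ler_piMr// ltW.
Qed.

Lemma line_prefix n rho tau v : adm tau v -> (n <= size v)%N ->
  exists u w, v = u ++ w /\ u \in line n rho tau.
Proof.
elim: n rho tau v => [|n IH] rho tau v av nv.
  by exists [::], v; rewrite inE.
have [r1|r1] := leP 1 rho; first by exists [::], v; rewrite /= r1 inE.
case: v av nv => // i v /= /andP[iN av] nv.
have [u [w [-> ul]]] := IH (rho / c (root_label tau) i) _ _ av nv.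
exists (i :: u), w; split=> //=; rewrite leNgt r1 /=.
apply/allpairsPdep; exists i, u; split=> //.
by rewrite mem_filter iN mem_enum.
Qed.

Lemma line_uniq n rho tau : uniq (line n rho tau).
Proof.
elim: n rho tau => [|n IH] rho tau //=; case: ifP => // _.
apply: allpairs_uniq_dep; first by rewrite filter_uniq// enum_uniq.
  by move=> i _; exact: IH.
by move=> [i w] [i' w'] _ _ /= [-> ->].
Qed.

(** The value 0 at absent children lets sums over all of ['I_Nmax] stand for sums over the
    children. *)
Definition weight (t : R) (i : 'I_Nmax) (l : borel (label (rifs_index L))) : R :=
  if (i < rifs_arity l)%N then c l i `^ t else 0.

Lemma weight_ge0 t i l : 0 <= weight t i l.
Proof. by rewrite /weight; case: ifP => // _; exact: powR_ge0. Qed.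

Lemma line_mass n rho tau (t : R) :
  \sum_(v <- line n rho tau) node_ratio tau v `^ t <= total_mass (weight t) n tau.
Proof.
elim: n rho tau => [|n IH] rho tau; first by rewrite big_seq1 /= powR1 addr0.
have a0 := weight_ge0 t.
have [r1|r1] := leP 1 rho.
  rewrite /= r1 big_seq1 powR1 lerDl sumr_ge0// => i _.
  by rewrite mulr_ge0 ?total_mass_ge0.
rewrite /= (lt_geF r1) big_allpairs_dep/= big_filter big_enum_cond/=.
apply: ler_wpDl => //; rewrite big_mkcond/=; apply: ler_sum => i _.
rewrite /weight; case: ifP => iN; last by rewrite mul0r.
apply: le_trans (ler_wpM2l (powR_ge0 _ _) (IH (rho / c (root_label tau) i) (child i tau))).
rewrite mulr_sumr big_seq [leRHS]big_seq; apply: ler_sum => w /line_adm aw.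
by rewrite powRM// ltW ?c_gt0// ratio_gt0.
Qed.

Context (O : set E).
Context (hO : forall (l : label (rifs_index L)) (i : 'I_Nmax), (i < rifs_arity l)%N ->
  rifs_map l i @` O `<=` O).
Context (hOd : forall (l : label (rifs_index L)) (i j : 'I_Nmax),
  (i < rifs_arity l)%N -> (j < rifs_arity l)%N ->
  (rifs_map l i @` O) `&` (rifs_map l j @` O) !=set0 -> i = j).

(** Where two nodes separate, their images of [O] lie in the images of [O] under two maps of one
    system; a common prefix is removed by injectivity. *)
Lemma line_disjoint n rho tau u v x : u \in line n rho tau -> v \in line n rho tau ->
  (nmap tau u @` O) x -> (nmap tau v @` O) x -> u = v.
Proof.
elim: n rho tau u v x => [|n IH] rho tau u v x.
  by rewrite !inE => /eqP -> /eqP ->.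
have [r1|r1] := leP 1 rho; first by move=> /(line_nil r1) -> /(line_nil r1) ->.
move=> /lineP /(_ r1)[i [u' [-> iN ul]]] /lineP /(_ r1)[j [v' [-> jN vl]]].
move=> [y Oy yx] [z Oz zx].
have Oy' : O (nmap (child i tau) u' y).
  by apply: (nmap_invariant hO (line_adm ul)); exact: imageP.
have Oz' : O (nmap (child j tau) v' z).
  by apply: (nmap_invariant hO (line_adm vl)); exact: imageP.
have ij : i = j.
  apply: (hOd iN jN); exists x; split.
    by exists (nmap (child i tau) u' y).
  by exists (nmap (child j tau) v' z).
subst j; congr cons; apply: (IH _ _ _ _ _ ul vl).
  by exists y.
exists z => //; apply: (similarity_inj (c_gt0 iN) (hc iN).1).
by rewrite -[LHS]/(nmap tau (i :: v') z) zx -yx.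
Qed.

(** Each image of [O] contains a ball about the image of [x0] of radius at least [a * cmin * rho],
    and the images are disjoint. The images of [x0] are therefore separated on the scale [rho], and
    all lie within a multiple of [rho] of the centre. *)
Lemma line_hits_bound (D : set E) : D !=set0 ->
  (exists M, forall x y, D x -> D y -> enorm (x - y) <= M) ->
  O !=set0 -> open O ->
  exists K : nat, forall n rho tau x, 0 < rho -> rho <= 1 -> cmax ^+ n <= rho ->
    (size [seq v <- line n rho tau | `[< (nmap tau v @` D) `&` eball x rho !=set0 >]] <= K)%N.
Proof.
move=> [y0 Dy0] [M hM] [x0 Ox0] oO.
have [a a0 aO] : exists2 a, 0 < a & eball x0 a `<=` O.
  have /nbhs_ballP[e /= e0 eO] : nbhs x0 O by exact: open_nbhs_nbhs.
  exists e => // y; rewrite /eball/= => h; apply: eO; rewrite -ball_normE/=.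
  exact: le_lt_trans (norm_le_enorm _) h.
have M0 : 0 <= M by apply: le_trans (hM _ _ Dy0 Dy0); exact: enorm_ge0.
have B0 : 0 <= enorm (x0 - y0) + M + 1 by rewrite !addr_ge0// enorm_ge0.
have [K hK] := @separated_card_bound R d _ _ (mulr_gt0 a0 cmin0) B0.
exists K => n rho tau x r0 r1 cr; apply: (hK _ (fun v => nmap tau v x0) _ x rho) => //.
- by rewrite filter_uniq// line_uniq.
- move=> v; rewrite mem_filter => /andP[/asboolP[z [[y Dy <-{z}]]]].
  rewrite /eball/= => xz vl; have av := line_adm vl.
  apply: (le_trans (ler_enorm_dist _ (nmap tau v y) _)).
  rewrite nmap_similarity// mulrDl mul1r lerD//; last by rewrite enormC ltW.
  rewrite mulrC ler_pM ?enorm_ge0 ?(ltW (ratio_gt0 av))//; last exact: line_ratio_le vl.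
  by rewrite (le_trans (ler_enorm_dist _ y0 _))// lerD2l hM.
move=> u v; rewrite !mem_filter => /andP[_ ul] /andP[_ vl] uv.
rewrite leNgt; apply/negP => h; case/eqP: uv.
have au := line_adm ul; have av := line_adm vl.
apply: (line_disjoint (x := nmap tau v x0) ul vl); last exact: imageP.
have : eball (nmap tau u x0) (node_ratio tau u * a) (nmap tau v x0).
  rewrite /eball/=; apply: (lt_le_trans h); rewrite -mulrA mulrC ler_wpM2r ?(ltW a0)//.
  exact: line_ratio_ge ul.
move=> /(eball_sub_image (ratio_gt0 au) (nmap_similarity au))[z /aO Oz <-].
exact: imageP.
Qed.

End TreeMaps.
(** * Lower bound for the Hausdorff dimension *)

Section HausdorffLowerBound.
Context {R : realType} {k d Nmax : nat} {L : rifs R k d Nmax}.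
Local Notation Tree := (labelled_tree L).
Local Notation Node := (seq 'I_Nmax).
Local Notation E := 'rV[R]_d.
Implicit Types (tau : Tree) (v w : Node).
Context (c : label (rifs_index L) -> 'I_Nmax -> R) (cmin cmax : R).
Context (cmin0 : 0 < cmin) (cminmax : cmin <= cmax) (cmax1 : cmax < 1).
Context (hc : forall l (i : 'I_Nmax), (i < rifs_arity l)%N ->
  similarity (c l i) (rifs_map l i) /\ cmin <= c l i <= cmax).

(** Unless the root is in [C], the members of [C] that start with [i] become, with [i] removed, a
    cut set of the subtree at [i]. *)
Lemma capacity_le_cut t n tau (C : seq Node) :
  (forall u, u \in C -> adm tau u) ->
  (forall v, size v = n -> adm tau v -> exists u w, v = u ++ w /\ u \in C) ->
  capacity (weight c t) n tau <= \sum_(u <- C) node_ratio c tau u `^ t.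
Proof.
have c0 := @c_gt0 _ _ _ _ L c cmin cmax cmin0 hc.
have r0 := @ratio_gt0 _ _ _ _ L c cmin cmax cmin0 hc.
elim: n tau C => [|n IH] tau C aC cutC.
  have [u [w []]] := cutC [::] erefl isT; case: u => //= _ C0.
  rewrite (big_rem [::])//= powR1 lerDl sumr_ge0// => u _; exact: powR_ge0.
have [C0|C0] := boolP ([::] \in C).
  rewrite (big_rem [::])//= powR1 ge_min lerDl sumr_ge0// => u _; exact: powR_ge0.
apply: (le_trans (capacity_le_sum _ _ _)).
pose F u := node_ratio c tau u `^ t.
apply: (@le_trans _ _ (\sum_(i < Nmax) \sum_(u <- C)
    if (i < rifs_arity (root_label tau))%N && starts_with i u then F u else 0)); last first.
  rewrite exchange_big/=; apply: ler_sum => u _.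
  case: u => [|j w]; first by rewrite big1 ?powR_ge0// => i _; rewrite andbF.
  rewrite (bigD1 j)//= big1 ?addr0.
    by case: ifP => // _; exact: powR_ge0.
  move=> i ij; rewrite /starts_with /=.
  by case: eqP => [[ji]|]; [rewrite ji eqxx in ij|rewrite andbF].
apply: ler_sum => i _; rewrite /weight.
case: ifP => [iN|_] /=; last by rewrite mul0r big1.
rewrite -big_mkcond/=.
have -> : \sum_(u <- C | starts_with i u) F u =
    \sum_(w <- [seq behead u | u <- C & starts_with i u])
      c (root_label tau) i `^ t * node_ratio c (child i tau) w `^ t.
  rewrite big_map big_filter; rewrite big_seq_cond [RHS]big_seq_cond.
  apply: eq_bigr => -[|j w]; first by rewrite andbF.
  move=> /andP[/aC /= /andP[jN aw] /eqP[ji]]; subst j.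
  by rewrite /F /= powRM// ltW// ?c0// r0.
rewrite -mulr_sumr ler_wpM2l ?powR_ge0//; apply: IH.
  move=> w /mapP[u]; rewrite mem_filter => /andP[iu uC] ->.
  by case: u iu uC => // j u /eqP[->] /aC /= /andP[].
move=> v sv av; have [|/=|u [w [vE uC]]] := cutC (i :: v); first by rewrite /= sv.
  by rewrite iN av.
case: u vE uC => [_ uC|j u [-> ->] uC]; first by rewrite uC in C0.
exists u, w; split=> //; apply/mapP; exists (j :: u) => //.
by rewrite mem_filter uC /starts_with/= eqxx.
Qed.

Context (D : set E) (hD : invariant_compact L D).

Let Dc : compact D. Proof. by case: hD. Qed.
Let D0 : D !=set0. Proof. by case: hD. Qed.
Let Dinv : forall (l : label (rifs_index L)) (i : 'I_Nmax), (i < rifs_arity l)%N ->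
     rifs_map l i @` D `<=` D.
Proof. by case: hD. Qed.

Lemma level_nonincreasing n m tau : (n <= m)%N -> level D m tau `<=` level D n tau.
Proof.
move=> nm _ [v [sv av] [y Dy <-]].
have E : take n v ++ drop n v = v by exact: cat_take_drop.
move: (av); rewrite -E adm_cat => /andP[a1 a2].
exists (take n v).
  by split; [rewrite /= size_take_min sv; exact/minn_idPl|exact: a1].
exists (nmap (subtree (take n v) tau) (drop n v) y); last by rewrite nmap_cat.
by apply: (nmap_invariant Dinv a2); exact: imageP.
Qed.

Lemma closed_level n tau : closed (level D n tau).
Proof.
apply: closed_bigcup.
  apply: (@sub_finite_set _ _ [set` [seq tval t | t <- enum {: n.-tuple 'I_Nmax}]]) => //.
  move=> v [/eqP sv av] /=; apply/mapP; exists (Tuple sv) => //.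
  by rewrite mem_enum.
move=> v [_ av]; apply: compact_closed; first exact: norm_hausdorff.
apply: continuous_compact => //; apply: continuous_subspaceT.
exact: similarity_continuous (nmap_similarity hc av).
Qed.

(** Otherwise points of level [n] outside the first [n] open sets would cluster at a point of all
    levels, that is of the random set, and some [V j] around it would contain late points of the
    sequence. *)
Lemma random_set_cover_level tau (V : nat -> set E) : (forall j, open (V j)) ->
  random_set D tau `<=` \bigcup_j V j ->
  exists n, level D n tau `<=` \bigcup_(j in [set j | (j < n)%N]) V j.
Proof.
move=> oV FV; apply: contrapT => /forallNP H.
have {}H n : exists x, level D n tau x /\ forall j, (j < n)%N -> ~ V j x.
  have /existsNP[x /not_implyP[lx nV]] := H n.
  by exists x; split=> // j jn Vjx; apply: nV; exists j.
have [x hx] := choice H.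
have levD n : level D n tau `<=` D.
  by move=> y [v [_ av] im]; exact: (nmap_invariant Dinv av).
have [p [Dp clp]] : exists p, D p /\ cluster (x @ \oo) p.
  have : (x @ \oo) D by exists 0%N => // n _; exact: levD _ _ (hx n).1.
  by move=> /Dc [p [Dp clp]]; exists p.
have Fp : random_set D tau p.
  rewrite random_setE => n _; apply: closed_level.
  move=> B Bp; apply: clp => //.
  by exists n => // m /= nm; exact: level_nonincreasing nm _ (hx m).1.
have [j _ Vjp] := FV p Fp.
have [y [/= ny Vjy]] : [set y | ~ V j y] `&` V j !=set0.
  apply: (clp [set y | ~ V j y] (V j)); last exact: open_nbhs_nbhs.
  by exists j.+1 => // m /= jm; exact: (hx m).2.
by [].
Qed.

Context (O : set E) (O0 : O !=set0) (oO : open O).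
Context (hO : forall (l : label (rifs_index L)) (i : 'I_Nmax), (i < rifs_arity l)%N ->
  rifs_map l i @` O `<=` O).
Context (hOd : forall (l : label (rifs_index L)) (i j : 'I_Nmax),
  (i < rifs_arity l)%N -> (j < rifs_arity l)%N ->
  (rifs_map l i @` O) `&` (rifs_map l j @` O) !=set0 -> i = j).

Lemma compact_enorm_bounded : exists M, forall x y, D x -> D y -> enorm (x - y) <= M.
Proof.
have [M [_ hM]] := compact_bounded Dc.
exists (d%:R * ((M + 1) + (M + 1))) => x y Dx Dy.
apply: (le_trans (enorm_le_norm _)); rewrite ler_wpM2l//.
apply: (le_trans (ler_normB _ _)).
by rewrite lerD//; apply: (hM (M + 1)) => //; rewrite ltrDl.
Qed.

Lemma exists_exp_le (e : R) : 0 < e -> exists n, cmax ^+ n <= e.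
Proof.
move=> e0; have c0 : 0 <= cmax by rewrite (le_trans (ltW cmin0)).
have /cvgrPdist_lt/(_ e e0)[n _ hn] : cmax ^+ n @[n --> \oo] --> 0.
  by apply: cvg_expr; rewrite ger0_norm.
exists n; have := hn n (leqnn n); rewrite sub0r normrN ger0_norm ?exprn_ge0//.
exact: ltW.
Qed.

(** The cylinders of size [rho j] that meet the ball [j], for finitely many [j], form a cut set with
    at most [K] nodes per ball. The mask [b] allows void members in a cover. *)
Lemma capacity_le_cover : exists K : nat,
  forall t tau eta (b : nat -> bool) (x : nat -> E) (rho : nat -> R),
  (forall n, eta <= capacity (weight c t) n tau) -> 0 <= t ->
  (forall j, b j -> 0 < rho j <= 1) ->
  random_set D tau `<=` \bigcup_(j in [set j | b j]) eball (x j) (rho j) ->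
  exists n, eta <= K%:R * \sum_(j < n | b j) rho j `^ t.
Proof.
have [K hK] := line_hits_bound cmin0 cminmax cmax1 hc hO hOd D0 compact_enorm_bounded O0 oO.
exists K => t tau eta b x rho heta t0 hrho cov.
pose V j := if b j then eball (x j) (rho j) else set0.
have oV j : open (V j) by rewrite /V; case: ifP => _; [exact: open_eball|exact: open0].
have [n hn] : exists n, level D n tau `<=` \bigcup_(j in [set j | (j < n)%N]) V j.
  apply: random_set_cover_level => // p /cov[j bj pj]; exists j => //.
  by rewrite /V (_ : b j = true).
exists n.
(* A depth at which the lines for all radii in use are complete. *)
have [m [nm hm]] : exists m, (n <= m)%N /\ forall j, (j < n)%N -> b j -> cmax ^+ m <= rho j.
  have [m hm] : exists m, forall j, (j < n)%N -> b j -> cmax ^+ m <= rho j.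
    clear hn; elim: n => [|n [m hm]]; first by exists 0%N.
    have [bn|bn] := boolP (b n); last first.
      exists m => j; rewrite ltnS leq_eqVlt => /orP[/eqP -> bn'|]; last exact: hm.
      by rewrite bn' in bn.
    have [p hp] := exists_exp_le (proj1 (andP (hrho n bn))).
    have mono q q' : (q <= q')%N -> cmax ^+ q' <= cmax ^+ q.
      by move=> qq; rewrite ler_wiXn2l// ?(le_trans (ltW cmin0))// ltW.
    exists (maxn m p) => j; rewrite ltnS leq_eqVlt => /orP[/eqP -> _|jn bj].
      by apply: le_trans hp; rewrite mono// leq_maxr.
    by apply: le_trans (hm j jn bj); rewrite mono// leq_maxl.
  exists (maxn n m); split; first exact: leq_maxl.
  move=> j jn bj; apply: le_trans (hm j jn bj).
  by rewrite ler_wiXn2l ?leq_maxr// ?(le_trans (ltW cmin0))// ltW.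
pose Cj j := [seq v <- line c m (rho j) tau |
  `[< (nmap tau v @` D) `&` eball (x j) (rho j) !=set0 >]].
pose C := flatten [seq Cj j | j <- iota 0 n & b j].
apply: (le_trans (heta m)); apply: (@le_trans _ _ (\sum_(u <- C) node_ratio c tau u `^ t)).
  apply: capacity_le_cut.
  - move=> u /flattenP[s /mapP[j _ ->]]; rewrite mem_filter => /andP[_].
    exact: line_adm.
  - move=> v sv av.
    have [y0 Dy0] := D0.
    have lv : level D m tau (nmap tau v y0).
      by exists v => //; exact: imageP.
    have [j /= jn] := hn _ (level_nonincreasing nm lv).
    rewrite /V; case: ifP => // bj hj.
    have [|u [w [vE ul]]] := line_prefix c (n := m) (rho j) av; first by rewrite sv.
    exists u, w; split=> //; apply/flattenP; exists (Cj j).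
      by apply/mapP; exists j => //; rewrite mem_filter bj mem_iota add0n.
    rewrite mem_filter ul andbT; apply/asboolP; exists (nmap tau v y0); split=> //.
    rewrite vE nmap_cat; apply: imageP.
    move: av; rewrite vE adm_cat => /andP[_ aw].
    by apply: (nmap_invariant Dinv aw); exact: imageP.
rewrite big_flatten big_map big_filter mulr_sumr -[leRHS](big_mkord b (fun j => K%:R * rho j `^ t)).
rewrite /index_iota subn0 big_seq_cond [leRHS]big_seq_cond; apply: ler_sum => j /andP[jn bj].
have {}jn : (j < n)%N by move: jn; rewrite mem_iota add0n.
have /andP[rj0 rj1] := hrho j bj.
apply: (@le_trans _ _ (\sum_(v <- Cj j) rho j `^ t)).
  rewrite big_seq [leRHS]big_seq; apply: ler_sum => v; rewrite mem_filter => /andP[_ vl].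
  apply: ge0_ler_powR => //; rewrite ?nnegrE; [|exact: ltW|].
    by rewrite ltW// (ratio_gt0 cmin0 hc (line_adm vl)).
  exact: (line_ratio_le cmin0 hc (hm j jn bj) vl).
rewrite big_const_seq count_predT iter_addr addr0 -[leLHS]mulr_natl ler_wpM2r ?powR_ge0//.
by rewrite ler_nat; apply: hK => //; exact: hm.
Qed.

End HausdorffLowerBound.

(** * Lower bounds for the Hausdorff dimension from covers by balls *)

Section DimensionCriteria.
Context {R : realType} {d : nat}.
Local Notation E := 'rV[R]_d.
Implicit Types F U : set E.

(** A set of diameter [del] fits into open balls of radius larger than [del] only, and [del] may be
    0. The radius is the [t]-th root of [del^t + e'], where [e'] is capped to keep it at most 1. *)
Lemma powR_slack (t del e : R) : 0 < t -> 0 <= del -> del <= 2^-1 -> 0 < e ->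
  exists rho, [/\ del < rho, rho <= 1 & rho `^ t <= del `^ t + e].
Proof.
move=> t0 d0 d1 e0.
have p1 s : 1 `^ s = 1 :> R by rewrite powR1.
have dt1 : del `^ t < 1.
  apply: (@le_lt_trans _ _ (2^-1 `^ t)).
    by apply: ge0_ler_powR => //; rewrite ?nnegrE// ltW.
  rewrite -[ltRHS](p1 t); apply: gt0_ltr_powR => //; rewrite ?nnegrE//; lra.
pose e' := Num.min e (1 - del `^ t).
have e'0 : 0 < e' by rewrite lt_min e0 subr_gt0.
pose y := del `^ t + e'.
have y0 : 0 <= y by rewrite addr_ge0 ?powR_ge0// ltW.
exists (y `^ t^-1).
have yt : (y `^ t^-1) `^ t = y by rewrite -powRrM mulVf ?gt_eqF// powRr1.
split.
- rewrite ltNge; apply/negP => h.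
  have : y <= del `^ t.
    rewrite -[leLHS]yt; apply: ge0_ler_powR => //; rewrite ?nnegrE ?powR_ge0//; exact: ltW.
  by rewrite /y gerDl leNgt e'0.
- rewrite -[leRHS](p1 t^-1); apply: ge0_ler_powR => //; rewrite ?nnegrE//.
    by rewrite invr_ge0 ltW.
  by rewrite /y -lerBrDl ge_min lexx orbT.
by rewrite yt lerD2l ge_min lexx.
Qed.

Lemma dim_H_ge_of_cover F (t K eta : R) : 0 < t -> 0 < eta -> 0 <= K ->
  (forall (b : nat -> bool) (x : nat -> E) (rho : nat -> R),
    (forall j, b j -> 0 < rho j <= 1) ->
    F `<=` \bigcup_(j in [set j | b j]) eball (x j) (rho j) ->
    exists n, eta <= K * \sum_(j < n | b j) rho j `^ t) ->
  (t%:E <= dim_H F)%E.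
Proof.
move=> t0 eta0 K0 hF; apply: le_ereal_inf_tmp => _ [u [u0 hu] <-].
rewrite lee_fin leNgt; apply/negP => ut.
(* One [e] pays for the diameters, a second one for enlarging the sets to balls; the total satisfies
   [2 K e < eta]. *)
pose e := eta / (2 * K + 1).
have K1 : 0 < 2 * K + 1 by lra.
have e0 : 0 < e by rewrite divr_gt0.
(* Diameters of at most [2^-1] give [|U|^t <= |U|^u] for [u < t] and leave room for radii up to
   1. *)
have : (hausdorff_premeasure u 2^-1 F < e%:E)%E.
  apply: (@le_lt_trans _ _ 0%E); last by rewrite lte_fin.
  rewrite -hu; apply: ereal_sup_ubound; exists 2^-1 => //=; lra.
move=> /ereal_inf_lt[_ [U [diamU FU] <-]] sumU.
have diamE j : exists2 r : R, 0 <= r <= 2^-1 & diam (U j) = r%:E.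
  have := diamU j; have := diam_ge0 (U j); case: (diam (U j)) => [r| |]//=.
  by rewrite !lee_fin => r0 r1; exists r; rewrite ?r0.
have pow0 j : (0 <= diam_pow u (U j))%E.
  by rewrite /diam_pow; case: ifP => // _; exact: poweR_ge0.
have data j : exists xr : E * R, U j !=set0 -> [/\ 0 < xr.2 <= 1,
    U j `<=` eball xr.1 xr.2 & ((xr.2 `^ t)%:E <= diam_pow u (U j) + (e / 2 ^+ j.+1)%:E)%E].
  have [[x Ux]|U0] := pselect (U j !=set0); last by exists (0, 0).
  have [r /andP[r0 r1] rE] := diamE j.
  have ej : 0 < e / 2 ^+ j.+1 by rewrite divr_gt0// exprn_gt0.
  have [rho [rrho rho1 hrho]] := powR_slack t0 r0 r1 ej.
  exists (x, rho) => _; split => /=.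
  - by rewrite rho1 (le_lt_trans r0).
  - move=> y Uy; rewrite /eball/=; apply: le_lt_trans rrho.
    by rewrite -lee_fin -rE enorm_le_diam.
  rewrite /diam_pow; case: asboolP => [U0|_]; first by rewrite U0 in Ux.
  rewrite rE poweR_EFin -EFinD lee_fin; apply: (le_trans hrho); rewrite lerD2r.
  have [->|rn0] := eqVneq r 0; first by rewrite powR0 ?gt_eqF// powR_ge0.
  by rewrite ger_powR ?(ltW ut)// lt_neqAle eq_sym rn0 r0/=; lra.
have [xr hxr] := choice data.
pose b j := `[< U j !=set0 >].
have bP j : b j -> U j !=set0 by move/asboolP.
have [n] : exists n, eta <= K * \sum_(j < n | b j) (xr j).2 `^ t.
  apply: (hF b (fun j => (xr j).1) (fun j => (xr j).2)).
    by move=> j /bP /hxr[].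
  move=> y /FU[j _ Uy]; have Uj : U j !=set0 by exists y.
  by exists j; [exact/asboolP|have [_ + _] := hxr j Uj; apply].
rewrite leNgt => /negP; apply.
have geo m : \sum_(j < m) e / 2 ^+ j.+1 = e * (1 - 2 ^- m).
  elim: m => [|m IH]; first by rewrite big_ord0 expr0 invr1 subrr mulr0.
  rewrite big_ord_recr/= IH exprS invfM; field.
  by rewrite expf_neq0.
have sum_le : \sum_(j < n | b j) (xr j).2 `^ t <= 2 * e.
  rewrite -lee_fin -sumEFin.
  apply: (@le_trans _ _ (\sum_(j < n) (diam_pow u (U j) + (e / 2 ^+ j.+1)%:E))%E).
    rewrite big_mkcond/=; apply: lee_sum => j _; case: ifP => [/bP /hxr[]//|_].
    by rewrite adde_ge0// lee_fin divr_ge0 ?(ltW e0)// exprn_ge0.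
  rewrite big_split/= sumEFin geo.
  have -> : (2 * e)%:E = (e%:E + e%:E)%E by rewrite -EFinD; congr EFin; ring.
  apply: leeD; last by rewrite lee_fin ler_piMr ?(ltW e0)// gerBl invr_ge0 exprn_ge0.
  apply: le_trans (ltW sumU); rewrite -(big_mkord xpredT (fun j => diam_pow u (U j))).
  exact: nneseries_lim_ge.
apply: (@le_lt_trans _ _ (K * (2 * e))); first by rewrite ler_wpM2l.
rewrite /e; have -> : K * (2 * (eta / (2 * K + 1))) = eta * (2 * K / (2 * K + 1)) by ring.
by rewrite gtr_pMr// ltr_pdivrMr// mul1r ltrDl.
Qed.

End DimensionCriteria.
(** * Comparison of the dimensions *)

Section DimensionComparison.
Context {R : realType} {d : nat}.
Local Notation E := 'rV[R]_d.
Implicit Types F U : set E.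

Lemma cover_number_le_size (r : R) (X : set E) (l : seq (set E)) :
  (forall V, V \in l -> (diam V <= r%:E)%E) -> X `<=` \bigcup_(V in [set` l]) V ->
  (cover_number r X <= (size l)%:R%:E)%E.
Proof.
move=> hl Xl; apply: ereal_inf_lbound; exists (size l) => //=.
exists (fun i : 'I_(size l) => nth set0 l i); split=> [i|x /Xl[V /= Vl Vx]].
  by apply: hl; rewrite mem_nth.
have h : (index V l < size l)%N by rewrite index_mem.
by exists (Ordinal h) => //=; rewrite nth_index.
Qed.

(** The margin 1 extracts a cover from the infimum without attainment. *)
Lemma cover_number_le_ex (r c : R) (X : set E) : (cover_number r X <= c%:E)%E ->
  exists l : seq (set E), [/\ forall V, V \in l -> (diam V <= r%:E)%E,
    X `<=` \bigcup_(V in [set` l]) V & (size l)%:R <= c + 1].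
Proof.
move=> h; have : (cover_number r X < (c + 1)%:E)%E.
  by apply: (le_lt_trans h); rewrite lte_fin ltrDl.
move=> /ereal_inf_lt[_ [n [U [hU XU]] <-]]; rewrite lte_fin => nc.
exists [seq U i | i <- enum 'I_n]; split.
- by move=> V /mapP[i _ ->].
- move=> x /XU[i _ Ux]; exists (U i) => //=; apply/mapP; exists i => //.
  by rewrite mem_enum.
- by rewrite size_map size_enum_ord ltW.
Qed.

Lemma diam_pow_ge0 (s : R) U : (0 <= diam_pow s U)%E.
Proof. by rewrite /diam_pow; case: ifP => // _; exact: poweR_ge0. Qed.

Lemma diam_pow_set0 (s : R) : diam_pow s (set0 : set E) = 0%E.
Proof. by rewrite /diam_pow asboolT. Qed.

Lemma diam_set0 : diam (set0 : set E) = 0%E.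
Proof.
by apply/eqP; rewrite eq_le diam_ge0 andbT; apply: diam_le => // x y [].
Qed.

Lemma diam_pow_le (s r : R) U : 0 <= s -> 0 <= r -> (diam U <= r%:E)%E ->
  (diam_pow s U <= (r `^ s)%:E)%E.
Proof.
move=> s0 r0 Ur; rewrite /diam_pow; case: ifP => _; first by rewrite lee_fin powR_ge0.
rewrite -poweR_EFin; apply: gt0_ler_poweR => //; rewrite ?in_itv/= ?leey ?andbT ?lee_fin//.
exact: diam_ge0.
Qed.

Lemma hausdorff_premeasure_le (s r eps : R) F (l : seq (set E)) :
  0 <= s -> 0 <= r -> r <= eps ->
  (forall V, V \in l -> (diam V <= r%:E)%E) -> F `<=` \bigcup_(V in [set` l]) V ->
  (hausdorff_premeasure s eps F <= ((size l)%:R * r `^ s)%:E)%E.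
Proof.
move=> s0 r0 re hl Fl.
pose U n := nth set0 l n.
have Ur n : (diam (U n) <= r%:E)%E.
  have [nl|ln] := ltnP n (size l); first by apply: hl; rewrite mem_nth.
  by rewrite /U nth_default// diam_set0 lee_fin.
apply: (@le_trans _ _ (\sum_(0 <= n <oo) diam_pow s (U n))%E).
  apply: ereal_inf_lbound; exists U => //=; split=> [n|x /Fl[V /= Vl Vx]].
    by apply: (le_trans (Ur n)); rewrite lee_fin.
  by exists (index V l) => //; rewrite /U nth_index.
apply: lime_le.
  by apply: is_cvg_nneseries => n _ _; exact: diam_pow_ge0.
apply: nearW => n.
apply: (@le_trans _ _ (\sum_(0 <= j < size l + n) diam_pow s (U j))%E).
  rewrite [leRHS](@big_cat_nat _ _ _ n)//= ?leq_addl// leeDl// sume_ge0// => j _.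
  exact: diam_pow_ge0.
rewrite (@big_cat_nat _ _ _ (size l))//= ?leq_addr//.
rewrite [X in (_ + X)%E]big_nat_cond [X in (_ + X)%E]big1 ?adde0; last first.
  move=> j /andP[/andP[lj _] _]; rewrite /U nth_default//; exact: diam_pow_set0.
apply: (@le_trans _ _ (\sum_(0 <= j < size l) (r `^ s)%:E)%E).
  by apply: lee_sum => j _; exact: diam_pow_le.
by rewrite sumEFin lee_fin sumr_const_nat subn0 mulr_natl.
Qed.

Lemma hausdorff_measure_eq0 (s : R) F :
  (forall eps e : R, 0 < eps -> 0 < e -> (hausdorff_premeasure s eps F <= e%:E)%E) ->
  hausdorff_measure s F = 0%E.
Proof.
move=> h; apply/eqP; rewrite eq_le; apply/andP; split.
  apply: ge_ereal_sup => _ [eps /= eps0 <-]; apply/lee_addgt0Pr => e e0.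
  by rewrite add0e; exact: h.
apply: (@le_trans _ _ (hausdorff_premeasure s 1 F)).
  apply: le_ereal_inf_tmp => _ [U _ <-]; apply: nneseries_ge0 => n _ _.
  exact: diam_pow_ge0.
by apply: ereal_sup_ubound; exists 1 => /=.
Qed.

Lemma dim_H_ge0 F : (0 <= dim_H F)%E.
Proof. by apply: le_ereal_inf_tmp => _ [s [s0 _] <-]; rewrite lee_fin. Qed.

(** The net is a [rho]-separated subset of maximal size, which exists by [separated_card_bound]. *)
Lemma finite_net F (M rho : R) : (forall x y, F x -> F y -> enorm (x - y) <= M) ->
  0 < rho -> exists s : seq E, (forall x, x \in s -> F x) /\
    F `<=` \bigcup_(x in [set` s]) eball x rho.
Proof.
move=> hM rho0.
have [->|/set0P[x0 Fx0]] := eqVneq F set0; first by exists [::]; split.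
have M0 : 0 <= M by apply: le_trans (hM _ _ Fx0 Fx0); exact: enorm_ge0.
have [K hK] := @separated_card_bound R d 1 _ ltr01 (divr_ge0 M0 (ltW rho0)).
pose good (s : seq E) := [/\ uniq s, forall x, x \in s -> F x &
  forall x y, x \in s -> y \in s -> x != y -> rho <= enorm (x - y)].
have goodK s : good s -> (size s <= K)%N.
  move=> [us sF sep]; apply: (hK _ id s x0 rho) => //.
    by move=> x /sF Fx; rewrite divfK ?gt_eqF// hM.
  by move=> x y xs ys xy; rewrite mul1r sep.
have ex0 : exists n, `[< exists s, good s /\ size s = n >].
  by exists 0%N; apply/asboolP; exists [::].
have bnd n : `[< exists s, good s /\ size s = n >] -> (n <= K)%N.
  by move=> /asboolP[s [gs <-]]; exact: goodK.
case: (ex_maxnP ex0 bnd) => n /asboolP[s [[us sF sep] sn]] maxn.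
exists s; split=> // y Fy; apply: contrapT => ny.
have far x : x \in s -> rho <= enorm (x - y).
  by move=> xs; rewrite leNgt; apply/negP => h; apply: ny; exists x.
have yns : y \notin s.
  by apply/negP => /far; rewrite subrr enorm0 leNgt rho0.
have := maxn n.+1; rewrite ltnn => /(_ _)/negP; apply => //.
apply/asboolP; exists (y :: s); split; last by rewrite /= sn.
split; first by rewrite /= yns.
  by move=> x; rewrite inE => /orP[/eqP ->|/sF].
move=> x z; rewrite !inE => /orP[/eqP ->|xs] /orP[/eqP ->|zs]; rewrite ?eqxx// => xz.
- by rewrite enormC far.
- exact: far.
- exact: sep.
Qed.

Lemma powR_small (beta e : R) : 0 < beta -> 0 < e -> forall m : R, 0 < m ->
  exists r, [/\ 0 < r, r <= m & r `^ beta <= e].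
Proof.
move=> b0 e0 m m0; exists (Num.min m (e `^ beta^-1)); split.
- by rewrite lt_min m0 powR_gt0.
- by rewrite ge_min lexx.
rewrite -[leRHS](powRr1 (ltW e0)) -[X in _ <= _ `^ X](mulVf (lt0r_neq0 b0)) powRrM.
apply: ge0_ler_powR; rewrite ?nnegrE ?(ltW b0) ?powR_ge0//.
  by rewrite le_min ltW//= powR_ge0.
by rewrite ge_min lexx orbT.
Qed.

(** The radius is fixed at the largest admissible value, [rho^(1 + delta) = |F|]. A finite net
    splits [F] into balls of this radius, and for small [r] their local covers make the premeasure
    of exponent [alpha + beta] of order [r^beta]. *)
Lemma dim_H_le_qA_exponent F (M delta : R) : 0 < delta ->
  (forall x y, F x -> F y -> enorm (x - y) <= M) ->
  (dim_H F <= qA_exponent delta F)%E.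
Proof.
move=> delta0 hM; apply: le_ereal_inf_tmp => _ [alpha [alpha0 [C C0 hC]] <-].
apply/lee_addgt0Pr => beta beta0; rewrite -EFinD.
apply: ereal_inf_lbound; exists (alpha + beta) => //; split; first by rewrite addr_ge0// ltW.
apply: hausdorff_measure_eq0 => eps e eps0 e0.
have s0 : 0 <= alpha + beta by rewrite addr_ge0// ltW.
(* At diameter 0 no scale is admissible and the hypothesis on [alpha] says nothing; [F] itself is
   then a cover by a single small set. *)
have [diam0|diam0] := leP (diam F) 0%E.
  have ab0 : 0 < alpha + beta by rewrite ltr_wpDl.
  have [r [r0 re hr]] := powR_small ab0 e0 eps0.
  apply: (le_trans (@hausdorff_premeasure_le _ r eps F [:: F] s0 (ltW r0) re _ _)).
  - by move=> V; rewrite inE => /eqP ->; apply: (le_trans diam0); rewrite lee_fin ltW.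
  - by move=> x Fx; exists F => //=; rewrite inE.
  by rewrite mul1r lee_fin.
have [x0 Fx0] : F !=set0.
  by apply/set0P/eqP => F0; rewrite F0 diam_set0 ltxx in diam0.
have M0 : 0 <= M by apply: le_trans (hM _ _ Fx0 Fx0); exact: enorm_ge0.
have [m mE m0] : exists2 m, diam F = m%:E & 0 < m.
  move: diam0 (diam_le M0 hM); case: (diam F) => [m| |]//.
  by rewrite lte_fin; exists m.
pose rho := m `^ (1 + delta)^-1.
have rho0 : 0 < rho by rewrite powR_gt0.
have d1 : 1 + delta != 0 by rewrite gt_eqF// addr_gt0.
have rhoE : rho `^ (1 + delta) = m by rewrite -powRrM mulVf// powRr1// ltW.
have [s [sF Fs]] := finite_net hM rho0.
pose A := (size s)%:R * (C * rho `^ alpha + 2).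
have A0 : 0 < A + 1 by rewrite ltr_wpDl// mulr_ge0// addr_ge0// mulr_ge0 ?powR_ge0// ltW.
have [r [r0 rm hr]] := powR_small beta0 (divr_gt0 e0 A0) (m := Num.min (Num.min m eps) 1)
  ltac:(by rewrite !lt_min m0 eps0 ltr01).
have [rm' re r1] : [/\ r <= m, r <= eps & r <= 1].
  by move: rm; rewrite !le_min => /andP[/andP[]].
have loc x : exists l : seq (set E), x \in s ->
  [/\ forall V, V \in l -> (diam V <= r%:E)%E,
    eball x rho `&` F `<=` \bigcup_(V in [set` l]) V & (size l)%:R <= C * (rho / r) `^ alpha + 1].
  have [xs|xs] := boolP (x \in s); last by exists [::].
  have [|l hl] := @cover_number_le_ex r (C * (rho / r) `^ alpha) (eball x rho `&` F).
    apply: le_trans (hC r rho r0 rho0 _ _); rewrite ?rhoE ?mE//.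
    by apply: ereal_sup_ubound; exists x => //; exact: sF.
  by exists l.
have [l hl] := choice loc.
pose tot := flatten [seq l x | x <- s].
apply: (le_trans (@hausdorff_premeasure_le _ r eps F tot s0 (ltW r0) re _ _)).
- by move=> V /flattenP[_ /mapP[x xs ->]]; have [+ _ _] := hl x xs; apply.
- move=> y Fy; have [x /= xs xy] := Fs y Fy.
  have [_ + _] := hl x xs => /(_ y (conj xy Fy))[V /= Vl Vy].
  by exists V => //=; apply/flattenP; exists (l x) => //; exact: map_f.
rewrite lee_fin.
have size_tot : (size tot)%:R <= (size s)%:R * (C * (rho / r) `^ alpha + 1) :> R.
  rewrite /tot size_flatten /shape -map_comp sumnE big_map natr_sum.
  apply: (@le_trans _ _ (\sum_(x <- s) (C * (rho / r) `^ alpha + 1))).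
    by rewrite big_seq [leRHS]big_seq; apply: ler_sum => x xs; have [] := hl x xs.
  by rewrite big_const_seq count_predT iter_addr addr0 mulr_natl.
apply: (@le_trans _ _ ((size s)%:R * (C * (rho / r) `^ alpha + 1) * r `^ (alpha + beta))).
  by rewrite ler_wpM2r ?powR_ge0.
have rab : r `^ (alpha + beta) = r `^ alpha * r `^ beta.
  by rewrite powRD// (gt_eqF r0) implybT.
have rhor : (rho / r) `^ alpha * r `^ alpha = rho `^ alpha.
  by rewrite -powRM ?divfK ?gt_eqF// ltW// divr_gt0.
have ra1 : r `^ alpha <= 1.
  by rewrite -[leRHS](powRr0 r) ger_powR// r0.
apply: (@le_trans _ _ (A * r `^ beta)).
  rewrite rab /A !mulrA ler_wpM2r ?powR_ge0// -mulrA ler_wpM2l// mulrDl -mulrA rhor mul1r lerD2l.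
  lra.
apply: (@le_trans _ _ ((A + 1) * (e / (A + 1)))); last by rewrite mulrC divfK ?gt_eqF.
apply: (@le_trans _ _ ((A + 1) * r `^ beta)); first by rewrite ler_wpM2r ?powR_ge0// lerDl.
by rewrite ler_wpM2l// ltW.
Qed.

Lemma dim_qA_eq F (s : \bar R) : (forall delta : R, 0 < delta -> qA_exponent delta F = s) ->
  dim_qA F = s.
Proof.
move=> h; apply/cvg_lim => //; apply: cvg_near_cst.
by near=> delta; apply: h; near: delta; exact: nbhs_right_gt.
Unshelve. all: by end_near. Qed.

End DimensionComparison.
(** * Upper bound for the quasi-Assouad dimension *)

Section QuasiAssouadUpperBound.
Context {R : realType} {k d Nmax : nat} {L : rifs R k d Nmax}.
Local Notation Tree := (labelled_tree L).
Local Notation Node := (seq 'I_Nmax).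
Local Notation E := 'rV[R]_d.
Implicit Types (tau : Tree) (v w : Node).
Context (c : label (rifs_index L) -> 'I_Nmax -> R) (cmin cmax : R).
Context (cmin0 : 0 < cmin) (cminmax : cmin <= cmax) (cmax1 : cmax < 1).
Context (hc : forall l (i : 'I_Nmax), (i < rifs_arity l)%N ->
  similarity (c l i) (rifs_map l i) /\ cmin <= c l i <= cmax).
Context (D : set E) (hD : invariant_compact L D).
Context (O : set E) (O0 : O !=set0) (oO : open O).
Context (hO : forall (l : label (rifs_index L)) (i : 'I_Nmax), (i < rifs_arity l)%N ->
  rifs_map l i @` O `<=` O).
Context (hOd : forall (l : label (rifs_index L)) (i j : 'I_Nmax),
  (i < rifs_arity l)%N -> (j < rifs_arity l)%N ->
  (rifs_map l i @` O) `&` (rifs_map l j @` O) !=set0 -> i = j).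

Let Dinv : forall (l : label (rifs_index L)) (i : 'I_Nmax), (i < rifs_arity l)%N ->
     rifs_map l i @` D `<=` D.
Proof. by case: hD. Qed.

Lemma random_set_sub_level n tau : (0 < n)%N -> random_set D tau `<=` level D n tau.
Proof. by move=> n0 x; rewrite random_setE; apply. Qed.

Lemma random_set_sub tau : random_set D tau `<=` D.
Proof.
move=> x /(random_set_sub_level (ltn0Sn 0))[v [_ av] im].
exact: (nmap_invariant Dinv av).
Qed.

(** Each term of the mass of the line is at least [(cmin * x)^t]. The separate [x] is needed because
    a threshold relative to a subtree may exceed 1, where the line is the root alone. *)
Lemma line_card_le n rho tau t x : 0 < rho -> 0 <= t ->
  0 < x -> x <= 1 -> x <= rho ->
  (size (line c n rho tau))%:R * (cmin * x) `^ t <= total_mass (weight c t) n tau.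
Proof.
move=> r0 t0 x0 x1 xr.
have [r1|r1] := leP 1 rho.
  have -> : line c n rho tau = [:: [::]] by case: n => //= n; rewrite r1.
  rewrite mul1r; apply: le_trans (total_mass_ge1 (weight_ge0 c t) _ _).
  have -> : 1 = 1 `^ t :> R by rewrite powR1.
  have cx : cmin * x <= 1.
    by rewrite mulr_ile1 ?(ltW cmin0) ?(ltW x0)// (le_trans cminmax)// ltW.
  by apply: ge0_ler_powR; rewrite ?nnegrE// mulr_ge0// ltW.
apply: le_trans (line_mass cmin0 hc n rho tau t).
apply: (@le_trans _ _ (\sum_(v <- line c n rho tau) (cmin * x) `^ t)).
  by rewrite big_const_seq count_predT iter_addr addr0 mulr_natl.
rewrite big_seq [leRHS]big_seq; apply: ler_sum => v vl.
have av := line_adm vl.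
apply: ge0_ler_powR; rewrite ?nnegrE ?(ltW (ratio_gt0 cmin0 hc av))//.
  by rewrite mulr_ge0// ltW.
apply: le_trans (line_ratio_ge cmin0 cminmax cmax1 hc r0 (ltW r1) vl).
by rewrite ler_wpM2l// ltW.
Qed.

Lemma line_depth_le n rho tau v : 0 < rho -> rho <= 1 -> v \in line c n rho tau ->
  (size v)%:R * - ln cmax <= - ln cmin - ln rho.
Proof.
move=> r0 r1 vl; have av := line_adm vl.
have cmax0 : 0 < cmax by exact: lt_le_trans cminmax.
have h : cmin * rho <= cmax ^+ size v.
  apply: le_trans (line_ratio_ge cmin0 cminmax cmax1 hc r0 r1 vl) _.
  exact: (ratio_le cmin0 hc).
have : ln (cmin * rho) <= ln (cmax ^+ size v).
  by rewrite ler_ln ?posrE// ?mulr_gt0// exprn_gt0.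
rewrite lnM ?posrE// lnXn// -mulr_natl; lra.
Qed.

Lemma powRV (x e : R) : 0 < x -> x^-1 `^ e = (x `^ e)^-1.
Proof. by move=> x0; rewrite -powR_inv1 ?ltW// -powRrM mulN1r powRN. Qed.

Lemma size_line n rho tau v : v \in line c n rho tau -> (size v <= n)%N.
Proof.
elim: n rho tau v => [|n IH] rho tau v; first by rewrite inE => /eqP ->.
have [r1|r1] := leP 1 rho; first by move=> /(line_nil r1) ->.
by move=> /lineP /(_ r1)[i [w [-> _ /IH]]].
Qed.

Lemma ln_le_powR (x e : R) : 0 < x -> 0 < e -> ln x <= x `^ e / e.
Proof.
move=> x0 e0; rewrite ler_pdivlMr// mulrC -ln_powR.
have y0 : 0 < x `^ e by exact: powR_gt0.
exact/ltW/ln_sublinear.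
Qed.

(* The cover consists of the cylinders of size [r1] below the cylinders of size
   [R1] that meet the ball; there are boundedly many of the latter. *)
Lemma local_cover_count : exists K0 M : R, [/\ 1 <= K0, 1 <= M,
  forall x y, D x -> D y -> enorm (x - y) <= M &
  forall t tau B K, 0 <= t -> 0 <= K ->
    (forall v n, total_mass (weight c t) n (subtree v tau) <= B + K * (size v)%:R) ->
    forall R1 r1 rho r : R, 0 < r1 -> r1 <= R1 -> R1 <= 1 -> r1 * M <= r ->
      (R1 < 1 -> rho = R1) ->
    (local_cover_number r rho (random_set D tau) <=
      (K0 * ((`|B| + K * ((- ln cmin - ln R1) / - ln cmax)) * (R1 / (cmin * r1)) `^ t))%:E)%E].
Proof.
have [M0 hM0] := compact_enorm_bounded hD.
have D0 : D !=set0 by case: hD.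
have [K hK] := line_hits_bound cmin0 cminmax cmax1 hc hO hOd D0 (compact_enorm_bounded hD) O0 oO.
have cmax0 : 0 < cmax by exact: lt_le_trans cminmax.
have lncmax : 0 < - ln cmax by rewrite oppr_gt0 ln_lt0// cmax0.
exists (K.+1%:R), (Num.max 1 M0); split.
- by rewrite ler1n.
- by rewrite le_max lexx.
- by move=> x y Dx Dy; rewrite le_max hM0 ?orbT.
set M := Num.max 1 M0.
have hM x y : D x -> D y -> enorm (x - y) <= M by move=> Dx Dy; rewrite le_max hM0 ?orbT.
have M1 : 1 <= M by rewrite le_max lexx.
move=> t tau B K' t0 K'0 hB R1 r1 rho r r10 r1R R1le1 r1M rhoR.
have R10 : 0 < R1 by exact: lt_le_trans r1R.
apply: ge_ereal_sup => _ [x Fx <-].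
have [n0 hn0] := exists_exp_le cmin0 cminmax cmax1 R10.
have [n1 hn1] := exists_exp_le cmin0 cminmax cmax1 r10.
pose hits := [seq v <- line c n0 R1 tau | `[< (nmap tau v @` D) `&` eball x rho !=set0 >]].
(* The threshold is divided by the ratio of [v], so that the composed cylinders have ratio at most
   [r1]. *)
pose low v := line c n1 (r1 / node_ratio c tau v) (subtree v tau).
pose l := [seq nmap tau (v ++ w) @` D | v <- hits, w <- low v].
have hits_adm v : v \in hits -> adm tau v by rewrite mem_filter => /andP[_ /line_adm].
have hits_ratio v : v \in hits -> 0 < node_ratio c tau v <= R1.
  move=> vh; rewrite (ratio_gt0 cmin0 hc (hits_adm v vh))/=.
  by move: vh; rewrite mem_filter => /andP[_]; exact: (line_ratio_le cmin0 hc).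
have low_hyp v : v \in hits -> cmax ^+ n1 <= r1 / node_ratio c tau v.
  move=> /hits_ratio/andP[v0 v1]; rewrite ler_pdivlMr//; apply: le_trans hn1.
  by rewrite ler_piMr// ?exprn_ge0 ?(ltW cmax0)// (le_trans v1).
apply: (@le_trans _ _ (size l)%:R%:E).
  apply: cover_number_le_size.
    move=> V /allpairsPdep[v [w [vh wl ->]]].
    have /andP[v0 v1] := hits_ratio v vh.
    have avw : adm tau (v ++ w) by rewrite adm_cat hits_adm//= (line_adm wl).
    apply: diam_le; first by apply: le_trans r1M; rewrite mulr_ge0 ?(ltW r10)// (le_trans ler01).
    move=> _ _ [y Dy <-] [z Dz <-].
    rewrite (nmap_similarity hc avw); apply: le_trans r1M.
    rewrite ler_pM ?enorm_ge0 ?hM ?(ltW (ratio_gt0 cmin0 hc avw))//.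
    have -> : node_ratio c tau (v ++ w) = node_ratio c tau v * node_ratio c (subtree v tau) w.
      by clear; elim: v tau => [|i v IH] tau /=; rewrite ?mul1r// IH mulrA.
    rewrite mulrC -ler_pdivlMr//.
    exact: (line_ratio_le cmin0 hc (low_hyp v vh) wl).
  move=> y [xy Fy].
  have [u [su au] [z Dz zy]] := @random_set_sub_level (n0 + n1).+1 tau (ltn0Sn _) y Fy.
  have [|v [u' [uE vl]]] := line_prefix c (n := n0) R1 au.
    by rewrite su ltnW// ltnS leq_addr.
  have := au; rewrite uE adm_cat => /andP[av au'].
  have vh : v \in hits.
    rewrite mem_filter vl andbT; apply/asboolP; exists y; split=> //.
    rewrite -zy uE nmap_cat; apply: imageP.
    by apply: (nmap_invariant Dinv au'); exact: imageP.
  have [|w [w' [u'E wl]]] := line_prefix c (n := n1) (r1 / node_ratio c tau v) au'.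
    have /(congr1 size) := uE; rewrite su size_cat => sE.
    rewrite -(leq_add2l n0); apply: (leq_trans (leqnSn _)).
    by rewrite sE leq_add2r (size_line vl).
  exists (nmap tau (v ++ w) @` D) => /=.
    by apply/allpairsPdep; exists v, w.
  rewrite -zy uE u'E catA (nmap_cat _ (v ++ w)); apply: imageP.
  have aw' : adm (subtree (v ++ w) tau) w'.
    by move: au; rewrite uE u'E catA adm_cat => /andP[].
  by apply: (nmap_invariant Dinv aw'); exact: imageP.
rewrite lee_fin.
(* At [R1 = 1] the line is the root alone, whatever the radius of the ball. *)
have size_hits : (size hits <= K.+1)%N.
  have [R1lt|R1ge] := ltP R1 1.
    by rewrite leqW// /hits (rhoR R1lt); apply: hK.
  rewrite /hits size_filter; apply: (leq_trans (count_size _ _)).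
  by case: n0 {hn0 hits low l hits_adm hits_ratio low_hyp} => //= n; rewrite R1ge.
pose X := (`|B| + K' * ((- ln cmin - ln R1) / - ln cmax)) * (R1 / (cmin * r1)) `^ t.
have size_low v : v \in hits -> (size (low v))%:R <= X.
  move=> vh; have /andP[v0 v1] := hits_ratio v vh.
  have rr : 0 < r1 / R1 by rewrite divr_gt0.
  have rr1 : r1 / R1 <= 1 by rewrite ler_pdivrMr// mul1r.
  have rrv : r1 / R1 <= r1 / node_ratio c tau v.
    by rewrite ler_wpM2l ?(ltW r10)// lef_pV2.
  have h := line_card_le n1 (subtree v tau) (divr_gt0 r10 v0) t0 rr rr1 rrv.
  have p0 : 0 < (cmin * (r1 / R1)) `^ t by rewrite powR_gt0// mulr_gt0.
  have pE : (R1 / (cmin * r1)) `^ t = ((cmin * (r1 / R1)) `^ t)^-1.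
    have -> : R1 / (cmin * r1) = (cmin * (r1 / R1))^-1 by rewrite mulrA invf_div.
    by rewrite powRV// mulr_gt0.
  rewrite /X pE ler_pdivlMr//; apply: (le_trans h); apply: (le_trans (hB v n1)).
  apply: lerD; first exact: ler_norm.
  rewrite ler_wpM2l// ler_pdivlMr//.
  by move: vh; rewrite mem_filter => /andP[_]; exact: line_depth_le.
rewrite -/X /l size_allpairs_dep sumnE big_map natr_sum.
apply: (@le_trans _ _ (\sum_(v <- hits) X)).
  by rewrite big_seq [leRHS]big_seq; apply: ler_sum => v; exact: size_low.
rewrite big_const_seq count_predT iter_addr addr0 -[leLHS]mulr_natl.
rewrite ler_wpM2r ?ler_nat//; apply: mulr_ge0; last exact: powR_ge0.
rewrite addr_ge0// mulr_ge0// divr_ge0 ?(ltW lncmax)//.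
have cmin1 : cmin <= 1 by rewrite (le_trans cminmax)// ltW.
by have := ln_le0 cmin1; have := ln_le0 R1le1; lra.
Qed.

(** For [rho < 1] the condition [r <= rho^(1 + delta)] reads [delta * ln (1 / rho) <= ln (rho / r)]:
    this turns the depth of the cylinders into a logarithm of [rho / r]. For [rho >= 1] the root is
    the only large cylinder. The factor [M] keeps [M * (rho / r)] at least 1 even when [r > rho]. *)
Lemma scale_choice (M delta rho r : R) : 1 <= M -> 0 < delta -> 0 < r -> 0 < rho ->
  r <= rho `^ (1 + delta) -> rho `^ (1 + delta) <= M ->
  exists R1 r1 : R, [/\ [/\ 0 < r1, r1 <= R1 & R1 <= 1], r1 * M <= r /\ (R1 < 1 -> rho = R1),
    R1 / (cmin * r1) <= M / cmin * (M * (rho / r)),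
    - ln R1 <= ln (M * (rho / r)) / delta & 1 <= M * (rho / r)].
Proof.
move=> M1 delta0 r0 rho0 rrho rhoM.
have M0 : 0 < M by exact: lt_le_trans M1.
have X0 : 0 < M * (rho / r) by rewrite mulr_gt0// divr_gt0.
have [rho1|rho1] := ltP rho 1.
  have r_rho : r <= rho.
    apply: (le_trans rrho); rewrite -[leRHS](powRr1 (ltW rho0)) ger_powR ?rho0 ?(ltW rho1)//.
    by rewrite lerDl ltW.
  have X1 : 1 <= rho / r by rewrite ler_pdivlMr// mul1r.
  have X1' : 1 <= M * (rho / r) by rewrite mulr_ege1.
  exists rho, (r / M); split=> //.
  - split; [exact: divr_gt0| |exact: ltW].
    by apply: le_trans r_rho; rewrite ler_pdivrMr// ler_peMr// ltW.
  - by split=> //; rewrite divfK// gt_eqF.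
  - have -> : rho / (cmin * (r / M)) = (M * (rho / r)) / cmin by field; rewrite !gt_eqF.
    by rewrite [leRHS]mulrAC ler_wpM2r ?invr_ge0 ?(ltW cmin0)// ler_peMl// ltW.
  rewrite ler_pdivlMr//.
  have h : ln r <= (1 + delta) * ln rho.
    by rewrite -ln_powR ler_ln// posrE powR_gt0.
  have -> : ln (M * (rho / r)) = ln M + (ln rho - ln r).
    by rewrite lnM ?posrE ?divr_gt0// ln_div ?posrE.
  have := ln_ge0 M1; lra.
have rM : r <= M by exact: le_trans rhoM.
have X1 : 1 <= M * (rho / r).
  by rewrite mulrA ler_pdivlMr// mul1r (le_trans rM)// ler_peMr// ltW.
have m0 : 0 < Num.min r 1 by rewrite lt_min r0/=.
exists 1, (Num.min r 1 / M); split=> //.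
- split; [exact: divr_gt0| |exact: lexx].
  by rewrite ler_pdivrMr// mul1r ge_min M1 orbT.
- by split=> [|]; rewrite ?ltxx// divfK ?gt_eqF// ge_min lexx.
- have -> : 1 / (cmin * (Num.min r 1 / M)) = M / cmin * (Num.min r 1)^-1.
    by field; rewrite !gt_eqF.
  rewrite ler_wpM2l ?divr_ge0 ?(ltW M0) ?(ltW cmin0)//.
  case: (leP r 1) => r1; last by rewrite invr1.
  rewrite mulrA -[leLHS]mul1r ler_wpM2r ?invr_ge0 ?(ltW r0)//.
  by rewrite mulr_ege1.
by rewrite ln1 oppr0 divr_ge0 ?(ltW delta0)// ln_ge0.
Qed.

Lemma qA_exponent_le t alpha delta tau B K : 0 <= t -> t < alpha -> 0 < delta -> 0 <= K ->
  (forall v n, total_mass (weight c t) n (subtree v tau) <= B + K * (size v)%:R) ->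
  (qA_exponent delta (random_set D tau) <= alpha%:E)%E.
Proof.
move=> t0 ta delta0 K0 hB.
have [K1 [M [K11 M1 hM count]]] := local_cover_count.
have M0 : 0 < M by exact: lt_le_trans M1.
have alpha0 : 0 <= alpha by rewrite (le_trans t0)// ltW.
(* With [X = M * (rho / r)], the power [X^t] accounts for the cylinders, and the spare power [X^e]
   absorbs the depth factor through [ln X <= X^e / e]. *)
pose e := alpha - t; have e0 : 0 < e by rewrite subr_gt0.
have cmax0 : 0 < cmax by exact: lt_le_trans cminmax.
have lncmax : 0 < - ln cmax by rewrite oppr_gt0 ln_lt0// cmax0.
have lncmin : 0 <= - ln cmin by rewrite oppr_ge0 ln_le0// (le_trans cminmax)// ltW.
pose C1 := `|B| + K * ((- ln cmin + (e * delta)^-1) / - ln cmax) + 1.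
have C1p : 0 < C1.
  rewrite ltr_wpDl// addr_ge0// mulr_ge0// divr_ge0 ?(ltW lncmax)// addr_ge0//.
  by rewrite invr_ge0 mulr_ge0// ltW.
apply: ereal_inf_lbound; exists alpha => //; split=> //.
exists (K1 * (C1 * (M / cmin) `^ t) * M `^ alpha).
  have K10 : 0 < K1 by exact: lt_le_trans K11.
  have p0 : 0 < (M / cmin) `^ t by rewrite powR_gt0// divr_gt0.
  by rewrite !mulr_gt0// powR_gt0.
move=> r rho r0 rho0 rrho rhoF.
have rhoM : rho `^ (1 + delta) <= M.
  rewrite -lee_fin; apply: (le_trans rhoF); apply: diam_le; first exact: ltW.
  by move=> x y /random_set_sub Dx /random_set_sub Dy; exact: hM.
have [R1 [r1 [[r10 r1R R11] [r1M Rrho] ratio_le ln_le X1]]] :=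
  scale_choice M1 delta0 r0 rho0 rrho rhoM.
apply: (le_trans (count t tau B K t0 K0 hB R1 r1 rho r r10 r1R R11 r1M Rrho)).
rewrite lee_fin -!mulrA ler_wpM2l ?(le_trans ler01)//.
set X := M * (rho / r) in X1 ln_le ratio_le.
have X0 : 0 < X by exact: lt_le_trans X1.
have XaE : M `^ alpha * (rho / r) `^ alpha = X `^ e * X `^ t.
  rewrite -powRM ?(ltW M0) ?divr_ge0 ?(ltW rho0) ?(ltW r0)// -/X -powRD ?subrK//.
  by rewrite (gt_eqF X0) implybT.
rewrite XaE.
have Xe1 : 1 <= X `^ e by rewrite -(powRr0 X) ler_powR// ltW.
have -> : C1 * ((M / cmin) `^ t * (X `^ e * X `^ t)) = (C1 * X `^ e) * ((M / cmin) `^ t * X `^ t).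
  by ring.
apply: ler_pM; rewrite ?powR_ge0//.
- rewrite addr_ge0// mulr_ge0// divr_ge0 ?(ltW lncmax)//.
  by have := ln_le0 R11; lra.
- have lnX : - ln R1 <= (e * delta)^-1 * X `^ e.
    apply: (le_trans ln_le); rewrite invfM -mulrA mulrC [leRHS]mulrCA.
    rewrite ler_wpM2l ?invr_ge0 ?(ltW delta0)// mulrC.
    exact: ln_le_powR.
  have h1 : (- ln cmin - ln R1) / - ln cmax <=
      (- ln cmin + (e * delta)^-1) / - ln cmax * X `^ e.
    rewrite [leRHS]mulrAC ler_wpM2r ?invr_ge0 ?(ltW lncmax)// mulrDl.
    by apply: lerD => //; rewrite ler_peMr.
  have h2 := ler_wpM2l K0 h1.
  have h3 : `|B| <= `|B| * X `^ e by rewrite ler_peMr.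
  by rewrite /C1 [leRHS]mulrDl [X in _ <= X + _]mulrDl -(mulrA K) mul1r ler_wpDr ?powR_ge0// lerD.
rewrite -powRM ?(ltW X0) ?divr_ge0 ?(ltW M0) ?(ltW cmin0)//.
apply: ge0_ler_powR; rewrite ?nnegrE//.
  by rewrite divr_ge0 ?mulr_ge0 ?(ltW cmin0) ?(ltW r10)// (le_trans (ltW r10)).
by rewrite mulr_ge0 ?divr_ge0 ?(ltW X0) ?(ltW M0) ?(ltW cmin0).
Qed.

End QuasiAssouadUpperBound.
(** * The almost sure dimension *)

Lemma measurable_borel_coord {R : realType} {d : nat} (j : 'I_d) :
  measurable_fun [set: borel 'rV[R]_d] (fun x : borel 'rV[R]_d => x 0 j).
Proof.
apply: (measurability _ (RGenOInfty.measurableE R)) => _ [_ [x ->] <-].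
rewrite setTI; apply: sub_sigma_algebra.
apply: (@open_comp _ _ (fun y : 'rV[R]_d => y 0 j)); last by rewrite set_itvE; exact: open_gt.
by move=> y _; exact: coord_continuous.
Qed.

(** * Measurability of the weights *)

Section WeightMeasurability.
Context {R : realType} {k d Nmax : nat} {L : rifs R k d Nmax}.
Local Notation Lab := (borel (label (rifs_index L))).
Context (c : label (rifs_index L) -> 'I_Nmax -> R).
Context (hsim : forall l (i : 'I_Nmax), (i < rifs_arity l)%N ->
  similarity (c l i) (rifs_map l i)).

(** The ratio is recovered as the distance between the images of a unit vector and of 0, which is
    measurable in the label. In dimension 0 the maps do not determine it. *)
Lemma measurable_weight (t : R) (i : 'I_Nmax) : (0 < d)%N ->
  measurable_fun [set: Lab] (weight c t i).
Proof.
case: d L c hsim => // d' L' c' hsim' _.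
pose j0 : 'I_d'.+1 := ord0.
have e1 : enorm (delta_mx 0 j0 - 0 : 'rV[R]_d'.+1) = 1.
  rewrite subr0 /enorm (bigD1 j0)//= big1 ?addr0 ?mxE ?eqxx ?expr1n ?sqrtr1//.
  by move=> j jj; rewrite mxE eqxx (negPf jj) expr0n.
pose h (l : borel (label (rifs_index L'))) :=
  enorm (rifs_map l i (delta_mx 0 j0) - rifs_map l i 0).
have mh : measurable_fun [set l : borel (label (rifs_index L')) | (i < rifs_arity l)%N] h.
  apply: measurableT_comp.
    apply: continuous_measurable_fun; exact: sqrt_continuous.
  apply: measurable_sum => j; apply: measurable_funX.
  rewrite (_ : (fun l => _) = (fun l : borel (label (rifs_index L')) =>
      rifs_map l i (delta_mx 0 j0) 0 j) \- (fun l => rifs_map l i 0 0 j)).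
    have mf x : measurable_fun [set l : borel (label (rifs_index L')) | (i < rifs_arity l)%N]
        (fun l => rifs_map l i x 0 j).
      exact: measurableT_comp (measurable_borel_coord j) (@rifs_map_measurable _ _ _ _ L' i x).
    by apply: measurable_funB; exact: mf.
  by apply: funext => l; rewrite !mxE.
have -> : weight c' t i = fun l => if (i < rifs_arity l)%N then h l `^ t else 0.
  apply: funext => l; rewrite /weight; case: ifP => // il.
  by rewrite /h (hsim' l i il) e1 mulr1.
have mi : measurable_fun [set: borel (label (rifs_index L'))] (fun l => (i < rifs_arity l)%N).
  have mi : measurable_fun [set: nat] (fun n => (i < n)%N) by [].
  exact: measurableT_comp mi (@rifs_arity_measurable _ _ _ _ L').
apply: measurable_fun_if => //.
rewrite setTI; exact: measurableT_comp (@measurable_powR R t) mh.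
Qed.

End WeightMeasurability.

(** * Vanishing capacity as a hereditary event *)

Section VanishingHereditary.
Context {R : realType} {k d Nmax : nat} {L : rifs R k d Nmax}.
Local Notation Lab := (borel (label (rifs_index L))).
Local Notation Tree := (labelled_tree L).
Context (a : 'I_Nmax -> Lab -> R) (m : R) (m0 : 0 < m).
Context (ma : forall i, measurable_fun [set: Lab] (a i)).
Context (a_ge0 : forall i l, 0 <= a i l) (a_le1 : forall i l, a i l <= 1).
Context (a_gem : forall (i : 'I_Nmax) l, (i < rifs_arity l)%N -> m <= a i l).
Context (a_eq0 : forall (i : 'I_Nmax) (l : Lab), (rifs_arity l <= i)%N -> a i l = 0).

(** The weight of a child present is at least [m], so a small capacity at the root forces small ones
    at the children. Conversely there are finitely many children and capacities decrease with the
    depth, so one depth serves all of them. *)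
Lemma hereditary_capacity_vanishing : hereditary (capacity_vanishing a).
Proof.
split; first exact: measurable_capacity_vanishing.
move=> tau; split=> [h i iN j|h j].
  have [j' hj'] : exists j', j'.+1%:R^-1 < m * j.+1%:R^-1.
    by apply: archimedean_inv_lt; rewrite mulr_gt0// invr_gt0.
  have [[|n] /= hn] := h j'.
    by move: hn; rewrite ltNge invf_le1 ?ler1n.
  exists n; have j'1 : j'.+1%:R^-1 <= 1 :> R by rewrite invf_le1 ?ler1n.
  rewrite -(ltr_pM2l m0); apply: le_lt_trans hj'.
  (* The threshold is at most 1, so it is the sum that lies below it. *)
  move: hn; rewrite gt_min => /orP[|hn]; first by rewrite ltNge j'1.
  apply: le_trans (ltW hn); rewrite (bigD1 i)//=.
  rewrite -[leLHS]addr0; apply: lerD.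
    by rewrite ler_wpM2r ?(capacity_ge0 a_ge0)// a_gem.
  by apply: sumr_ge0 => q _; rewrite mulr_ge0 ?(capacity_ge0 a_ge0).
pose e : R := (Nmax.+1%:R * j.+1%:R)^-1.
have e0 : 0 < e by rewrite invr_gt0 mulr_gt0.
have [j' hj'] := archimedean_inv_lt e0.
have ex_n (i : 'I_Nmax) : exists n, (i < rifs_arity (root_label tau))%N ->
    capacity a n (child i tau) < j'.+1%:R^-1.
  have [iN|iN] := boolP (i < rifs_arity (root_label tau))%N; last by exists 0%N.
  by have [q hq] := h i iN j'; exists q.
have [n hn] := choice ex_n.
pose N := (\max_(i < Nmax) n i)%N.
exists N.+1; apply: (le_lt_trans (capacity_le_sum _ _ _)).
apply: (@le_lt_trans _ _ (\sum_(i < Nmax) e)).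
  apply: ler_sum => i _.
  have [iN|iN] := ltnP i (rifs_arity (root_label tau)); last by rewrite a_eq0// mul0r ltW.
  rewrite -[leRHS]mul1r ler_pM// ?(capacity_ge0 a_ge0)//.
  apply: le_trans (ltW (lt_trans (hn i iN) hj')).
  by apply: (capacity_nonincreasing a_ge0); exact: (leq_bigmax i).
rewrite sumr_const card_ord -[ltLHS]mulr_natl /e invfM mulrA gtr_pMl ?invr_gt0//.
by rewrite ltr_pdivrMr// mul1r ltr_nat.
Qed.

End VanishingHereditary.

(** * The critical exponent *)

Lemma capacity_mono {R : realType} {k d Nmax : nat} {L : rifs R k d Nmax}
    (a b : 'I_Nmax -> borel (label (rifs_index L)) -> R) n tau :
  (forall i l, 0 <= a i l) -> (forall i l, a i l <= b i l) ->
  capacity a n tau <= capacity b n tau.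
Proof.
move=> a0 ab; elim: n tau => [|n IH] tau //=.
by rewrite le_min2// ler_sum// => i _; rewrite ler_pM// capacity_ge0.
Qed.

Section Dimension.
Context {R : realType} {k d Nmax : nat} {L : rifs R k d Nmax}.
Local Notation Tree := (labelled_tree L).
Local Notation Lab := (borel (label (rifs_index L))).
Local Notation E := 'rV[R]_d.
Context (c : label (rifs_index L) -> 'I_Nmax -> R) (cmin cmax : R).
Context (cmin0 : 0 < cmin) (cminmax : cmin <= cmax) (cmax1 : cmax < 1).
Context (hc : forall l (i : 'I_Nmax), (i < rifs_arity l)%N ->
  similarity (c l i) (rifs_map l i) /\ cmin <= c l i <= cmax).
Context (D : set E) (hD : invariant_compact L D).
Context (O : set E) (O0 : O !=set0) (oO : open O).
Context (hO : forall (l : label (rifs_index L)) (i : 'I_Nmax), (i < rifs_arity l)%N ->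
  rifs_map l i @` O `<=` O).
Context (hOd : forall (l : label (rifs_index L)) (i j : 'I_Nmax),
  (i < rifs_arity l)%N -> (j < rifs_arity l)%N ->
  (rifs_map l i @` O) `&` (rifs_map l j @` O) !=set0 -> i = j).
Context (P : probability Tree R) (hP : random_recursive_measure P).
Context (hN : non_extinguishing L).

Let c_itv l (i : 'I_Nmax) : (i < rifs_arity l)%N -> cmin <= c l i <= cmax.
Proof. by move=> /hc[]. Qed.

(** In dimension 0 the space is a point, so the open set condition leaves at most one map per system
    and the mean arity is at most 1. *)
Lemma dim_gt0_of_non_extinguishing : (0 < d)%N.
Proof.
rewrite lt0n; apply/eqP => d0; move: hN; rewrite /non_extinguishing ltNge => /negP; apply.
apply: (@le_trans _ _ (\int[rifs_law L]_(l in setT) (cst 1%E l)))%E.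
  apply: ge0_le_integral => //.
    by apply/measurable_EFinP; exact: (measurable_arity (fun n => n%:R)).
  move=> l _; rewrite lee_fin (ler_nat _ _ 1) leqNgt; apply/negP => N2.
  have Nm : (1 < Nmax)%N by apply: leq_trans N2 (rifs_arity_le l).
  have [x Ox] := O0.
  have /(congr1 val) // : Ordinal (ltnW Nm) = Ordinal Nm.
  apply: (@hOd l) => //=; first exact: ltnW.
  exists (rifs_map l (Ordinal (ltnW Nm)) x); split; first exact: imageP.
  exists x => //; apply/rowP => -[j jd]; exfalso; by rewrite d0 in jd.
by rewrite integral_cst//= probability_setT mule1.
Qed.

Let w t := @weight R k d Nmax L c t.

Let mw t i : measurable_fun [set: Lab] (w t i).
Proof.
by apply: measurable_weight dim_gt0_of_non_extinguishing => l j /hc[].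
Qed.

Let w_ge0 t i l : 0 <= w t i l. Proof. exact: weight_ge0. Qed.

Let cmax0 : 0 < cmax. Proof. exact: lt_le_trans cminmax. Qed.

Let w_decr t t' i l : t <= t' -> w t' i l <= cmax `^ (t' - t) * w t i l.
Proof.
move=> tt; rewrite /w /weight; case: ifP => iN; last by rewrite mulr0.
have /andP[c1 c2] := c_itv iN; have c0 := lt_le_trans cmin0 c1.
have -> : c l i `^ t' = c l i `^ (t' - t) * c l i `^ t.
  by rewrite -powRD ?subrK// (gt_eqF c0) implybT.
rewrite ler_wpM2r ?powR_ge0//; apply: ge0_ler_powR; rewrite ?nnegrE ?subr_ge0//; exact: ltW.
Qed.

Let cmaxp_le1 t : 0 <= t -> cmax `^ t <= 1.
Proof.
by move=> t0; rewrite -[leRHS](powRr0 cmax) ger_powR// cmax0 ltW.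
Qed.

Let w_le_w0 t i l : 0 <= t -> w t i l <= w 0 i l.
Proof.
move=> t0; apply: (le_trans (w_decr i l t0)); rewrite subr0.
by rewrite ler_piMl// cmaxp_le1.
Qed.

Let w0E i l : w 0 i l = if (i < rifs_arity l)%N then 1 else 0.
Proof. by rewrite /w /weight; case: ifP => // _; rewrite powRr0. Qed.

Let w_le1 t i l : 0 <= t -> w t i l <= 1.
Proof. by move=> /w_le_w0 /le_trans; apply; rewrite w0E; case: ifP. Qed.

Let w_gem t (i : 'I_Nmax) (l : Lab) : 0 <= t -> (i < rifs_arity l)%N -> cmin `^ t <= w t i l.
Proof.
move=> t0 iN; rewrite /w /weight iN; have /andP[c1 _] := c_itv iN.
by apply: ge0_ler_powR; rewrite ?nnegrE// ?(le_trans (ltW cmin0))// ltW.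
Qed.

Let w_eq0 t (i : 'I_Nmax) (l : Lab) : (rifs_arity l <= i)%N -> w t i l = 0.
Proof. by rewrite /w /weight leqNgt => /negPf ->. Qed.

Let hered t : 0 <= t -> hereditary (capacity_vanishing (w t)).
Proof.
move=> t0; apply: (@hereditary_capacity_vanishing _ _ _ _ _ (w t) (cmin `^ t)).
- exact: powR_gt0.
- exact: mw.
- exact: w_ge0.
- by move=> i l; exact: w_le1.
- by move=> i l; exact: w_gem.
- by move=> i l; exact: w_eq0.
Qed.

Lemma capacity0_ge1 tau v : adm tau v -> 1 <= capacity (w 0) (size v) tau.
Proof.
elim: v tau => [|i v IH] tau //= /andP[iN av]; rewrite le_min lexx/=.
rewrite (bigD1 i)//= w0E iN mul1r; apply: (le_trans (IH _ av)).
by rewrite lerDl sumr_ge0// => j _; rewrite mulr_ge0// capacity_ge0.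
Qed.

(* Extinction is treated as the vanishing of the capacity of exponent 0, so that
   it is hereditary for the same reason as the vanishing of exponent [t]. *)
Lemma random_set_extinct tau : capacity_vanishing (w 0) tau -> random_set D tau = set0.
Proof.
move=> /(_ 1%N)[n hn]; rewrite -subset0 => x.
case: n hn => [|n] hn.
  by move: hn; rewrite /= ltNge invf_le1 ?ler1n.
move=> /(@random_set_sub_level _ _ _ _ _ _ n.+1 tau (ltn0Sn n))[v [sv av] _].
have := capacity0_ge1 av; rewrite sv leNgt (lt_trans hn)//.
by rewrite invf_lt1 ?ltr1n.
Qed.

Let phi t := fine (\int[P]_tau (\sum_(i < Nmax) w t i (root_label tau))%:E).

Let mphi t : measurable_fun [set: Tree] (fun tau => (\sum_(i < Nmax) w t i (root_label tau))%:E).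
Proof.
apply/measurable_EFinP; apply: measurable_sum => i.
exact: measurableT_comp (mw t i) measurable_root_label.
Qed.

Let phiE t : 0 <= t -> (\int[P]_tau (\sum_(i < Nmax) w t i (root_label tau))%:E = (phi t)%:E)%E.
Proof.
move=> t0; rewrite fineK// ge0_fin_numE; last first.
  by apply: integral_ge0 => tau _; rewrite lee_fin sumr_ge0.
apply: (@le_lt_trans _ _ (\int[P]_tau (cst (Nmax%:R%:E) tau)))%E; last first.
  by rewrite integral_cst//= probability_setT mule1 ltry.
apply: ge0_le_integral => //.
  by move=> tau _; rewrite lee_fin sumr_ge0.
move=> tau _; rewrite lee_fin; apply: (@le_trans _ _ (\sum_(i < Nmax) 1)).
  by apply: ler_sum => i _; exact: w_le1.
by rewrite sumr_const card_ord.
Qed.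

Let phi0_gt1 : 1 < phi 0.
Proof.
rewrite -lte_fin -phiE//; move: hN; rewrite /non_extinguishing.
congr (_ < _)%E.
rewrite -(integral_root_label hP (f := fun l => (rifs_arity l)%:R%:E)).
- apply: eq_integral => tau _; congr EFin.
  under eq_bigr do rewrite w0E.
  rewrite -big_mkcond/= -(big_ord_widen Nmax (fun=> 1)) ?rifs_arity_le//.
  by rewrite sumr_const card_ord.
- by apply/measurable_EFinP; exact: (measurable_arity (fun n => n%:R)).
- by move=> l; rewrite lee_fin.
Qed.

Let phi_decr t t' : 0 <= t -> t <= t' -> phi t' <= cmax `^ (t' - t) * phi t.
Proof.
move=> t0 tt; rewrite -lee_fin EFinM -!phiE//; last exact: le_trans tt.
rewrite -ge0_integralZl//; first last.
- by rewrite lee_fin powR_ge0.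
- by move=> tau _; rewrite lee_fin sumr_ge0.
apply: ge0_le_integral => //.
- by move=> tau _; rewrite lee_fin sumr_ge0.
- exact: emeasurable_funM.
by move=> tau _; rewrite -EFinM lee_fin mulr_sumr ler_sum// => i _; exact: w_decr.
Qed.

Let critical := [set t : R | 0 <= t /\ 1 <= phi t].

Lemma critical_has_sup : has_sup critical.
Proof.
split; first by exists 0; split=> //; exact: ltW.
have lncmax : 0 < - ln cmax by rewrite oppr_gt0 ln_lt0// cmax0.
(* The bound solves [1 <= cmax^t * phi 0] for [t]. *)
exists (ln (phi 0) / - ln cmax) => t [t0 t1].
have p0 : 0 < phi 0 by exact: lt_trans phi0_gt1.
rewrite ler_pdivlMr// mulrN -ln_powR -lnV ?posrE ?powR_gt0//.
rewrite ler_ln ?posrE ?invr_gt0 ?powR_gt0// -div1r ler_pdivrMr ?powR_gt0//.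
by rewrite mulrC; apply: (le_trans t1); rewrite -[in leRHS](subr0 t); exact: phi_decr.
Qed.

Let s := sup critical.

Let s_ge0 : 0 <= s.
Proof. by apply: sup_ubound; [case: critical_has_sup|split=> //; exact: ltW]. Qed.

Let phi_lt1 t : s < t -> phi t < 1.
Proof.
move=> st; rewrite ltNge; apply/negP => t1; move: (st); rewrite ltNge => /negP; apply.
apply: sup_ubound; first by case: critical_has_sup.
by split=> //; exact: le_trans s_ge0 (ltW st).
Qed.

Let phi_gt1 t : 0 <= t -> t < s -> 1 < phi t.
Proof.
move=> t0 ts; have e0 : 0 < s - t by rewrite subr_gt0.
have [t' [t'0 t'1]] := sup_adherent e0 critical_has_sup.
rewrite opprB addrC subrK => tt'.
have h := le_trans t'1 (phi_decr t0 (ltW tt')).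
have q1 : cmax `^ (t' - t) < 1.
  have -> : 1 = 1 `^ (t' - t) :> R by rewrite powR1.
  by apply: gt0_ltr_powR; rewrite ?subr_gt0 ?nnegrE ?(ltW cmax0).
have q0 : 0 < cmax `^ (t' - t) by exact: powR_gt0.
nra.
Qed.

Let ae_lower t : 0 < t -> t < s ->
  {ae P, forall tau, random_set D tau !=set0 -> (t%:E <= dim_H (random_set D tau))%E}.
Proof.
move=> t0 ts.
have w1 i l : w t i l <= 1 by exact: w_le1 (ltW t0).
have B1 := capacity_vanishing_lt1 (mw t) (w_ge0 t) w1 hP (phi_gt1 (ltW t0) ts) (phiE (ltW t0)).
have AB : capacity_vanishing (w 0) `<=` capacity_vanishing (w t).
  move=> tau h j; have [n hn] := h j; exists n; apply: le_lt_trans hn.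
  by apply: capacity_mono => // i l; exact: w_le_w0 (ltW t0).
have z := hereditary_eq_mod0 hP hN (hered (lexx 0)) (hered (ltW t0)) AB B1.
(* Off this null set either the capacities stay above some [1/(j+1)], which bounds every cover from
   below, or the tree is extinct and the set empty. *)
exists (capacity_vanishing (w t) `\` capacity_vanishing (w 0)); split=> //.
  by apply: measurableD; [case: (hered (ltW t0))|case: (hered (lexx 0))].
move=> tau /= h; split.
  move=> j; apply: contrapT => /forallNP hj; apply: h => _.
  have eta0 : 0 < (j.+1%:R : R)^-1 by rewrite invr_gt0.
  have [K hK] := capacity_le_cover cmin0 cminmax cmax1 hc hD O0 oO hO hOd.
  apply: (dim_H_ge_of_cover (K := K%:R) t0 eta0) => // b x rho hrho cov.
  apply: (hK t tau _ b x rho) => //; last exact: ltW.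
  by move=> n; rewrite leNgt; apply/negP; exact: hj.
by move=> /random_set_extinct F0; apply: h; rewrite F0 => -[].
Qed.

(** Countably many exponents on either side of [s] suffice, and the mass bounds do not involve
    [delta], so one null set serves every [delta]. *)
Lemma ae_dim_qA_eq_dim_H :
  {ae P, forall tau, dim_qA (random_set D tau) = dim_H (random_set D tau)}.
Proof.
have lower : {ae P, forall tau, forall j : nat, 0 < s - j.+1%:R^-1 -> random_set D tau !=set0 ->
    ((s - j.+1%:R^-1)%:E <= dim_H (random_set D tau))%E}.
  apply: ae_foralln => j.
  have [t0|t0] := ltP 0 (s - j.+1%:R^-1); last by apply: filterE => tau.
  have ts : s - j.+1%:R^-1 < s by rewrite gtrBl invr_gt0.
  by apply: filterS (ae_lower t0 ts) => tau h _.
have upper : {ae P, forall tau, forall j : nat, exists B K : R, 0 <= K /\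
    forall v n, total_mass (w (s + j.+1%:R^-1)) n (subtree v tau) <= B + K * (size v)%:R}.
  apply: ae_foralln => j.
  have ts : s < s + j.+1%:R^-1 by rewrite ltrDl invr_gt0.
  have t0 : 0 <= s + j.+1%:R^-1 by exact: le_trans s_ge0 (ltW ts).
  apply: (ae_total_mass_bounded hP (mw _) (w_ge0 _) _ (phi_lt1 ts) (phiE t0)) => i l.
  exact: w_le1.
apply: filterS2 lower upper => tau low up.
set F := random_set D tau.
have [M hM] := compact_enorm_bounded hD.
have FM x y : F x -> F y -> enorm (x - y) <= M.
  by move=> /(random_set_sub hD) Dx /(random_set_sub hD) Dy; exact: hM.
apply: dim_qA_eq => delta delta0; apply/eqP; rewrite eq_le (dim_H_le_qA_exponent delta0 FM) andbT.
(* For the empty set the supremum over the centres is [-oo], so the exponent 0 is admissible. *)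
have [F0|/set0P Fne] := eqVneq F set0.
  apply: le_trans (dim_H_ge0 _); apply: ereal_inf_lbound; exists 0 => //; split=> //.
  exists 1 => // r rho _ _ _ _; rewrite /local_cover_number F0 image_set0 ereal_sup0.
  exact: leNye.
apply: (@le_trans _ _ s%:E); apply/lee_addgt0Pr => e e0.
  have [j hj] := archimedean_inv_lt (divr_gt0 e0 (ltr0n R 2)).
  have [B [K [K0 hB]]] := up j.
  have ts : s < s + j.+1%:R^-1 by rewrite ltrDl invr_gt0.
  rewrite -EFinD; apply: (qA_exponent_le cmin0 cminmax cmax1 hc hD O0 oO hO hOd
    (le_trans s_ge0 (ltW ts)) _ delta0 K0 hB).
  by rewrite ltrD2l (lt_trans hj)// ltr_pdivrMr// ltr_pMr// ltr1n.
have [j hj] := archimedean_inv_lt e0.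
have [t0|t0] := ltP 0 (s - j.+1%:R^-1).
  apply: (@le_trans _ _ ((s - j.+1%:R^-1)%:E + e%:E)%E).
    by rewrite -EFinD lee_fin -addrA lerDl addrC subr_ge0 ltW.
  by rewrite leeD2r// low.
apply: (@le_trans _ _ (0%E + e%:E)%E); last by rewrite leeD2r// dim_H_ge0.
by rewrite add0e lee_fin (le_trans _ (ltW hj))// -subr_le0.
Qed.

End Dimension.

Theorem theorem2p6 (R : realType) (k d Nmax : nat) (L : rifs R k d Nmax)
    (cmin cmax : R) (c : label (rifs_index L) -> 'I_Nmax -> R)
    (P : probability (labelled_tree L) R) (D : set 'rV[R]_d) :
  non_extinguishing L ->
  uosc L ->
  0 < cmin -> cmin <= cmax -> cmax < 1 ->
  (forall l (i : 'I_Nmax), label_val l <> 0 -> (i < rifs_arity l)%N ->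
     similarity (c l i) (rifs_map l i) /\ cmin <= c l i <= cmax) ->
  random_recursive_measure P ->
  invariant_compact L D ->
  {ae P, forall tau, dim_qA (random_set D tau) = dim_H (random_set D tau)}.
Proof.
move=> hN [U [U0 _ oU hU]] cmin0 cminmax cmax1 hc hP hD.
(* A label of value 0 has arity 0, so the hypotheses on the other labels cover every map in use. *)
have ne0 (l : label (rifs_index L)) (i : 'I_Nmax) : (i < rifs_arity l)%N -> label_val l <> 0.
  by move=> il l0; rewrite (rifs_arity0 l0) in il.
apply: (@ae_dim_qA_eq_dim_H R k d Nmax L c cmin cmax cmin0 cminmax cmax1 _ D hD U U0 oU) => //.
- by move=> l i il; exact: (hc l i (ne0 _ _ il) il).
- by move=> l i il; have [h _] := hU l (ne0 _ _ il); exact: h.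
- by move=> l i j il jl; have [_ h] := hU l (ne0 _ _ il); exact: h.
Qed.
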